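(* Let $\lambda>0$, $\gamma\in\mathbb{R}$, $\Delta>0$, and let $\nu$ be a finite measure with $\nu(\mathbb{R})=\lambda$ and $\int\log^\beta(\max\{|x|,e\})\nu(dx)<\infty$ for some $\beta>2$. Let $Z_1,\dots,Z_n$ be i.i.d. $\Delta$-increments of the compound Poisson process with drift $\gamma$, intensity $\lambda$ and jump measure $\nu$, with law $P$, empirical measure $P_n$, characteristic function $\varphi$ and empirical characteristic function $\varphi_n$. Let $K$ be symmetric with $K\in L^1(\mathbb{R})$ and $\mathrm{supp}\,\mathcal{F}K\subseteq[-1,1]$, and let $h_n\to0$ with $\log(h_n^{-1})/n^{1/(1+2\delta)}\to0$ for some $\delta>0$. Let $g_n\in L^2(\mathbb{R})$ satisfy $$\int_{-h_n^{-1}}^{h_n^{-1}}|\mathcal{F}g_n(u)|du=o\big(n^{1/2}(\log h_n^{-1})^{-(1+2\delta)}\big),\quad \sup_n\sup_x|g_n(x)|<\infty,$$ and suppose $g:=\lim_{n\to\infty}g_n*K_{h_n}$ exists at every point. Then, on events whose probability tends to one, $$\sqrt n\frac1\Delta\int g_n(x)\mathcal{F}^{-1}\Big[\mathrm{Log}\frac{\varphi_n}{\varphi}\mathcal{F}K_{h_n}\Big](x)dx=\sqrt n\frac1\Delta\int\big(g_n*K_{h_n}*M\big)(x)(P_n-P)(dx)+\sqrt n\frac1{2\pi\Delta}\int\mathcal{F}g_n(-u)R_n(u)\mathcal{F}K_{h_n}(u)du,$$ and, as $n\to\infty$, this quantity converges in distribution to $N(0,\sigma_g^2)$, where $\sigma_g^2$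 is finite and $$\Delta^2\sigma_g^2=\int\big((g*M)(x)-g(0)\big)^2P(dx)=\int\big((g*M)(x)\big)^2P(dx)-g(0)^2.$$
   Context: $\mathcal{F}\mu(u)=\int e^{iux}\mu(dx)$, $\mathcal{F}^{-1}g(x)=(2\pi)^{-1}\int e^{-iux}g(u)du$. $\varphi(u)=\exp(\Delta(i\gamma u+\mathcal{F}\nu(u)-\lambda))$, $\varphi_n(u)=n^{-1}\sum_ke^{iuZ_k}$, $P_n=n^{-1}\sum_k\delta_{Z_k}$, $\varphi^{-1}=1/\varphi$, $M:=\mathcal{F}^{-1}[\varphi^{-1}(-\cdot)]=e^{\lambda\Delta}\delta_{\gamma\Delta}*\sum_{k\ge0}\bar\nu^{*k}(-\Delta)^k/k!$ ($\bar\nu(A)=\nu(-A)$, $\bar\nu^{*0}=\delta_0$); $f*\mu(x)=\int f(x-y)\mu(dy)$; $K_h=h^{-1}K(\cdot/h)$. On the event that $\varphi_n/\varphi$ does not vanish on $[-h_n^{-1},h_n^{-1}]$, $\mathrm{Log}(\varphi_n/\varphi)$ is its continuous logarithm there with value $0$ at $u=0$ (it is multiplied by $\mathcal{F}K_{h_n}$, supported in $[-h_n^{-1},h_n^{-1}]$). $R_n(u):=R(\varphi_n(u)/\varphi(u))$ with $R(z)=\int_1^z(s-z)s^{-2}ds$. *)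

(* Defs.v *)
From HB Require Import structures.
From mathcomp Require Import all_boot all_order all_algebra.
From mathcomp Require Import all_classical all_reals all_analysis.
From mathcomp Require Import complex.
Import Order.TTheory GRing.Theory Num.Theory.
Import numFieldTopology.Exports numFieldNormedType.Exports.

Set Implicit Arguments.
Unset Strict Implicit.
Unset Printing Implicit Defensive.

Local Open Scope classical_set_scope.
Local Open Scope ring_scope.
Local Open Scope complex_scope.

Section Defs.
Variable R : realType.

Definition cre (z : R[i]) : R := let: a +i* _ := z in a.
Definition cim (z : R[i]) : R := let: _ +i* b := z in b.
Definition cabs (z : R[i]) : R := Num.sqrt (cre z ^+ 2 + cim z ^+ 2).

Definition cexp (z : R[i]) : R[i] :=
  (expR (cre z) * cos (cim z)) +i* (expR (cre z) * sin (cim z)).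
Definition eiu (t : R) : R[i] := cos t +i* sin t.

(* real integral w.r.t. a measure (junk value 0 if infinite) *)
Definition Rinteg d (T : measurableType d) (mu : set T -> \bar R) (f : T -> R) : R :=
  fine (\int[mu]_x (f x)%:E).
Definition cint d (T : measurableType d) (mu : set T -> \bar R) (f : T -> R[i]) : R[i] :=
  Rinteg mu (fun x => cre (f x)) +i* Rinteg mu (fun x => cim (f x)).

Definition leb := (@lebesgue_measure R).

Definition charfun d (T : measurableType d) (mu : set T -> \bar R) (X : T -> R) (u : R) : R[i] :=
  cint mu (fun x => eiu (u * X x)).
Definition mfourier (mu : set (measurableTypeR R) -> \bar R) (u : R) : R[i] :=
  charfun mu id u.
Definition fourier (f : R -> R) (u : R) : R[i] :=
  cint leb (fun x => eiu (u * x) * (f x)%:C).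
Definition ifourier (H : R -> R[i]) (x : R) : R[i] :=
  ((pi *+ 2)^-1)%:C * cint leb (fun u => eiu (- (u * x)) * H u).

Definition is_L2_fourier (g : R -> R) (G : R -> R[i]) : Prop :=
  measurable_fun setT (fun u => cre (G u)) /\
  measurable_fun setT (fun u => cim (G u)) /\
  (fun A : nat =>
     (\int[leb]_u ((cabs (G u - fourier (fun x => \1_`[- A%:R, A%:R] x * g x) u)) ^+ 2)%:E)%E)
    @ \oo --> 0%E.

Definition fconv (f k : R -> R) (x : R) : R := Rinteg leb (fun y => f (x - y) * k y).
Definition Kh (h : R) (K : R -> R) (x : R) : R := h^-1 * K (x / h).

(* f * nubar^{*k}, with nubar(A) = nu(-A):
   (f * nubar)(x) = int f(x - y) nubar(dy) = int f(x + y) nu(dy) *)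
Definition conv_nubar_pow (nu : set (measurableTypeR R) -> \bar R) (f : R -> R) (k : nat) : R -> R :=
  iter k (fun f' x => Rinteg nu (fun y => f' (x + y))) f.

(* (f * M)(x) with M = e^{lambda Delta} delta_{gamma Delta} * sum_k nubar^{*k} (-Delta)^k / k! *)
Definition convM (gam lam Del : R) (nu : set (measurableTypeR R) -> \bar R) (f : R -> R) (x : R) : R :=
  expR (lam * Del) *
  limn (series ((fun k : nat =>
    (- Del) ^+ k / (k`!)%:R * conv_nubar_pow nu f k (x - gam * Del)) : R^nat)).

Definition cpp_phi (gam lam Del : R) (nu : set (measurableTypeR R) -> \bar R) (u : R) : R[i] :=
  cexp (Del%:C * ((0 +i* (gam * u)) + mfourier nu u - lam%:C)).

Definition phin d (T : measurableType d) (Z : nat -> T -> R) (n : nat) (w : T) (u : R) : R[i] :=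
  (n%:R^-1)%:C * \sum_(k < n) eiu (u * Z k w).

(* theta is a continuous argument of z on [-A, A], vanishing at 0, i.e.
   ln|z| + i theta is the continuous logarithm of z on [-A,A] with value 0 at 0 *)
Definition is_cont_arg (A : R) (z : R -> R[i]) (theta : R -> R) : Prop :=
  {within `[- A, A], continuous theta} /\ theta 0 = 0 /\
  forall u, `|u| <= A -> z u = (cabs (z u))%:C * eiu (theta u).
(* the continuous logarithm Log z built from theta (set to 0 outside [-A,A];
   it only gets multiplied by a function supported in [-A,A]) *)
Definition cLog (A : R) (z : R -> R[i]) (theta : R -> R) (u : R) : R[i] :=
  if `|u| <= A then ln (cabs (z u)) +i* theta u else 0.

(* R(z) = int_1^z (s - z) s^{-2} ds, along the segment s = 1 + t (z - 1), t in [0,1] *)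
Definition Rfun (z : R[i]) : R[i] :=
  cint leb (fun t : R => (\1_`[0, 1] t)%:C *
    (((1 + t%:C * (z - 1)) - z) / (1 + t%:C * (z - 1)) ^+ 2 * (z - 1))).

Definition iid_law d (T : measurableType d) (Pr : probability T R) (Z : nat -> T -> R)
  (P : probability (measurableTypeR R) R) : Prop :=
  (forall k, measurable_fun setT (Z k)) /\
  (forall k (B : set (measurableTypeR R)), measurable B -> Pr (Z k @^-1` B) = P B) /\
  (forall (s : seq nat) (B : nat -> set (measurableTypeR R)), uniq s ->
     (forall k, measurable (B k)) ->
     fine (Pr (\bigcap_(k in [set` s]) (Z k @^-1` B k))) =
       \prod_(k <- s) fine (Pr (Z k @^-1` B k))).

(* T_n converges in distribution to N(0, s2) (s2 >= 0; N(0,0) = delta_0) *)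
Definition cvg_dist_normal d (T : measurableType d) (Pr : probability T R)
  (Tn : nat -> T -> R) (s2 : R) : Prop :=
  forall f : R -> R, continuous f -> (exists C, forall x, `|f x| <= C) ->
    (fun n => Rinteg Pr (fun w => f (Tn n w))) @ \oo -->
      Rinteg leb (fun x => f (Num.sqrt s2 * x) * normal_pdf 0 1 x).

End Defs.

(* Main.v *)
Require Import Defs.
From mathcomp Require Import all_boot all_order all_algebra.
From mathcomp Require Import all_classical all_reals all_analysis.
From mathcomp Require Import measurable_realfun lebesgue_integral_under ftc complex.
From mathcomp Require Import ring lra.
Import Order.TTheory GRing.Theory Num.Theory.
Import numFieldTopology.Exports numFieldNormedType.Exports.
Set Implicit Arguments.
Unset Strict Implicit.
Unset Printing Implicit Defensive.
Local Open Scope classical_set_scope.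
Local Open Scope ring_scope.
Local Open Scope complex_scope.

(** On the event where [|phin - phi| <= 1 / (2 sup |1/phi|)] on [[-1/h_n, 1/h_n]], the quotient
    [z = phin / phi] stays in the disc [|z - 1| <= 1/2], so its continuous logarithm is the principal
    one and [Log z = (z - 1) + R(z)].  Parseval's identity, applied to the bounded compactly supported
    function [Log z * F K_h], turns the left-hand side into the integral of [F g_n(-u)] against
    [(z - 1) F K_h] and [R(z) F K_h].  The first part is the centred empirical mean of
    [g_n * K_h * M], because [g_n * K_h] and its convolution with [M] are inverse Fourier integrals
    of [F g_n(-u) F K_h(u)] and of the same function divided by [phi].  The event has probability
    tending to one by exponential Markov bounds on a grid of mesh [1/n], whose cardinality
    [2 n / h_n] is killed by [log (1/h_n) = o(n)]; between grid points the increments of [phin] and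
    [phi] are averages of [min(2, |x|/n)].  The remainder is quadratic in [phin - phi], of
    expectation [O(1/n)], hence negligible after multiplication by [sqrt n] and integration against
    [|F g_n|].  The linear part is a triangular array of bounded i.i.d. variables: its characteristic
    functions converge, and the continuity theorem is obtained by Gaussian smoothing of compactly
    supported test functions.  The limit variance follows by dominated convergence, since
    [g_n * K_h * M -> g * M] pointwise and [E (g_n * K_h * M)(Z) = g_n * K_h (0)]. *)

(** The modulus of [1 / phi] is at most [exp (2 lam Del)] at every frequency. A fixed tolerance for
    [phin - phi] therefore makes the logarithm principal on a window that grows with [n], and at a
    fixed tolerance the exponential rate in [n] absorbs the number of grid points. Two features of
    the data shape the rest. The transform of [g_n] is given only as an [L^2] limit of truncated
    transforms; this is why Parseval is proved against bounded integrable [H] alone, where the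
    square integrability of the inverse transform of [H] suffices. No power moment of [P] is
    available; this is why increments in the frequency are measured by a truncated modulus. The
    measure [M] enters through the power series of [exp (- Del F nu)]: its partial sums correspond
    to finite combinations of iterated convolutions and are dominated by [exp (lam Del)] in
    frequency. At the end the characteristic function of the whole statistic is compared with that
    of its linear part: on the good event by the mean of the remainder bound, off it by twice the
    probability of the complement. *)

(** * Complex numbers through their real and imaginary parts *)

Section ComplexParts.
Context {R : realType}.
Implicit Types (z w : R[i]) (x y t : R).

Lemma creD z w : cre (z + w) = cre z + cre w. Proof. by case: z; case: w. Qed.
Lemma cimD z w : cim (z + w) = cim z + cim w. Proof. by case: z; case: w. Qed.
Lemma creN z : cre (- z) = - cre z. Proof. by case: z. Qed.
Lemma cimN z : cim (- z) = - cim z. Proof. by case: z. Qed.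
Lemma creB z w : cre (z - w) = cre z - cre w. Proof. by case: z; case: w. Qed.
Lemma cimB z w : cim (z - w) = cim z - cim w. Proof. by case: z; case: w. Qed.
Lemma creM z w : cre (z * w) = cre z * cre w - cim z * cim w.
Proof. by case: z; case: w. Qed.
Lemma cimM z w : cim (z * w) = cre z * cim w + cim z * cre w.
Proof. by case: z; case: w. Qed.
Lemma creC x : cre x%:C = x. Proof. by []. Qed.
Lemma cimC x : cim x%:C = 0. Proof. by []. Qed.
Lemma creJ z : cre (conjc z) = cre z. Proof. by case: z. Qed.
Lemma cimJ z : cim (conjc z) = - cim z. Proof. by case: z. Qed.
Lemma creV z : cre z^-1 = cre z / (cre z ^+ 2 + cim z ^+ 2).
Proof. by case: z. Qed.
Lemma cimV z : cim z^-1 = - (cim z / (cre z ^+ 2 + cim z ^+ 2)).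
Proof. by case: z. Qed.
Lemma cre0 : cre (0 : R[i]) = 0. Proof. by []. Qed.
Lemma cim0 : cim (0 : R[i]) = 0. Proof. by []. Qed.
Lemma cre1 : cre (1 : R[i]) = 1. Proof. by []. Qed.
Lemma cim1 : cim (1 : R[i]) = 0. Proof. by []. Qed.
Lemma cre_sum I (r : seq I) (P : pred I) (F : I -> R[i]) :
  cre (\sum_(i <- r | P i) F i) = \sum_(i <- r | P i) cre (F i).
Proof. exact: (big_morph _ creD cre0). Qed.
Lemma cim_sum I (r : seq I) (P : pred I) (F : I -> R[i]) :
  cim (\sum_(i <- r | P i) F i) = \sum_(i <- r | P i) cim (F i).
Proof. exact: (big_morph _ cimD cim0). Qed.
Lemma creZ x z : cre (x%:C * z) = x * cre z.
Proof. by rewrite creM mul0r subr0. Qed.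
Lemma cimZ x z : cim (x%:C * z) = x * cim z.
Proof. by rewrite cimM mul0r addr0. Qed.

Lemma complex_eqP z w : cre z = cre w -> cim z = cim w -> z = w.
Proof. by case: z w => a b [c d] /= -> ->. Qed.

Definition cparts := (creC, cimC, creD, cimD, creN, cimN, creB, cimB, creM, cimM,
  creJ, cimJ, cre0, cim0, cre1, cim1).

Lemma cabsE z : cabs z = Normc.normc z. Proof. by case: z. Qed.
Lemma cabs_ge0 z : 0 <= cabs z. Proof. exact: sqrtr_ge0. Qed.
Lemma cabsM z w : cabs (z * w) = cabs z * cabs w.
Proof. by rewrite !cabsE Normc.normcM. Qed.
Lemma cabsD z w : cabs (z + w) <= cabs z + cabs w.
Proof. by rewrite !cabsE le_normcD. Qed.
Lemma cabsN z : cabs (- z) = cabs z.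
Proof. by rewrite /cabs !cparts !sqrrN. Qed.
Lemma cabsB z w : cabs (z - w) <= cabs z + cabs w.
Proof. by rewrite -(cabsN w) cabsD. Qed.
Lemma cabsV z : cabs z^-1 = (cabs z)^-1.
Proof. by rewrite !cabsE Normc.normcV. Qed.
Lemma cabsJ z : cabs (conjc z) = cabs z.
Proof. by rewrite /cabs !cparts sqrrN. Qed.
Lemma cabsC x : cabs x%:C = `|x|.
Proof. by rewrite /cabs !cparts expr0n/= addr0 sqrtr_sqr. Qed.
Lemma cabs0 : cabs (0 : R[i]) = 0.
Proof. by rewrite -[0]/(0%:C) cabsC normr0. Qed.
Lemma cabs1 : cabs (1 : R[i]) = 1.
Proof. by rewrite -[1]/(1%:C) cabsC normr1. Qed.
Lemma cabsX z n : cabs (z ^+ n) = cabs z ^+ n.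
Proof. by elim: n => [|n IH]; rewrite ?expr0 ?cabs1// !exprS cabsM IH. Qed.
Lemma cabs_sqr z : cabs z ^+ 2 = cre z ^+ 2 + cim z ^+ 2.
Proof. by rewrite sqr_sqrtr// addr_ge0// sqr_ge0. Qed.
Lemma cabs_distC z w : cabs (z - w) = cabs (w - z).
Proof. by rewrite -cabsN opprB. Qed.
Lemma cabs_eq0 z : cabs z = 0 -> z = 0.
Proof. by rewrite cabsE => /Normc.eq0_normc. Qed.
Lemma cabs_gt0 z : z != 0 -> 0 < cabs z.
Proof.
by move=> z0; rewrite lt_def cabs_ge0 andbT; apply: contra z0 => /eqP/cabs_eq0 ->.
Qed.
Lemma cre_le_cabs z : `|cre z| <= cabs z.
Proof.
rewrite -(ler_pXn2r (n:=2)) ?nnegrE ?cabs_ge0//.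
by rewrite cabs_sqr real_normK ?num_real// lerDl sqr_ge0.
Qed.
Lemma cim_le_cabs z : `|cim z| <= cabs z.
Proof.
rewrite -(ler_pXn2r (n:=2)) ?nnegrE ?cabs_ge0//.
by rewrite cabs_sqr real_normK ?num_real// lerDr sqr_ge0.
Qed.
Lemma cabs_le_parts z : cabs z <= `|cre z| + `|cim z|.
Proof.
rewrite -(ler_pXn2r (n:=2)) ?nnegrE ?cabs_ge0 ?addr_ge0//.
rewrite cabs_sqr sqrrD !real_normK ?num_real//.
by rewrite lerD2r lerDl mulrn_wge0// mulr_ge0.
Qed.
Lemma cabs_sum I (r : seq I) (P : pred I) (F : I -> R[i]) :
  cabs (\sum_(i <- r | P i) F i) <= \sum_(i <- r | P i) cabs (F i).
Proof.
apply: (big_ind2 (fun z x => cabs z <= x)) => //; first by rewrite cabs0.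
by move=> z x w y zx wy; apply: (le_trans (cabsD _ _)); exact: lerD.
Qed.
Lemma mulJc z : (conjc z) * z = (cabs z ^+ 2)%:C.
Proof.
apply: complex_eqP; rewrite !cparts ?cabs_sqr; first by rewrite mulNr opprK !expr2.
by rewrite mulNr mulrC subrr.
Qed.

Lemma cabs_eiu t : cabs (eiu t) = 1.
Proof. by rewrite /cabs /= cos2Dsin2 sqrtr1. Qed.
Lemma eiuD t y : eiu (t + y) = eiu t * eiu y.
Proof.
by apply: complex_eqP; rewrite !cparts/= ?cosD// sinD [RHS]addrC; congr (_ + _); rewrite mulrC.
Qed.
Lemma eiu0 : eiu (0:R) = 1.
Proof. by rewrite /eiu cos0 sin0. Qed.
Lemma eiuN t : eiu (- t) = (conjc (eiu t)).
Proof. by rewrite /eiu cosN sinN. Qed.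
Lemma eiuB t y : eiu (t - y) = eiu t * eiu (- y).
Proof. exact: eiuD. Qed.
Lemma cexpE z : cexp z = (expR (cre z))%:C * eiu (cim z).
Proof. by apply: complex_eqP; rewrite ?creZ ?cimZ. Qed.
Lemma cexpD z w : cexp (z + w) = cexp z * cexp w.
Proof.
rewrite !cexpE !cparts expRD eiuD rmorphM/=.
by rewrite [LHS]mulrACA.
Qed.
Lemma cexp0 : cexp (0 : R[i]) = 1.
Proof. by rewrite cexpE expR0 eiu0 mulr1. Qed.
Lemma cabs_cexp z : cabs (cexp z) = expR (cre z).
Proof. by rewrite cexpE cabsM cabs_eiu mulr1 cabsC ger0_norm// expR_ge0. Qed.
Lemma cexp_neq0 z : cexp z != 0.
Proof.
apply/eqP => /(congr1 (@cabs R)); rewrite cabs_cexp cabs0 => /eqP.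
by rewrite gt_eqF// expR_gt0.
Qed.
Lemma cexpN z : cexp (- z) = (cexp z)^-1.
Proof.
by apply: (mulIf (cexp_neq0 z)); rewrite mulVf ?cexp_neq0// -cexpD addNr cexp0.
Qed.
End ComplexParts.

(** * Measurability of complex functions, componentwise *)

Section ComplexMeasurability.
Context {R : realType} d {T : measurableType d}.
Implicit Types (f g : T -> R[i]) (r : T -> R).

Definition cmeasurable f := measurable_fun setT (fun x => cre (f x)) /\
  measurable_fun setT (fun x => cim (f x)).

Lemma cmeasurable_cst (c : R[i]) : cmeasurable (fun=> c).
Proof. by split; exact: measurable_cst. Qed.
Lemma cmeasurableD f g : cmeasurable f -> cmeasurable g ->
  cmeasurable (fun x => f x + g x).
Proof.
move=> [f1 f2] [g1 g2]; split.
- under eq_fun do rewrite creD; exact: measurable_funD.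
- under eq_fun do rewrite cimD; exact: measurable_funD.
Qed.
Lemma cmeasurableM f g : cmeasurable f -> cmeasurable g ->
  cmeasurable (fun x => f x * g x).
Proof.
move=> [f1 f2] [g1 g2]; split.
- under eq_fun do rewrite creM.
  by apply: measurable_funB; apply: measurable_funM.
- under eq_fun do rewrite cimM.
  by apply: measurable_funD; apply: measurable_funM.
Qed.
Lemma cmeasurable_real r : measurable_fun setT r -> cmeasurable (fun x => (r x)%:C).
Proof. by move=> mr; split => //; exact: measurable_cst. Qed.
Lemma cmeasurableN f : cmeasurable f -> cmeasurable (fun x => - f x).
Proof.
move=> [f1 f2]; split.
- under eq_fun do rewrite creN; exact: measurable_funN.
- under eq_fun do rewrite cimN; exact: measurable_funN.
Qed.
Lemma cmeasurableB f g : cmeasurable f -> cmeasurable g ->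
  cmeasurable (fun x => f x - g x).
Proof. by move=> mf mg; apply: cmeasurableD => //; exact: cmeasurableN. Qed.
Lemma cmeasurableJ f : cmeasurable f -> cmeasurable (fun x => (conjc (f x))).
Proof.
move=> [f1 f2]; split; first by under eq_fun do rewrite creJ.
by under eq_fun do rewrite cimJ; exact: measurable_funN.
Qed.
Lemma cmeasurableX f n : cmeasurable f -> cmeasurable (fun x => f x ^+ n).
Proof.
move=> mf; elim: n => [|n IH].
  by under eq_fun do rewrite expr0; exact: cmeasurable_cst.
by under eq_fun do rewrite exprS; exact: cmeasurableM.
Qed.
Lemma cmeasurable_sum I (s : seq I) (F : I -> T -> R[i]) :
  (forall i, cmeasurable (F i)) -> cmeasurable (fun x => \sum_(i <- s) F i x).
Proof.
move=> mF; elim: s => [|i s IH].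
  by under eq_fun do rewrite big_nil; exact: cmeasurable_cst.
by under eq_fun do rewrite big_cons; exact: cmeasurableD.
Qed.
Lemma measurable_cos_comp r : measurable_fun setT r ->
  measurable_fun setT (fun x => cos (r x)).
Proof.
move=> mr; apply: (measurableT_comp (f := @cos R)) => //.
by apply: continuous_measurable_fun; exact: continuous_cos.
Qed.
Lemma measurable_sin_comp r : measurable_fun setT r ->
  measurable_fun setT (fun x => sin (r x)).
Proof.
move=> mr; apply: (measurableT_comp (f := @sin R)) => //.
by apply: continuous_measurable_fun; exact: continuous_sin.
Qed.
Lemma cmeasurable_eiu r : measurable_fun setT r -> cmeasurable (fun x => eiu (r x)).
Proof.
by move=> mr; split; [exact: measurable_cos_comp|exact: measurable_sin_comp].
Qed.
Lemma cmeasurable_cexp f : cmeasurable f -> cmeasurable (fun x => cexp (f x)).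
Proof.
move=> [f1 f2].
have -> : (fun x => cexp (f x)) = (fun x => (expR (cre (f x)))%:C * eiu (cim (f x))).
  by apply/funext => x; rewrite cexpE.
apply: cmeasurableM; last exact: cmeasurable_eiu.
by apply: cmeasurable_real; exact: (measurableT_comp (f := expR)).
Qed.
Lemma measurable_sqrtr r : measurable_fun setT r -> (forall x, 0 <= r x) ->
  measurable_fun setT (fun x => Num.sqrt (r x)).
Proof.
move=> mr r0; have -> : (fun x => Num.sqrt (r x)) = (fun x => powR (r x) 2^-1).
  by apply/funext => x; rewrite powR12_sqrt.
exact: (measurableT_comp (measurable_powR _)).
Qed.
(** The inverse is written [r * powR (r ^+ 2) (-1)], a power of a nonnegative base, to which the
    measurability of [powR] applies. At [r = 0] both sides vanish. *)
Lemma measurable_invr r : measurable_fun setT r -> measurable_fun setT (fun x => (r x)^-1).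
Proof.
move=> mr; have -> : (fun x => (r x)^-1) = (fun x => r x * powR (r x ^+ 2) (-1)).
  apply/funext => x; rewrite powR_inv1 ?sqr_ge0//.
  have [->|r0] := eqVneq (r x) 0; first by rewrite invr0 mul0r.
  by rewrite expr2 invfM mulrA divff// mul1r.
apply: measurable_funM => //; apply: (measurableT_comp (measurable_powR _)).
exact: measurable_funX.
Qed.
Lemma cmeasurableV f : cmeasurable f -> cmeasurable (fun x => (f x)^-1).
Proof.
move=> [f1 f2].
have m2 : measurable_fun setT (fun x => (cre (f x) ^+ 2 + cim (f x) ^+ 2)^-1).
  by apply: measurable_invr; apply: measurable_funD; exact: measurable_funX.
split.
- by under eq_fun do rewrite creV; exact: measurable_funM.
- under eq_fun do rewrite cimV.
  by apply: measurable_funN; exact: measurable_funM.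
Qed.
Lemma measurable_cabs f : cmeasurable f -> measurable_fun setT (fun x => cabs (f x)).
Proof.
move=> [f1 f2]; apply: measurable_sqrtr.
  by apply: measurable_funD; exact: measurable_funX.
by move=> x; rewrite addr_ge0// sqr_ge0.
Qed.
End ComplexMeasurability.

Lemma cmeasurable_comp (R : realType) d1 d2 (T1 : measurableType d1)
    (T2 : measurableType d2) (f : T2 -> R[i]) (h : T1 -> T2) :
  cmeasurable f -> measurable_fun setT h -> cmeasurable (fun x => f (h x)).
Proof.
move=> [f1 f2] mh; split.
  exact: (measurableT_comp (f := fun x => cre (f x))).
exact: (measurableT_comp (f := fun x => cim (f x))).
Qed.

(** * Linearity and norm bounds for real and complex integrals *)

Section Integrals.
Context {R : realType} d {T : measurableType d} (mu : {measure set T -> \bar R}).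
Implicit Types (r s : T -> R) (f g : T -> R[i]).

Local Notation rintegrable r := (mu.-integrable setT (EFin \o r)).

Lemma rintegrable_meas r : rintegrable r -> measurable_fun setT r.
Proof. by move=> /integrableP[/measurable_EFinP]. Qed.
Lemma rintegrable_le r s : measurable_fun setT r -> (forall x, `|r x| <= s x) ->
  rintegrable s -> rintegrable r.
Proof.
move=> mr rs; apply: le_integrable => //; first exact/measurable_EFinP.
by move=> x _ /=; rewrite lee_fin (le_trans (rs x))// ler_norm.
Qed.
Lemma rintegrableD r s : rintegrable r -> rintegrable s -> rintegrable (fun x => r x + s x).
Proof.
move=> ir is_; rewrite (_ : _ \o _ = (EFin \o r) \+ (EFin \o s))%E//.
exact: integrableD.
Qed.
Lemma rintegrableN r : rintegrable r -> rintegrable (fun x => - r x).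
Proof. by move=> ir; rewrite (_ : _ \o _ = -%E \o (EFin \o r))//; exact: integrableN. Qed.
Lemma rintegrableB r s : rintegrable r -> rintegrable s -> rintegrable (fun x => r x - s x).
Proof. by move=> ir is_; apply: rintegrableD => //; exact: rintegrableN. Qed.
Lemma rintegrableZ (c : R) r : rintegrable r -> rintegrable (fun x => c * r x).
Proof. move=> ir; have := @integrableZl _ _ _ mu _ measurableT c _ ir; exact. Qed.
Lemma rintegrable_norm r : rintegrable r -> rintegrable (fun x => `|r x|).
Proof. exact: integrable_norm. Qed.

Lemma RintegD r s : rintegrable r -> rintegrable s ->
  Rinteg mu (fun x => r x + s x) = Rinteg mu r + Rinteg mu s.
Proof. exact: RintegralD. Qed.
Lemma RintegB r s : rintegrable r -> rintegrable s ->
  Rinteg mu (fun x => r x - s x) = Rinteg mu r - Rinteg mu s.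
Proof. exact: RintegralB. Qed.
Lemma RintegZ (c : R) r : rintegrable r -> Rinteg mu (fun x => c * r x) = c * Rinteg mu r.
Proof. exact: RintegralZl. Qed.
Lemma RintegN r : rintegrable r -> Rinteg mu (fun x => - r x) = - Rinteg mu r.
Proof.
by move=> ir; under [X in Rinteg _ X]eq_fun do rewrite -mulN1r; rewrite RintegZ// mulN1r.
Qed.
Lemma le_Rinteg r s : rintegrable r -> rintegrable s -> (forall x, r x <= s x) ->
  Rinteg mu r <= Rinteg mu s.
Proof. by move=> ir is_ rs; apply: le_Rintegral. Qed.
Lemma Rinteg_ge0 r : (forall x, 0 <= r x) -> 0 <= Rinteg mu r.
Proof. by move=> r0; apply: Rintegral_ge0. Qed.
Lemma normr_Rinteg r : rintegrable r -> `|Rinteg mu r| <= Rinteg mu (fun x => `|r x|).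
Proof. by move=> ir; apply: le_normr_Rintegral. Qed.
Lemma Rinteg0 : Rinteg mu (fun=> 0) = 0.
Proof. by rewrite /Rinteg integral0. Qed.
Lemma rintegrable0 : rintegrable (fun=> 0).
Proof. exact: integrable0. Qed.
Lemma EFin_Rinteg r : rintegrable r -> (Rinteg mu r)%:E = (\int[mu]_x (r x)%:E)%E.
Proof. by move=> ir; rewrite fineK//; exact: integrable_fin_num. Qed.

Definition cintegrable f := rintegrable (fun x => cre (f x)) /\ rintegrable (fun x => cim (f x)).

Lemma cintegrable_meas f : cintegrable f -> cmeasurable f.
Proof. by move=> [i1 i2]; split; exact: rintegrable_meas. Qed.
Lemma cintegrable_le f r : cmeasurable f -> (forall x, cabs (f x) <= r x) ->
  rintegrable r -> cintegrable f.
Proof.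
move=> [m1 m2] fr ir; split; apply: rintegrable_le ir => // x.
  by rewrite (le_trans (cre_le_cabs _)).
by rewrite (le_trans (cim_le_cabs _)).
Qed.
Lemma cintegrable_cabs f : cintegrable f -> rintegrable (fun x => cabs (f x)).
Proof.
move=> if_; have [i1 i2] := if_; have mf := cintegrable_meas if_.
have := rintegrableD (rintegrable_norm i1) (rintegrable_norm i2).
apply: rintegrable_le; first exact: measurable_cabs.
by move=> x; rewrite ger0_norm ?cabs_ge0// cabs_le_parts.
Qed.
Lemma cintegrableD f g : cintegrable f -> cintegrable g -> cintegrable (fun x => f x + g x).
Proof.
move=> [f1 f2] [g1 g2]; split.
  by under eq_fun do rewrite creD; exact: rintegrableD.
by under eq_fun do rewrite cimD; exact: rintegrableD.
Qed.
Lemma cintegrableZ c f : cintegrable f -> cintegrable (fun x => c * f x).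
Proof.
move=> [f1 f2]; split.
  by under eq_fun do rewrite creM; apply: rintegrableB; exact: rintegrableZ.
by under eq_fun do rewrite cimM; apply: rintegrableD; exact: rintegrableZ.
Qed.
Lemma cintegrableN f : cintegrable f -> cintegrable (fun x => - f x).
Proof. by move=> if_; under eq_fun do rewrite -mulN1r; exact: cintegrableZ. Qed.
Lemma cintegrableB f g : cintegrable f -> cintegrable g -> cintegrable (fun x => f x - g x).
Proof. by move=> if_ ig; apply: cintegrableD => //; exact: cintegrableN. Qed.
Lemma cintegrable0 : cintegrable (fun=> 0).
Proof. by split; exact: rintegrable0. Qed.
Lemma cintegrable_sum I (l : seq I) (F : I -> T -> R[i]) :
  (forall i, cintegrable (F i)) -> cintegrable (fun x => \sum_(i <- l) F i x).
Proof.
move=> mF; elim: l => [|i l IH].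
  by under eq_fun do rewrite big_nil; exact: cintegrable0.
by under eq_fun do rewrite big_cons; exact: cintegrableD.
Qed.
Lemma cintegrableJ f : cintegrable f -> cintegrable (fun x => (conjc (f x))).
Proof.
move=> [f1 f2]; split; first by under eq_fun do rewrite creJ.
by under eq_fun do rewrite cimJ; exact: rintegrableN.
Qed.
Lemma cintegrable_real r : rintegrable r -> cintegrable (fun x => (r x)%:C).
Proof. by move=> ir; split => //; exact: rintegrable0. Qed.

Lemma eq_cint f g : f =1 g -> cint mu f = cint mu g.
Proof. by move=> /funext ->. Qed.
Lemma cintD f g : cintegrable f -> cintegrable g ->
  cint mu (fun x => f x + g x) = cint mu f + cint mu g.
Proof.
move=> [f1 f2] [g1 g2]; apply: complex_eqP; rewrite ?cparts /=.
  by under [X in Rinteg _ X]eq_fun do rewrite creD; exact: RintegD.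
by under [X in Rinteg _ X]eq_fun do rewrite cimD; exact: RintegD.
Qed.
Lemma cintZ c f : cintegrable f -> cint mu (fun x => c * f x) = c * cint mu f.
Proof.
move=> [f1 f2]; apply: complex_eqP; rewrite ?cparts /=.
  under [X in Rinteg _ X]eq_fun do rewrite creM.
  by rewrite RintegB ?RintegZ//; exact: rintegrableZ.
under [X in Rinteg _ X]eq_fun do rewrite cimM.
by rewrite RintegD ?RintegZ//; exact: rintegrableZ.
Qed.
Lemma cintZr c f : cintegrable f -> cint mu (fun x => f x * c) = cint mu f * c.
Proof. by move=> if_; under eq_cint do rewrite mulrC; rewrite cintZ// mulrC. Qed.
Lemma cintN f : cintegrable f -> cint mu (fun x => - f x) = - cint mu f.
Proof. by move=> if_; under eq_cint do rewrite -mulN1r; rewrite cintZ// mulN1r. Qed.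
Lemma cintB f g : cintegrable f -> cintegrable g ->
  cint mu (fun x => f x - g x) = cint mu f - cint mu g.
Proof. by move=> if_ ig; rewrite cintD ?cintN//; exact: cintegrableN. Qed.
Lemma cint0 : cint mu (fun=> 0) = 0.
Proof. by apply: complex_eqP; rewrite /= Rinteg0. Qed.
Lemma cint_sum I (l : seq I) (F : I -> T -> R[i]) :
  (forall i, cintegrable (F i)) ->
  cint mu (fun x => \sum_(i <- l) F i x) = \sum_(i <- l) cint mu (F i).
Proof.
move=> mF; elim: l => [|i l IH].
  by rewrite big_nil; under eq_cint do rewrite big_nil; exact: cint0.
rewrite big_cons -IH; under eq_cint do rewrite big_cons.
by rewrite cintD//; exact: cintegrable_sum.
Qed.
Lemma cintJ f : cintegrable f -> cint mu (fun x => (conjc (f x))) = (conjc (cint mu f)).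
Proof.
move=> [f1 f2]; apply: complex_eqP; rewrite ?cparts /=.
  by under [X in Rinteg _ X]eq_fun do rewrite creJ.
by under [X in Rinteg _ X]eq_fun do rewrite cimJ; rewrite RintegN.
Qed.
Lemma cint_real r : cint mu (fun x => (r x)%:C) = (Rinteg mu r)%:C.
Proof. by apply: complex_eqP => //=; rewrite Rinteg0. Qed.

(* The modulus of [c = cint mu f] is that of [cint mu ((conjc c) f) = |c|^2], a real integral. *)
Lemma cabs_cint_le f : cintegrable f -> cabs (cint mu f) <= Rinteg mu (fun x => cabs (f x)).
Proof.
move=> if_; have ia := cintegrable_cabs if_.
set c := cint mu f.
have [c0|c0] := eqVneq (cabs c) 0; first by rewrite c0 Rinteg_ge0// => x; exact: cabs_ge0.
have cp : 0 < cabs c by rewrite lt_def c0 cabs_ge0.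
rewrite -(ler_pM2l cp) -RintegZ// -expr2.
have -> : cabs c ^+ 2 = Rinteg mu (fun x => cre ((conjc c) * f x)).
  by have := congr1 (@cre R) (cintZ (conjc c) if_); rewrite mulJc.
apply: le_Rinteg; [exact: (cintegrableZ (conjc c) if_).1|exact: rintegrableZ|].
move=> x; apply: (le_trans (ler_norm _)); apply: (le_trans (cre_le_cabs _)).
by rewrite cabsM cabsJ.
Qed.
Lemma cabs_cint_bound f r : cmeasurable f -> (forall x, cabs (f x) <= r x) ->
  rintegrable r -> cabs (cint mu f) <= Rinteg mu r.
Proof.
move=> mf fr ir; have if_ := cintegrable_le mf fr ir.
by apply: (le_trans (cabs_cint_le if_)); apply: le_Rinteg => //; exact: cintegrable_cabs.
Qed.
End Integrals.

(** * Sequential limits and dominated convergence *)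

Section ComplexLimits.
Context {R : realType}.
Implicit Types (u v : nat -> R[i]) (l m : R[i]).

Lemma cvg0_le (u a : nat -> R) : (\forall n \near \oo, `|u n| <= a n) ->
  a @ \oo --> (0:R) -> u @ \oo --> (0:R).
Proof.
move=> ua a0; apply: norm_cvg0; apply: (squeeze_cvgr _ (cvg_cst 0) a0).
by apply: filterS ua => n un; rewrite normr_ge0.
Qed.

Definition ccvg u l := (fun n => cre (u n)) @ \oo --> cre l /\ (fun n => cim (u n)) @ \oo --> cim l.

Lemma ccvg_cst l : ccvg (fun=> l) l.
Proof. by split; exact: cvg_cst. Qed.
Lemma ccvgD u v l m : ccvg u l -> ccvg v m -> ccvg (fun n => u n + v n) (l + m).
Proof.
move=> [u1 u2] [v1 v2]; split; rewrite !cparts.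
  by under eq_fun do rewrite creD; exact: cvgD.
by under eq_fun do rewrite cimD; exact: cvgD.
Qed.
Lemma ccvgM u v l m : ccvg u l -> ccvg v m -> ccvg (fun n => u n * v n) (l * m).
Proof.
move=> [u1 u2] [v1 v2]; split; rewrite !cparts.
  by under eq_fun do rewrite creM; apply: cvgB; exact: cvgM.
by under eq_fun do rewrite cimM; apply: cvgD; exact: cvgM.
Qed.
Lemma ccvg_real (a : nat -> R) (b : R) : a @ \oo --> b -> ccvg (fun n => (a n)%:C) b%:C.
Proof. by move=> ab; split => //; exact: cvg_cst. Qed.
Lemma ccvg_le u l (a : nat -> R) : (\forall n \near \oo, cabs (u n - l) <= a n) ->
  a @ \oo --> (0:R) -> ccvg u l.
Proof.
move=> ula a0; split; apply/subr_cvg0; apply: (cvg0_le _ a0); apply: filterS ula => n un.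
  by rewrite -creB (le_trans (cre_le_cabs _)).
by rewrite -cimB (le_trans (cim_le_cabs _)).
Qed.
Lemma ccvg_unique u l m : ccvg u l -> ccvg u m -> l = m.
Proof.
move=> [u1 u2] [v1 v2]; apply: complex_eqP.
  by apply: (@cvg_unique _ _ ((fun n => cre (u n)) @ \oo)).
by apply: (@cvg_unique _ _ ((fun n => cim (u n)) @ \oo)).
Qed.
Lemma near_ccvg u v l : (\forall n \near \oo, u n = v n) -> ccvg u l -> ccvg v l.
Proof.
move=> uv [u1 u2]; split; [move: u1|move: u2]; apply: cvg_trans; apply: near_eq_cvg;
  by apply: filterS uv => n ->.
Qed.
End ComplexLimits.

Section DominatedConvergence.
Context {R : realType} d {T : measurableType d} (mu : {measure set T -> \bar R}).

(** [Rinteg] sends infinite integrals to 0, so the limit of the extended integrals transfers only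
    once the limit integral is known to be finite. That integrability is returned too, since it is
    reused later. *)
Lemma Rinteg_dct (r : nat -> T -> R) (l s : T -> R) :
  (forall n, measurable_fun setT (r n)) -> (forall n x, `|r n x| <= s x) ->
  mu.-integrable setT (EFin \o s) -> (forall x, (fun n => r n x) @ \oo --> l x) ->
  mu.-integrable setT (EFin \o l) /\ (fun n => Rinteg mu (r n)) @ \oo --> Rinteg mu l.
Proof.
move=> mr rs is_ rl.
have ml : measurable_fun setT l by apply: measurable_fun_cvg => // x _; exact: rl.
have [] := @dominated_convergence _ _ _ mu _ measurableT (fun n => EFin \o r n)
  (EFin \o l) (EFin \o s).
- by move=> n; exact/measurable_EFinP.
- exact/measurable_EFinP.
- by apply: aeW => x _; apply/fine_cvgP; split; [exact: nearW|exact: rl].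
- exact: is_.
- by apply: aeW => x n _; rewrite /= lee_fin.
move=> il _ cl; split => //.
have fl : (\int[mu]_x (l x)%:E)%E \is a fin_num by exact: integrable_fin_num.
by apply: fine_cvg; rewrite fineK.
Qed.
Lemma cint_dct (f : nat -> T -> R[i]) (l : T -> R[i]) (s : T -> R) :
  (forall n, cmeasurable (f n)) -> (forall n x, cabs (f n x) <= s x) ->
  mu.-integrable setT (EFin \o s) -> (forall x, ccvg (f ^~ x) (l x)) ->
  cintegrable mu l /\ ccvg (fun n => cint mu (f n)) (cint mu l).
Proof.
move=> mf fs is_ fl.
have [] := @Rinteg_dct (fun n x => cre (f n x)) (fun x => cre (l x)) s.
- by move=> n; exact: (mf n).1.
- by move=> n x; apply: le_trans (fs n x); exact: cre_le_cabs.
- exact: is_.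
- by move=> x; exact: (fl x).1.
have [] := @Rinteg_dct (fun n x => cim (f n x)) (fun x => cim (l x)) s.
- by move=> n; exact: (mf n).2.
- by move=> n x; apply: le_trans (fs n x); exact: cim_le_cabs.
- exact: is_.
- by move=> x; exact: (fl x).2.
by move=> i2 c2 i1 c1; split; split.
Qed.
End DominatedConvergence.

(** * Integrals with a parameter, and Fubini under product domination *)

Section ParameterIntegrals.
Context {R : realType} d1 d2 {T1 : measurableType d1} {T2 : measurableType d2}.
Variables (m1 : {sigma_finite_measure set T1 -> \bar R})
          (m2 : {sigma_finite_measure set T2 -> \bar R}).

(** The extended integral is a difference of two Tonelli integrals, each measurable in the
    parameter, and [fine] preserves measurability even at parameters where the integral is
    infinite. *)
Lemma measurable_Rinteg_param (f : T1 * T2 -> R) : measurable_fun setT f ->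
  measurable_fun setT (fun x => Rinteg m2 (fun y => f (x, y))).
Proof.
move=> mf; apply: (measurableT_comp (fine_measurable measurableT)).
under eq_fun do rewrite integralE.
have mF : measurable_fun setT (EFin \o f) by exact/measurable_EFinP.
pose F : T1 * T2 -> \bar R := EFin \o f.
apply: emeasurable_funB.
  have H := @measurable_fun_fubini_tonelli_F _ _ _ _ _ m2 (F^\+)%E (measurable_funepos mF) (@funepos_ge0 _ _ F).
  apply: (eq_measurable_fun _ _ H) => x _.
  by apply: eq_integral => y _; rewrite !funeposE.
have H := @measurable_fun_fubini_tonelli_F _ _ _ _ _ m2 (F^\-)%E (measurable_funeneg mF) (@funeneg_ge0 _ _ F).
apply: (eq_measurable_fun _ _ H) => x _.
by apply: eq_integral => y _; rewrite !funenegE.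
Qed.
Lemma cmeasurable_cint_param (f : T1 * T2 -> R[i]) : cmeasurable f ->
  cmeasurable (fun x => cint m2 (fun y => f (x, y))).
Proof.
by move=> [f1 f2]; split; [exact: (measurable_Rinteg_param f1)|exact: (measurable_Rinteg_param f2)].
Qed.

(** Domination by a product is the form met in all later exchanges of integrals: oscillating kernels
    have modulus one, so one factor bounds each variable. *)
Lemma integrable_prod_le (f : T1 * T2 -> R) (a : T1 -> R) (b : T2 -> R) :
  measurable_fun setT f -> (forall x y, `|f (x, y)| <= a x * b y) ->
  m1.-integrable setT (EFin \o a) -> m2.-integrable setT (EFin \o b) ->
  (m1 \x m2)%E.-integrable setT (EFin \o f).
Proof.
move=> mf fab ia ib.
have mF : measurable_fun setT (EFin \o f) by exact/measurable_EFinP.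
apply/(integrable12ltyP _ _ mF).
have ma := rintegrable_meas ia; have mb := rintegrable_meas ib.
(* The hypothesis only forces [a x * b y >= 0], so both factors may be negative; absolute values
   make the Tonelli bound a product of nonnegative functions. *)
pose A x := `|a x|; pose B y := `|b y|.
have iA : m1.-integrable setT (EFin \o A) by exact: rintegrable_norm.
have iB : m2.-integrable setT (EFin \o B) by exact: rintegrable_norm.
apply: (@le_lt_trans _ _ (\int[m1]_x ((A x * Rinteg m2 B)%:E))%E).
  apply: ge0_le_integral => //.
  - by move=> x _; apply: integral_ge0 => y _; exact: abse_ge0.
  - apply: (@measurable_fun_fubini_tonelli_F _ _ _ _ _ m2 (fun z => `|(f z)%:E|%E)) => //.
    exact: measurableT_comp.
  - apply/measurable_EFinP; apply: measurable_funM => //.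
    exact: measurableT_comp.
  move=> x _; rewrite EFinM EFin_Rinteg// -ge0_integralZl//.
  - apply: ge0_le_integral => //.
    + by apply: measurableT_comp => //; exact: (measurable_fun_pair2 x mF).
    + by apply/measurable_EFinP; apply: measurable_funM => //; exact: measurableT_comp.
    + move=> y _; rewrite /= -EFinM lee_fin; apply: (le_trans (fab x y)).
      by rewrite -normrM ler_norm.
  - by apply/measurable_EFinP; exact: measurableT_comp.
  - by move=> y _; rewrite lee_fin /B.
  - by rewrite lee_fin /A.
have iAB : m1.-integrable setT (EFin \o (fun x => Rinteg m2 B * A x)) by exact: rintegrableZ.
under eq_integral do rewrite mulrC.
by rewrite -EFin_Rinteg// ltry.
Qed.

Lemma Rinteg_fubini (f : T1 * T2 -> R) (a : T1 -> R) (b : T2 -> R) :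
  measurable_fun setT f -> (forall x y, `|f (x, y)| <= a x * b y) ->
  m1.-integrable setT (EFin \o a) -> m2.-integrable setT (EFin \o b) ->
  Rinteg m1 (fun x => Rinteg m2 (fun y => f (x, y))) =
  Rinteg m2 (fun y => Rinteg m1 (fun x => f (x, y))).
Proof.
move=> mf fab ia ib; have iF := integrable_prod_le mf fab ia ib.
congr fine.
transitivity (\int[m1]_x \int[m2]_y (f (x, y))%:E)%E.
  apply: eq_integral => x _; rewrite EFin_Rinteg//.
  apply: (@rintegrable_le _ _ _ _ _ (fun y => a x * b y)) => //.
    exact: (measurable_fun_pair2 x mf).
  exact: rintegrableZ.
rewrite (Fubini iF); apply: eq_integral => y _; rewrite EFin_Rinteg//.
apply: (@rintegrable_le _ _ _ _ _ (fun x => b y * a x)) => //.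
- exact: (measurable_fun_pair1 y mf).
- by move=> x; rewrite mulrC.
- exact: rintegrableZ.
Qed.

Lemma cint_fubini (f : T1 * T2 -> R[i]) (a : T1 -> R) (b : T2 -> R) :
  cmeasurable f -> (forall x y, cabs (f (x, y)) <= a x * b y) ->
  m1.-integrable setT (EFin \o a) -> m2.-integrable setT (EFin \o b) ->
  cint m1 (fun x => cint m2 (fun y => f (x, y))) =
  cint m2 (fun y => cint m1 (fun x => f (x, y))).
Proof.
move=> [mf1 mf2] fab ia ib; apply: complex_eqP => /=.
  apply: (@Rinteg_fubini (fun z => cre (f z)) a b) => // x y.
  exact: (le_trans (cre_le_cabs _)).
apply: (@Rinteg_fubini (fun z => cim (f z)) a b) => // x y.
exact: (le_trans (cim_le_cabs _)).
Qed.

Lemma cintegrable_inner (f : T1 * T2 -> R[i]) (a : T1 -> R) (b : T2 -> R) :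
  cmeasurable f -> (forall x y, cabs (f (x, y)) <= a x * b y) ->
  m1.-integrable setT (EFin \o a) -> m2.-integrable setT (EFin \o b) ->
  cintegrable m1 (fun x => cint m2 (fun y => f (x, y))).
Proof.
move=> mf fab ia ib.
apply: (@cintegrable_le _ _ _ _ _ (fun x => Rinteg m2 b * a x)).
- exact: cmeasurable_cint_param.
- move=> x; rewrite mulrC -RintegZ//; apply: cabs_cint_bound => //.
    by split; [exact: (measurable_fun_pair2 x mf.1)|exact: (measurable_fun_pair2 x mf.2)].
  exact: rintegrableZ.
- exact: rintegrableZ.
Qed.
End ParameterIntegrals.

(** * Affine changes of variables and the fundamental theorem of calculus *)

Section LebesgueAffine.
Context {R : realType}.
Implicit Types (c e a b : R) (f : R -> R).
Local Notation leb := (@leb R).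

Lemma measurable_affine c e : measurable_fun setT (fun x : R => c * x + e).
Proof. by apply: measurable_funD => //; apply: measurable_funM. Qed.

(** The sign of [c] matters because a negative slope turns []a, b]] into an interval closed on the
    left instead; the length is the same. *)
Lemma leb_itv_affine c e a b : c != 0 ->
  (leb ((fun x => (c * x + e)%R) @^-1` `]a, b]%classic) * `|c|%:E = leb `]a, b]%classic)%E.
Proof.
move=> c0; rewrite /leb lebesgue_measure_itv/= lte_fin.
have [cn|cp|c00] := ltgtP c 0; last by rewrite c00 eqxx in c0.
- have -> : (fun x => c * x + e) @^-1` `]a, b]%classic = `[(b - e) / c, (a - e) / c[%classic.
    apply/seteqP; split => x /=; rewrite !in_itv/=.
      move=> /andP[h1 h2]; rewrite ler_ndivrMr// ltr_ndivlMr//.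
      by apply/andP; split; rewrite mulrC; lra.
    by rewrite ler_ndivrMr// ltr_ndivlMr// => /andP[h1 h2]; apply/andP; split;
      move: h1 h2; rewrite mulrC; lra.
  rewrite lebesgue_measure_itv/= lte_fin ltr_nM2r ?invr_lt0// ltrD2r.
  case: ifP => ab; last by rewrite mul0e.
  rewrite -!EFinB -EFinM ltr0_norm//; congr EFin.
  by field.
- have -> : (fun x => c * x + e) @^-1` `]a, b]%classic = `](a - e) / c, (b - e) / c]%classic.
    apply/seteqP; split => x /=; rewrite !in_itv/=.
      move=> /andP[h1 h2]; rewrite ltr_pdivrMr// ler_pdivlMr//.
      by apply/andP; split; rewrite mulrC; lra.
    by rewrite ltr_pdivrMr// ler_pdivlMr// => /andP[h1 h2]; apply/andP; split;
      move: h1 h2; rewrite mulrC; lra.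
  rewrite lebesgue_measure_itv/= lte_fin ltr_pM2r ?invr_gt0// ltrD2r.
  case: ifP => ab; last by rewrite mul0e.
  by rewrite -!EFinB -EFinM gtr0_norm//; congr EFin; field.
Qed.

(** Uniqueness of Lebesgue measure: the pushforward scaled by [|c|] has the right value on half-open
    intervals. *)
Lemma leb_affine c e (A : set R) : c != 0 -> measurable A ->
  (leb A = `|c|%:E * leb ((fun x => (c * x + e)%R) @^-1` A))%E.
Proof.
move=> c0 mA.
have mphi := measurable_affine c e.
refine (@lebesgue_measure_unique R (mscale (NngNum (normr_ge0 c)) 
  (pushforward (T2 := measurableTypeR R) leb (fun x : measurableTypeR R => c * x + e))) _ A mA) => // X [[a b] _ <-].
by rewrite [RHS]muleC; exact/esym/leb_itv_affine.
Unshelve. exact: mphi. Qed.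

Lemma ge0_integral_affine c e (f : R -> \bar R) : c != 0 -> measurable_fun setT f ->
  (forall x, 0 <= f x)%E ->
  (\int[leb]_x f x = `|c|%:E * \int[leb]_x f (c * x + e)%R)%E.
Proof.
move=> c0 mf f0.
have mphi := measurable_affine c e.
rewrite (@eq_measure_integral _ _ _ _ (mscale (NngNum (normr_ge0 c))
  (pushforward (T2 := measurableTypeR R) leb (fun x : measurableTypeR R => c * x + e)))); last by move=> A mA _; exact: leb_affine.
by rewrite ge0_integral_mscale// ge0_integral_pushforward.
Qed.

Lemma rintegrable_affine c e f : c != 0 -> leb.-integrable setT (EFin \o f) ->
  leb.-integrable setT (EFin \o (fun x => f (c * x + e))).
Proof.
move=> c0 if_; have mf := rintegrable_meas if_.
apply/integrableP; split.
  apply/measurable_EFinP; apply: (measurableT_comp mf); exact: measurable_affine.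
have mn : measurable_fun setT (fun x => `|f x|%:E).
  by apply/measurable_EFinP; exact: measurableT_comp.
have E := @ge0_integral_affine c e (fun x => `|f x|%:E) c0 mn (fun x => normr_ge0 (f x)).
have /integrableP[_ fl] := if_; rewrite [X in (X < _)%E]E in fl.
have cp : 0 < `|c| by rewrite normr_gt0.
rewrite ltNge; apply/negP => i8.
have i8' : (\int[leb]_x `|f (c * x + e)|%:E = +oo)%E by apply/eqP; rewrite -leye_eq.
by move: fl; rewrite i8' gt0_muley ?lte_fin// ltxx.
Qed.

Lemma Rinteg_affine c e f : c != 0 -> leb.-integrable setT (EFin \o f) ->
  Rinteg leb f = `|c| * Rinteg leb (fun x => f (c * x + e)).
Proof.
move=> c0 if_; have mf := rintegrable_meas if_.
have ig := rintegrable_affine e c0 if_.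
have mE : measurable_fun setT (EFin \o f) by exact/measurable_EFinP.
apply: EFin_inj; rewrite EFinM !EFin_Rinteg//.
rewrite [LHS]integralE [in RHS]integralE.
rewrite (ge0_integral_affine e c0)//; last exact: measurable_funepos.
rewrite [X in (_ - X)%E](ge0_integral_affine e c0)//; last exact: measurable_funeneg.
have E1 : (\int[leb]_x (EFin \o f)^\+ (c * x + e)%R =
           \int[leb]_x (EFin \o (fun x => f (c * x + e)%R))^\+ x)%E.
  by apply: eq_integral => x _; rewrite !funeposE.
have E2 : (\int[leb]_x (EFin \o f)^\- (c * x + e)%R =
           \int[leb]_x (EFin \o (fun x => f (c * x + e)%R))^\- x)%E.
  by apply: eq_integral => x _; rewrite !funenegE.
rewrite E1 E2; apply/esym; apply: muleBr => //.
apply: fin_num_adde_defl; rewrite fin_numN.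
exact: (integrable_neg_fin_num measurableT ig).
Qed.

Lemma cintegrable_affine c e (f : R -> R[i]) : c != 0 -> cintegrable leb f ->
  cintegrable leb (fun x => f (c * x + e)).
Proof.
move=> c0 [i1 i2].
by split; [exact: (rintegrable_affine e c0 i1)|exact: (rintegrable_affine e c0 i2)].
Qed.
Lemma cint_affine c e (f : R -> R[i]) : c != 0 -> cintegrable leb f ->
  cint leb f = `|c|%:C * cint leb (fun x => f (c * x + e)).
Proof.
move=> c0 [i1 i2]; apply: complex_eqP; rewrite ?creZ ?cimZ.
  exact: (Rinteg_affine e c0 i1).
exact: (Rinteg_affine e c0 i2).
Qed.
Lemma cint_opp (f : R -> R[i]) : cintegrable leb f ->
  cint leb (fun x => f (- x)) = cint leb f.
Proof.
move=> if_; rewrite (@cint_affine (-1) 0 f)// ?oppr_eq0 ?oner_eq0//.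
rewrite normrN normr1 mul1r; apply: eq_cint => x.
by rewrite mulN1r addr0.
Qed.
Lemma cintegrable_opp (f : R -> R[i]) : cintegrable leb f ->
  cintegrable leb (fun x => f (- x)).
Proof.
move=> if_; have := @cintegrable_affine (-1) 0 f; under eq_fun do rewrite mulN1r addr0.
by apply=> //; rewrite oppr_eq0 oner_eq0.
Qed.
Lemma Rinteg_opp f : leb.-integrable setT (EFin \o f) ->
  Rinteg leb (fun x => f (- x)) = Rinteg leb f.
Proof.
move=> if_; rewrite (@Rinteg_affine (-1) 0 f)// ?oppr_eq0 ?oner_eq0//.
rewrite normrN normr1 mul1r; congr Rinteg; apply/funext => x.
by rewrite mulN1r addr0.
Qed.
Lemma Rinteg_itv_FTC (F f : R -> R) a b : a < b ->
  (forall x : R, is_derive x (1 : R) F (f x)) -> continuous f ->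
  Rinteg leb (fun x => \1_`[a, b] x * f x) = F b - F a.
Proof.
move=> ab dF cf.
have cF : continuous F.
  move=> x; apply: differentiable_continuous; apply/derivable1_diffP.
  by case: (dF x).
have E : (\int[leb]_(x in `[a, b]) (f x)%:E = (F b)%:E - (F a)%:E)%E.
  apply: continuous_FTC2 => //.
  - exact: continuous_subspaceT.
  - split; first by move=> x _; case: (dF x).
    + by apply: cvg_at_right_filter; exact: cF.
    + by apply: cvg_at_left_filter; exact: cF.
  - by move=> x _; rewrite derive1E; case: (dF x).
rewrite -[RHS]/(fine (F b - F a)%:E) EFinB -E integral_mkcond.
congr fine; apply: eq_integral => x _; rewrite patchE indicE.
by case: ifP => _; rewrite ?mul1r ?mul0r.
Qed.
End LebesgueAffine.

(** * The Gaussian and its Fourier transform *)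

Section Gaussian.
Context {R : realType}.
Implicit Types (s t x : R).
Local Notation leb := (@leb R).

Definition gexp x : R := expR (- (x ^+ 2 / 2)).
Definition gmass : R := Num.sqrt (pi *+ 2).

Lemma gmass_gt0 : 0 < gmass.
Proof. by rewrite sqrtr_gt0 mulrn_wgt0// pi_gt0. Qed.
Lemma gmass_sqr : gmass ^+ 2 = pi *+ 2.
Proof. by rewrite sqr_sqrtr// mulrn_wge0// pi_ge0. Qed.
Lemma gexp_gt0 x : 0 < gexp x. Proof. exact: expR_gt0. Qed.
Lemma gexp_ge0 x : 0 <= gexp x. Proof. exact: expR_ge0. Qed.
Lemma gexp0 : gexp 0 = 1.
Proof. by rewrite /gexp expr0n/= mul0r oppr0 expR0. Qed.
Lemma gexpN x : gexp (- x) = gexp x. Proof. by rewrite /gexp sqrrN. Qed.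
Lemma gexp_le1 x : gexp x <= 1.
Proof. by rewrite /gexp -[leRHS]expR0 ler_expR oppr_le0 divr_ge0// sqr_ge0. Qed.
Lemma is_derive_gexp x : is_derive x (1 : R) gexp (- x * gexp x).
Proof.
have -> : gexp = expR \o (fun y => - 2^-1 * y ^+ 2).
  by apply/funext => y; rewrite /gexp/= mulrC mulNr.
apply: is_derive_eq; rewrite /=.
rewrite /GRing.scale/= /gexp (_ : - 2^-1 * x ^+ 2 = - (x ^+ 2 / 2)); last by field.
by field.
Qed.
Lemma continuous_gexp : continuous gexp.
Proof.
move=> x; apply: differentiable_continuous; apply/derivable1_diffP.
by case: (is_derive_gexp x).
Qed.
Lemma measurable_gexp : measurable_fun setT gexp.
Proof. by apply: continuous_measurable_fun; exact: continuous_gexp. Qed.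
Lemma gexp_inv_le x : gexp x <= (1 + x ^+ 2 / 2)^-1.
Proof.
rewrite /gexp expRN lef_pV2 ?posrE ?expR_gt0 ?expR_ge1Dx//.
by rewrite ltr_pwDl// divr_ge0// sqr_ge0.
Qed.
Lemma gexp_nat_cvg0 : (fun n : nat => gexp n%:R) @ \oo --> (0 : R).
Proof.
have c0 : (fun n : nat => 2 * harmonic n) @ \oo --> (0 : R).
  by rewrite -[X in _ --> X](mulr0 2); apply: cvgM; [exact: cvg_cst|exact: cvg_harmonic].
apply: (cvg0_le _ c0); apply: nearW => n; rewrite ger0_norm ?gexp_ge0//.
apply: (le_trans (gexp_inv_le _)).
rewrite -[2 * _]invrK lef_pV2 ?posrE ?invr_gt0.
- rewrite invfM invrK /harmonic.
  (* After inversion the claim reads [(n + 1) / 2 <= 1 + n^2 / 2], that is [n <= n^2 + 1], which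
     follows from this square. *)
  have : 0 <= (n%:R - 1 : R) ^+ 2 by exact: sqr_ge0.
  have : 0 <= (n%:R : R) by [].
  rewrite -[n.+1%:R]natr1; move: (n%:R : R) => r r0 r1; nra.
- by rewrite ltr_pwDl// divr_ge0// sqr_ge0.
- by rewrite mulr_gt0//= invr_gt0 ltr0n.
Qed.

Lemma normal_pdf01E x : normal_pdf 0 1 x = gmass^-1 * gexp x.
Proof.
rewrite normal_pdfE ?oner_neq0// /normal_peak /normal_fun expr1n mul1r subr0.
by rewrite /gexp mulNr.
Qed.
Lemma rintegrable_gexp : leb.-integrable setT (EFin \o gexp).
Proof.
have H := rintegrableZ gmass (@integrable_normal_pdf R 0 1).
apply: eq_integrable H => // x _ /=.
by rewrite normal_pdf01E mulrA divff ?mul1r// gt_eqF// gmass_gt0.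
Qed.
Lemma Rinteg_gexp : Rinteg leb gexp = gmass.
Proof.
have := @integral_normal_pdf R 0 1.
move/(congr1 fine); rewrite /= -/(Rinteg leb (fun x => normal_pdf 0 1 x)).
under [X in Rinteg _ X]eq_fun do rewrite normal_pdf01E.
rewrite RintegZ; last exact: rintegrable_gexp.
by move=> h; rewrite -[LHS](mulKf (_ : gmass^-1 != 0)) ?h ?invrK ?mulr1// invr_eq0 gt_eqF// gmass_gt0.
Qed.
(* [|x| <= 2 + x^2/2 <= 2 exp(x^2/4)], so half of the exponent is left for integrability. *)
Lemma rintegrable_xgexp : leb.-integrable setT (EFin \o (fun x => `|x| * gexp x)).
Proof.
have s2 : (Num.sqrt 2 : R)^-1 != 0 by rewrite invr_eq0 sqrtr_eq0 -ltNge.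
have H := rintegrableZ 2 (rintegrable_affine 0 s2 rintegrable_gexp).
apply: rintegrable_le H.
  by apply: measurable_funM; [exact: (measurableT_comp (@normr_measurable R setT))|exact: measurable_gexp].
move=> x; rewrite addr0 normrM normr_id (ger0_norm (gexp_ge0 _)).
have -> : gexp x = gexp ((Num.sqrt 2)^-1 * x) * gexp ((Num.sqrt 2)^-1 * x).
  by rewrite /gexp -expRD; congr expR; rewrite exprMn exprVn sqr_sqrtr//; field.
rewrite mulrA ler_wpM2r ?gexp_ge0// -ler_pdivlMr ?gexp_gt0//.
rewrite /gexp expRN invrK exprMn exprVn sqr_sqrtr//.
have := expR_ge1Dx (2^-1 * x ^+ 2 / 2).
have : `|x| ^+ 2 = x ^+ 2 by rewrite real_normK ?num_real.
have : 0 <= (`|x| - 2) ^+ 2 by exact: sqr_ge0.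
nra.
Qed.

Let F t := Rinteg leb (fun x => cos (t * x) * gexp x).

Lemma measurable_mull t : measurable_fun setT (fun x : R => t * x).
Proof. exact: measurable_funM. Qed.
Lemma rintegrable_bounded_gexp (f : R -> R) : measurable_fun setT f ->
  (forall x, `|f x| <= 1) -> leb.-integrable setT (EFin \o (fun x => f x * gexp x)).
Proof.
move=> mf f1; apply: rintegrable_le rintegrable_gexp.
  by apply: measurable_funM => //; exact: measurable_gexp.
by move=> x; rewrite normrM (ger0_norm (gexp_ge0 _)) ler_piMl ?gexp_ge0.
Qed.
Lemma rintegrable_bounded_xgexp (f : R -> R) : measurable_fun setT f ->
  (forall x, `|f x| <= 1) -> leb.-integrable setT (EFin \o (fun x => x * f x * gexp x)).
Proof.
move=> mf f1; apply: rintegrable_le rintegrable_xgexp.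
  by apply: measurable_funM; [exact: measurable_funM|exact: measurable_gexp].
move=> x; rewrite !normrM (ger0_norm (gexp_ge0 _)) ler_wpM2r ?gexp_ge0//.
by rewrite ler_piMr.
Qed.
Lemma norm_cos_le1 x : `|cos x| <= 1. Proof. by rewrite ler_norml cos_geN1 cos_le1. Qed.
Lemma norm_sin_le1 x : `|sin x| <= 1. Proof. by rewrite ler_norml sin_geN1 sin_le1. Qed.

Lemma is_derive_cosgexp t x : is_derive t (1 : R) (fun t => cos (t * x) * gexp x)
  (- (x * sin (t * x) * gexp x)).
Proof.
have -> : (fun t => cos (t * x) * gexp x) =
   (fun t => gexp x *: (cos \o (fun t => t * x)) t).
  by apply/funext => y; rewrite /GRing.scale/= mulrC.
apply: is_derive_eq.
by rewrite /GRing.scale/=; ring.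
Qed.

(** The derivative in [t] of the integrand is bounded by [|x| * gexp x] uniformly in [t], which
    permits differentiation under the integral. *)
Lemma is_derive_F t : is_derive t (1 : R) F (- Rinteg leb (fun x => x * sin (t * x) * gexp x)).
Proof.
pose f t x := cos (t * x) * gexp x.
have d1 x u : partial1of2 f x u = - (u * sin (x * u) * gexp u).
  by rewrite partial1of2E; case: (is_derive_cosgexp x u).
have I : `]t - 1, t + 1[%classic t by rewrite /= in_itv/=; apply/andP; split; lra.
have H1 : forall x, `]t - 1, t + 1[%classic x -> leb.-integrable setT (EFin \o f x).
  move=> x _; apply: rintegrable_bounded_gexp => [|y]; last exact: norm_cos_le1.
  by apply: measurable_cos_comp; exact: measurable_mull.
have H2 : forall x y, `]t - 1, t + 1[%classic x -> [set: R] y -> derivable (f ^~ y) x 1.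
  by move=> x y _ _; case: (is_derive_cosgexp x y).
have H3 : forall y : R, 0 <= `|y| * gexp y by move=> y; rewrite mulr_ge0// gexp_ge0.
have H4 : forall x y, `]t - 1, t + 1[%classic x -> [set: R] y ->
    `|partial1of2 f x y| <= `|y| * gexp y.
  move=> x y _ _; rewrite d1 normrN !normrM (ger0_norm (gexp_ge0 _)) ler_wpM2r ?gexp_ge0//.
  by rewrite ler_piMr// norm_sin_le1.
apply: DeriveDef.
  exact: (@derivable_under_integral R _ _ leb f setT measurableT t _ _ I H1 H2 _ H3
    rintegrable_xgexp H4).
rewrite -derive1E.
rewrite (@differentiation_under_integral R _ _ leb f setT measurableT t _ _ I H1 H2 _ H3
    rintegrable_xgexp H4).
rewrite -RintegN; first by congr Rinteg; apply/funext => x; rewrite d1.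
apply: rintegrable_bounded_xgexp => [|y]; last exact: norm_sin_le1.
by apply: measurable_sin_comp; exact: measurable_mull.
Qed.

Lemma is_derive_singexp t x : is_derive x (1 : R) (fun x => sin (t * x) * gexp x)
  (t * (cos (t * x) * gexp x) - x * sin (t * x) * gexp x).
Proof.
have dg := is_derive_gexp x.
have -> : (fun x => sin (t * x) * gexp x) = (sin \o (fun x => t * x)) * gexp by [].
apply: is_derive_eq.
by rewrite /GRing.scale/=; ring.
Qed.

(** The difference of the two integrands is the derivative of [sin (t x) * gexp x], whose boundary
    values on growing symmetric intervals tend to zero. *)
Lemma gauss_by_parts t : Rinteg leb (fun x => x * sin (t * x) * gexp x) = t * F t.
Proof.
pose f x := t * (cos (t * x) * gexp x) - x * sin (t * x) * gexp x.
have mc : measurable_fun setT (fun x => cos (t * x)).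
  by apply: measurable_cos_comp; exact: measurable_mull.
have ms : measurable_fun setT (fun x => sin (t * x)).
  by apply: measurable_sin_comp; exact: measurable_mull.
have ic := rintegrable_bounded_gexp mc (fun x => norm_cos_le1 _).
have is_ := rintegrable_bounded_xgexp ms (fun x => norm_sin_le1 _).
have itc := rintegrableZ t ic.
have fi := rintegrableB itc is_.
suff : Rinteg leb f = 0.
  by rewrite /f RintegB// RintegZ// => /eqP; rewrite subr_eq0 => /eqP <-.
(* The index [n.+1] keeps every interval nondegenerate, as the fundamental theorem asks for
   [a < b]. *)
have fl : (fun n => Rinteg leb (fun x => \1_`[- n.+1%:R, n.+1%:R] x * f x)) @ \oo -->
    Rinteg leb f.
  apply: (proj2 (@Rinteg_dct R _ _ leb (fun n x => \1_`[- n.+1%:R, n.+1%:R] x * f x) f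
    (fun x => `|f x|) _ _ (rintegrable_norm fi) _)).
- by move=> n; apply: measurable_funM; [exact: measurable_indic|exact: (rintegrable_meas fi)].
- move=> n x; rewrite normrM ler_piMl// indicE.
  by case: (_ \in _); rewrite ?normr1 ?normr0.
- move=> x; apply: (@cvg_near_cst nat).
  have [m hm] : exists m : nat, `|x| < m%:R.
    by exists (Num.truncn `|x|).+1; exact: truncnS_gt.
  exists m => // n /= mn; rewrite indicE mem_set ?mul1r//= in_itv/= -ler_norml.
  by apply: ltW; apply: (lt_le_trans hm); rewrite ler_nat; exact: leqW.
have E n : Rinteg leb (fun x => \1_`[- n.+1%:R, n.+1%:R] x * f x) =
  sin (t * n.+1%:R) * gexp n.+1%:R *+ 2.
  have nb : - n.+1%:R < n.+1%:R :> R by have : (0 < n.+1%:R :> R) by []; lra.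
  rewrite (Rinteg_itv_FTC nb (is_derive_singexp t)).
    by rewrite gexpN mulrN sinN mulNr opprK mulr2n.
  move=> x; apply: cvgB; apply: cvgM; first exact: cvg_cst.
  - apply: cvgM; last exact: continuous_gexp.
    apply: (@continuous_comp _ _ _ (fun x => t * x) cos); last exact: continuous_cos.
    by apply: cvgM; [exact: cvg_cst|exact: cvg_id].
  - apply: cvgM; first exact: cvg_id.
    apply: (@continuous_comp _ _ _ (fun x => t * x) sin); last exact: continuous_sin.
    by apply: cvgM; [exact: cvg_cst|exact: cvg_id].
  - exact: continuous_gexp.
have {}fl : (fun n : nat => sin (t * n.+1%:R) * gexp n.+1%:R *+ 2) @ \oo --> Rinteg leb f.
  by apply: cvg_trans fl; apply: near_eq_cvg; apply: nearW => n; rewrite E.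
have g0 : (fun n : nat => gexp n.+1%:R *+ 2) @ \oo --> (0 : R).
  rewrite -[X in _ --> X](mul0rn _ 2); apply: cvgMn.
  by rewrite (cvg_shiftS (fun n : nat => gexp n%:R)); exact: gexp_nat_cvg0.
suff /(cvg_unique _ fl) : (fun n : nat => sin (t * n.+1%:R) * gexp n.+1%:R *+ 2) @ \oo --> (0:R).
  exact.
apply: (cvg0_le _ g0); apply: nearW => n.
rewrite normrMn lerMn2r/= normrM (ger0_norm (gexp_ge0 _)).
by rewrite ler_piMl ?gexp_ge0// norm_sin_le1.
Qed.

(** Integration by parts turns the derivative of the cosine transform [F] into [- t * F t], so
    [F t * exp (t^2 / 2)] is constant and equals [F 0], the Gaussian mass. *)
Lemma Rinteg_cos_gexp t : Rinteg leb (fun x => cos (t * x) * gexp x) = gmass * gexp t.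
Proof.
pose G t := F t * expR (t ^+ 2 / 2).
have dG s : is_derive s (1 : R) G 0.
  have dF := is_derive_F s; rewrite gauss_by_parts in dF.
  have dE : is_derive s (1 : R) (fun s => expR (s ^+ 2 / 2)) (s * expR (s ^+ 2 / 2)).
    have -> : (fun s => expR (s ^+ 2 / 2)) = expR \o (fun y => 2^-1 * y ^+ 2).
      by apply/funext => y; rewrite /= mulrC.
    apply: is_derive_eq.
    by rewrite /GRing.scale/= [2^-1 * _]mulrC; field.
  have -> : G = F * (fun s => expR (s ^+ 2 / 2)) by [].
  apply: is_derive_eq; rewrite /GRing.scale/=; ring.
have := is_derive_0_is_cst t 0 dG.
rewrite /G expr0n/= mul0r expR0 mulr1.
have -> : F 0 = gmass.
  rewrite -Rinteg_gexp; congr Rinteg; apply/funext => x.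
  by rewrite mul0r cos0 mul1r.
move=> <-; rewrite /gexp expRN -mulrA divff ?mulr1//.
by rewrite gt_eqF// expR_gt0.
Qed.

Lemma cintegrable_eiu_gexp t : cintegrable leb (fun x => eiu (t * x) * (gexp x)%:C).
Proof.
apply: (cintegrable_le _ _ rintegrable_gexp).
  apply: cmeasurableM; first exact: cmeasurable_eiu (measurable_mull t).
  by apply: cmeasurable_real; exact: measurable_gexp.
by move=> x; rewrite cabsM cabs_eiu mul1r cabsC ger0_norm// gexp_ge0.
Qed.
Lemma cint_eiu_gexp t : cint leb (fun x => eiu (t * x) * (gexp x)%:C) = (gmass * gexp t)%:C.
Proof.
apply: complex_eqP; rewrite ?creC ?cimC /=.
  by under [X in Rinteg _ X]eq_fun do rewrite mulr0 subr0; exact: Rinteg_cos_gexp.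
under [X in Rinteg _ X]eq_fun do rewrite mulr0 add0r.
set r := fun x => _.
have ir : leb.-integrable setT (EFin \o r).
  apply: rintegrable_bounded_gexp => [|x]; last exact: norm_sin_le1.
  by apply: measurable_sin_comp; exact: measurable_mull.
have := Rinteg_opp ir.
have -> : (fun x => r (- x)) = (fun x => - r x).
  by apply/funext => x; rewrite /r mulrN sinN gexpN mulNr.
rewrite RintegN// => h; lra.
Qed.

(** The density of the centred normal law with standard deviation [s]. *)
Definition gdens s x : R := (s * gmass)^-1 * gexp (s^-1 * x).

Lemma gdens_ge0 s x : 0 < s -> 0 <= gdens s x.
Proof. by move=> s0; rewrite mulr_ge0 ?gexp_ge0// invr_ge0 mulr_ge0 ?ltW// gmass_gt0. Qed.
Lemma measurable_gdens s : measurable_fun setT (gdens s).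
Proof.
apply: measurable_funM => //; apply: (measurableT_comp measurable_gexp).
exact: measurable_mull.
Qed.
Lemma rintegrable_gdens s : 0 < s -> leb.-integrable setT (EFin \o gdens s).
Proof.
move=> s0; apply: rintegrableZ.
have sn0 : s^-1 != 0 by rewrite invr_eq0 gt_eqF.
have := rintegrable_affine 0 sn0 rintegrable_gexp.
by under eq_fun do rewrite addr0.
Qed.
(** The substitution [u = v / s] reduces this to the standard Gaussian. It is the one explicit
    inversion formula of the development; the other inversions are brought back to it by Gaussian
    damping. *)
Lemma cint_eiu_gexp_scale s x : 0 < s ->
  cint leb (fun u => eiu (u * x) * (gexp (s * u))%:C) = ((pi *+ 2) * gdens s x)%:C.
Proof.
move=> s0; have sn0 : s != 0 by rewrite gt_eqF.
have := @cint_affine _ s 0 _ sn0 (cintegrable_eiu_gexp (s^-1 * x)).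
rewrite cint_eiu_gexp; under [in X in _ = X]eq_cint => u.
  rewrite addr0 (_ : s^-1 * x * (s * u) = u * x); last by field.
  over.
move=> E; apply: (@mulfI _ (`|s|%:C)).
  by rewrite -[0]/(0%:C) (inj_eq (@complexI R)) normr_eq0.
rewrite -E -rmorphM/= gtr0_norm// -gmass_sqr /gdens; congr (_%:C).
by field; rewrite sn0 gt_eqF// gmass_gt0.
Qed.
Lemma Rinteg_gdens s : 0 < s -> Rinteg leb (gdens s) = 1.
Proof.
move=> s0; have sn0 : s^-1 != 0 by rewrite invr_eq0 gt_eqF.
have ig : leb.-integrable setT (EFin \o (fun x => gexp (s^-1 * x))).
  have := rintegrable_affine 0 sn0 rintegrable_gexp.
  by under eq_fun do rewrite addr0.
have := Rinteg_affine 0 sn0 rintegrable_gexp.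
rewrite Rinteg_gexp; under [in X in _ = X -> _]eq_fun do rewrite addr0.
rewrite gtr0_norm ?invr_gt0// => E; rewrite /gdens RintegZ//.
by rewrite invfM mulrAC -E divff// gt_eqF// gmass_gt0.
Qed.
End Gaussian.

#[local] Arguments conjc : simpl never.
#[local] Arguments cint : simpl never.

(** * Measurability on product spaces *)

Section ProductMeasurability.
Context {R : realType} d1 d2 {T1 : measurableType d1} {T2 : measurableType d2}.

Lemma cmeasurable_fst (f : T1 -> R[i]) : cmeasurable f ->
  cmeasurable (fun z : T1 * T2 => f z.1).
Proof. by move=> mf; apply: cmeasurable_comp mf _; exact: measurable_fst. Qed.
Lemma cmeasurable_snd (f : T2 -> R[i]) : cmeasurable f ->
  cmeasurable (fun z : T1 * T2 => f z.2).
Proof. by move=> mf; apply: cmeasurable_comp mf _; exact: measurable_snd. Qed.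
Lemma measurable_fst_comp (f : T1 -> R) : measurable_fun setT f ->
  measurable_fun setT (fun z : T1 * T2 => f z.1).
Proof. by move=> mf; apply: measurableT_comp mf _; exact: measurable_fst. Qed.
Lemma measurable_snd_comp (f : T2 -> R) : measurable_fun setT f ->
  measurable_fun setT (fun z : T1 * T2 => f z.2).
Proof. by move=> mf; apply: measurableT_comp mf _; exact: measurable_snd. Qed.
End ProductMeasurability.

Lemma cmulJ (R : realType) (z w : R[i]) : (conjc (z * w)) = (conjc z) * (conjc w).
Proof. by apply: complex_eqP; rewrite !cparts; ring. Qed.

(** Fatou's lemma, since a convergent sequence agrees with its lower limit. It removes a damping
    factor from bounds that are uniform in it. *)
Lemma ge0_integral_lim_le (R : realType) d (T : measurableType d) (mu : {measure set T -> \bar R})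
    (f : nat -> T -> \bar R) (l : T -> \bar R) (B : \bar R) :
  (forall n, measurable_fun setT (f n)) -> (forall n x, setT x -> (0 <= f n x)%E) ->
  (forall x, (fun n => f n x) @ \oo --> l x) -> (forall n, \int[mu]_x f n x <= B)%E ->
  (\int[mu]_x l x <= B)%E.
Proof.
move=> mf f0 fl fB.
have -> : (\int[mu]_x l x = \int[mu]_x limn_einf (f ^~ x))%E.
  by apply: eq_integral => x _; rewrite (cvg_limn_einf_sup (fl x)).1.
apply: (le_trans (fatou mu measurableT mf f0)).
rewrite limn_einf_lim; apply: lime_le; first exact: is_cvg_einfs.
by apply: nearW => n; apply: le_trans (fB n); apply: ereal_inf_lbound; exists n => /=.
Qed.

(** * Parseval's identity for an [L^2] transform against a bounded integrable function *)

Section FourierL2.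
Context {R : realType}.
Local Notation leb := (@leb R).
Local Notation sqintegrable f := (leb.-integrable setT (EFin \o (fun x => cabs (f x) ^+ 2))).
Implicit Types (H : R -> R[i]) (g : R -> R).

Lemma measurable_idR : measurable_fun setT (fun x : R => x).
Proof. by []. Qed.

Lemma cmeasurable_kernel : cmeasurable (fun z : R * R => eiu (- (z.2 * z.1)) : R[i]).
Proof.
apply: cmeasurable_eiu; apply: measurable_funN; apply: measurable_funM.
  exact: measurable_snd.
exact: measurable_fst.
Qed.
Lemma cmeasurable_kernel_sym : cmeasurable (fun z : R * R => eiu (- (z.1 * z.2)) : R[i]).
Proof.
apply: cmeasurable_eiu; apply: measurable_funN; apply: measurable_funM.
  exact: measurable_fst.
exact: measurable_snd.
Qed.
Lemma cmeasurable_eiuNM x : cmeasurable (fun u : R => eiu (- (u * x))).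
Proof.
by apply: cmeasurable_eiu; apply: measurable_funN; apply: measurable_funM.
Qed.
Lemma cintegrable_eiuM (r : R -> R) H : measurable_fun setT r -> cintegrable leb H ->
  cintegrable leb (fun u => eiu (r u) * H u).
Proof.
move=> mr iH; apply: (cintegrable_le _ _ (cintegrable_cabs iH)).
  by apply: cmeasurableM; [exact: cmeasurable_eiu|exact: cintegrable_meas iH].
by move=> u; rewrite cabsM cabs_eiu mul1r.
Qed.

(** This is [ifourier] without the factor [1 / (2 pi)], which keeps that constant out of the
    estimates. *)
Definition ift H (x : R) := cint leb (fun u => eiu (- (u * x)) * H u).

Lemma cmeasurable_ift H : cmeasurable H -> cmeasurable (ift H).
Proof.
move=> mH; apply: (@cmeasurable_cint_param _ _ _ _ _ leb (fun z : R * R => eiu (- (z.2 * z.1)) * H z.2)).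
by apply: cmeasurableM; [exact: cmeasurable_kernel|exact: cmeasurable_snd].
Qed.
Lemma cabs_ift H x : cintegrable leb H -> cabs (ift H x) <= Rinteg leb (fun u => cabs (H u)).
Proof.
move=> iH; apply: cabs_cint_bound; last exact: cintegrable_cabs.
  apply: cmeasurableM; [exact: cmeasurable_eiuNM|exact: cintegrable_meas iH].
by move=> u; rewrite cabsM cabs_eiu mul1r.
Qed.

Lemma gexp_integrable_scale s : 0 < s -> leb.-integrable setT (EFin \o (fun x => gexp (s * x))).
Proof.
move=> s0; have sn0 : s != 0 by rewrite gt_eqF.
have := rintegrable_affine 0 sn0 (@rintegrable_gexp R).
by under eq_fun do rewrite addr0.
Qed.
Lemma measurable_gexp_scale s : measurable_fun setT (fun x : R => gexp (s * x)).
Proof. by apply: (measurableT_comp measurable_gexp); exact: measurable_mull. Qed.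

(* The weight [gexp (s x)] turns the double integral of [H u * (conjc (H v))] into an
   integral against the density [gdens s (v - u)], uniformly in [s]. *)
Lemma weighted_ift_le H M s : cintegrable leb H -> (forall u, cabs (H u) <= M) -> 0 < s ->
  Rinteg leb (fun x => cabs (ift H x) ^+ 2 * gexp (s * x)) <=
  (pi *+ 2) * M * Rinteg leb (fun u => cabs (H u)).
Proof.
move=> iH HM s0.
have mH := cintegrable_meas iH; have iaH := cintegrable_cabs iH.
set N := Rinteg leb (fun u => cabs (H u)).
have N0 : 0 <= N by apply: Rinteg_ge0 => u; exact: cabs_ge0.
have iw := gexp_integrable_scale s0.
have miH := cmeasurable_ift mH.
pose w x := gexp (s * x).
have w0 x : 0 <= w x by exact: gexp_ge0.
have mw : measurable_fun setT w by exact: measurable_gexp_scale.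
pose I (u : R) := cint leb (fun x => eiu (- (u * x)) * ((conjc (ift H x)) * (w x)%:C)).
have icw : cintegrable leb (fun x => (conjc (ift H x)) * (w x)%:C).
  apply: (cintegrable_le _ _ (rintegrableZ N iw)).
    by apply: cmeasurableM; [exact: cmeasurableJ|exact: cmeasurable_real].
  move=> x; rewrite cabsM cabsJ cabsC ger0_norm// ler_wpM2r//.
  exact: cabs_ift.
have E1 : cint leb (fun x => ift H x * ((conjc (ift H x)) * (w x)%:C)) =
          cint leb (fun u => H u * I u).
  transitivity (cint leb (fun x => cint leb (fun u => eiu (- (u * x)) * H u * ((conjc (ift H x)) * (w x)%:C)))).
    apply: eq_cint => x; rewrite cintZr//; apply: cintegrable_eiuM => //.
    by apply: measurable_funN; apply: measurable_funM.
  rewrite (@cint_fubini _ _ _ _ _ leb leb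
    (fun z : R * R => eiu (- (z.2 * z.1)) * H z.2 * ((conjc (ift H z.1)) * (w z.1)%:C))
    (fun x => N * w x) (fun u => cabs (H u))) //=.
  - apply: eq_cint => u; rewrite -cintZ; last first.
      by apply: cintegrable_eiuM icw; apply: measurable_funN; apply: measurable_funM.
    by apply: eq_cint => x; rewrite -mulrA mulrCA.
  - apply: cmeasurableM.
      by apply: cmeasurableM; [exact: cmeasurable_kernel|exact: cmeasurable_snd].
    apply: (cmeasurable_fst (f := fun x => (conjc (ift H x)) * (w x)%:C)).
    exact: cintegrable_meas icw.
  - move=> x u; rewrite !cabsM cabs_eiu mul1r cabsJ cabsC ger0_norm//.
    rewrite mulrC ler_wpM2r ?cabs_ge0// ler_wpM2r//; exact: cabs_ift.
  - exact: rintegrableZ.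
(* Exchanging the integrals again exposes the Fourier integral of the weight, so [I] is [2 pi] times
   the Gaussian smoothing of the conjugate of [H]. *)
have IE u : I u = cint leb (fun v => (conjc (H v)) * ((pi *+ 2) * gdens s (v - u))%:C).
  transitivity (cint leb (fun x => cint leb (fun v =>
      eiu (- (u * x)) * ((conjc (eiu (- (v * x)) * H v)) * (w x)%:C)))).
    apply: eq_cint => x; rewrite cintZ; last first.
      have iJ := cintegrableZ ((w x)%:C) (cintegrableJ (cintegrable_eiuM
        (measurable_funN (measurable_funM measurable_idR (measurable_cst x))) iH)).
      by under eq_fun do rewrite mulrC.
    rewrite cintZr; last first.
      by apply: cintegrableJ; apply: cintegrable_eiuM => //; apply: measurable_funN; apply: measurable_funM.
    by rewrite cintJ//; apply: cintegrable_eiuM => //; apply: measurable_funN; apply: measurable_funM.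
  rewrite (@cint_fubini _ _ _ _ _ leb leb
    (fun z : R * R => eiu (- (u * z.1)) * ((conjc (eiu (- (z.2 * z.1)) * H z.2)) * (w z.1)%:C))
    w (fun v => cabs (H v))) //=.
  - apply: eq_cint => v; rewrite -(@cint_eiu_gexp_scale _ s (v - u))// -cintZ; last first.
      apply: (cintegrable_le _ _ iw).
        apply: cmeasurableM; last exact: cmeasurable_real.
        by apply: cmeasurable_eiu; exact: measurable_funM.
      by move=> x; rewrite cabsM cabs_eiu mul1r cabsC ger0_norm ?gexp_ge0.
    apply: eq_cint => x.
    rewrite cmulJ -[conjc (eiu _)]eiuN opprK.
    have -> : eiu (x * (v - u)) = eiu (- (u * x)) * eiu (v * x).
      by rewrite -eiuD; congr eiu; ring.
    by ring.
  - apply: cmeasurableM.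
      apply: (cmeasurable_fst (f := fun x => eiu (- (u * x)))).
      by apply: cmeasurable_eiu; apply: measurable_funN; exact: measurable_funM.
    apply: cmeasurableM; last by apply: (cmeasurable_fst (f := fun x => (w x)%:C)); exact: cmeasurable_real.
    by apply: cmeasurableJ; apply: cmeasurableM; [exact: cmeasurable_kernel|exact: cmeasurable_snd].
  - by move=> x v; rewrite !cabsM !cabsJ !cabsM !cabs_eiu !mul1r cabsC ger0_norm// mulrC.
have pi2 : 0 <= pi *+ 2 :> R by rewrite mulrn_wge0// pi_ge0.
have M0 : 0 <= M by apply: (le_trans (cabs_ge0 _) (HM 0)).
(* The density [gdens s] has mass one, so the bound [M] on [H] passes to [I] up to [2 pi], with no
   dependence on [s]. *)
have IM u : cabs (I u) <= pi *+ 2 * M.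
  have ig : leb.-integrable setT (EFin \o (fun v => gdens s (v - u))).
    have := rintegrable_affine (- u) (oner_neq0 R) (rintegrable_gdens s0).
    by under eq_fun do rewrite mul1r.
  have -> : pi *+ 2 * M = Rinteg leb (fun v => pi *+ 2 * M * gdens s (v - u)).
    rewrite RintegZ//; have := Rinteg_affine (- u) (oner_neq0 R) (rintegrable_gdens s0).
    by under [in X in _ = X -> _]eq_fun do rewrite mul1r; rewrite normr1 mul1r Rinteg_gdens// => <-; rewrite mulr1.
  rewrite IE; apply: cabs_cint_bound; last exact: rintegrableZ.
    apply: cmeasurableM; first exact: cmeasurableJ.
    by apply: cmeasurable_real; apply: measurable_funM => //; exact: rintegrable_meas ig.
  move=> v; rewrite cabsM cabsJ cabsC normrM (ger0_norm pi2).
  rewrite ger0_norm ?gdens_ge0// mulrCA -mulrA ler_wpM2l//.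
  by rewrite ler_wpM2r// gdens_ge0.
have -> : Rinteg leb (fun x => cabs (ift H x) ^+ 2 * gexp (s * x)) =
    cre (cint leb (fun x => ift H x * ((conjc (ift H x)) * (w x)%:C))).
  rewrite -[RHS]/(Rinteg leb (fun x => cre (ift H x * (conjc (ift H x) * (w x)%:C)))).
  by congr Rinteg; apply/funext => x; rewrite mulrA [ift H x * _]mulrC mulJc -rmorphM.
rewrite E1; apply: (le_trans (ler_norm _)); apply: (le_trans (cre_le_cabs _)).
rewrite -RintegZ//; apply: cabs_cint_bound; last exact: rintegrableZ.
  apply: cmeasurableM => //.
  apply: (@cmeasurable_cint_param _ _ _ _ _ leb
    (fun z : R * R => eiu (- (z.1 * z.2)) * ((conjc (ift H z.2)) * (w z.2)%:C))).
  apply: cmeasurableM; first exact: cmeasurable_kernel_sym.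
  apply: (cmeasurable_snd (f := fun x => conjc (ift H x) * (w x)%:C)).
  exact: cintegrable_meas icw.
by move=> u; rewrite cabsM mulrC ler_wpM2r ?cabs_ge0.
Qed.

(** The weighted bound does not depend on [s]; taking [s = 1 / (n + 1)] and applying Fatou removes
    the weight. This half of Plancherel is what Parseval needs about [H]. *)
Lemma sqintegrable_ift H M : cintegrable leb H -> (forall u, cabs (H u) <= M) ->
  sqintegrable (ift H).
Proof.
move=> iH HM; have mH := cintegrable_meas iH.
have mi := measurable_cabs (cmeasurable_ift mH).
pose B := (pi *+ 2) * M * Rinteg leb (fun u => cabs (H u)).
pose f n x := (cabs (ift H x) ^+ 2 * gexp (n.+1%:R^-1 * x))%:E.
have mf n : measurable_fun setT (f n).
  apply/measurable_EFinP; apply: measurable_funM; first exact: measurable_funX.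
  exact: measurable_gexp_scale.
have f0 n x : setT x -> (0 <= f n x)%E.
  by move=> _; rewrite lee_fin mulr_ge0 ?sqr_ge0 ?gexp_ge0.
apply/integrableP; split; first by apply/measurable_EFinP; exact: measurable_funX.
have fB n : (\int[leb]_x f n x <= B%:E)%E.
  have s0 : 0 < (n.+1%:R^-1 : R) by rewrite invr_gt0.
  rewrite -EFin_Rinteg ?lee_fin; first exact: weighted_ift_le.
  apply: (rintegrable_le _ _ (rintegrableZ ((Rinteg leb (fun u => cabs (H u))) ^+ 2)
    (gexp_integrable_scale s0))).
    by apply/measurable_EFinP; exact: mf.
  move=> x; rewrite ger0_norm; last by rewrite mulr_ge0 ?sqr_ge0 ?gexp_ge0.
  rewrite ler_wpM2r ?gexp_ge0//; apply: lerXn2r; rewrite ?nnegrE ?cabs_ge0 ?cabs_ift//.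
  by apply: Rinteg_ge0 => u; exact: cabs_ge0.
apply: (@le_lt_trans _ _ B%:E); last exact: ltry.
have cf x : (fun n => f n x) @ \oo --> (cabs (ift H x) ^+ 2)%:E.
  apply/fine_cvgP; split; first exact: nearW.
  rewrite -[X in _ --> X]mulr1; apply: cvgM; first exact: cvg_cst.
  have h0 : (fun n : nat => n.+1%:R^-1 * x) @ \oo --> (0 : R).
    by rewrite -[X in _ --> X](mul0r x); apply: cvgM; [exact: cvg_harmonic|exact: cvg_cst].
  have h1 : (fun n : nat => gexp (n.+1%:R^-1 * x)) @ \oo --> gexp (0 : R).
    exact: (cvg_comp _ _ h0 (@continuous_gexp R 0)).
  by rewrite gexp0 in h1.
under eq_integral => x _ do rewrite /= ger0_norm ?sqr_ge0//.
by apply: (@ge0_integral_lim_le _ _ _ leb f).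
Qed.

Section Parseval.
Variables (g : R -> R) (G : R -> R[i]) (C : R).
Hypotheses (mg : measurable_fun setT g) (gC : forall x, `|g x| <= C)
  (g2 : (\int[leb]_x (g x ^+ 2)%:E < +oo)%E) (gG : is_L2_fourier g G).

Let gA (A : nat) (x : R) : R := \1_`[- A%:R, A%:R] x * g x.
Let D (A : nat) (u : R) : R[i] := G u - fourier (gA A) u.

Let rintegrable_g2 : leb.-integrable setT (EFin \o (fun x => g x ^+ 2)).
Proof.
apply/integrableP; split; first by apply/measurable_EFinP; exact: measurable_funX.
apply: le_lt_trans g2; apply: ge0_le_integral => //=.
- by apply/measurable_EFinP; apply: measurableT_comp => //; exact: measurable_funX.
- by apply/measurable_EFinP; exact: measurable_funX.
- by move=> x _; rewrite lee_fin ger0_norm// sqr_ge0.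
Qed.
Let measurable_gA A : measurable_fun setT (gA A).
Proof. by apply: measurable_funM => //; exact: measurable_indic. Qed.
Let rintegrable_gA A : leb.-integrable setT (EFin \o gA A).
Proof.
have iI : leb.-integrable setT (EFin \o (\1_`[- A%:R, A%:R] : R -> R)).
  exact: integrable_indic_itv.
apply: (rintegrable_le _ _ (rintegrableZ C iI)) => [|x]; first exact: measurable_gA.
rewrite /gA normrM [leLHS]mulrC; apply: ler_pM => //.
by rewrite indicE; case: (_ \in _); rewrite ?normr1 ?normr0.
Qed.
Lemma cmeasurable_fourier (f : R -> R) : measurable_fun setT f -> cmeasurable (fourier f).
Proof.
move=> mf; apply: (@cmeasurable_cint_param _ _ _ _ _ leb
  (fun z : R * R => eiu (z.1 * z.2) * (f z.2)%:C)).
apply: cmeasurableM.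
  apply: cmeasurable_eiu; apply: measurable_funM; [exact: measurable_fst|exact: measurable_snd].
by apply: (cmeasurable_snd (f := fun x => (f x)%:C)); exact: cmeasurable_real.
Qed.
Lemma cabs_fourier (f : R -> R) u : leb.-integrable setT (EFin \o f) ->
  cabs (fourier f u) <= Rinteg leb (fun x => `|f x|).
Proof.
move=> if_; apply: cabs_cint_bound; last exact: rintegrable_norm.
  apply: cmeasurableM; first by apply: cmeasurable_eiu; exact: measurable_funM.
  by apply: cmeasurable_real; exact: rintegrable_meas if_.
by move=> x; rewrite cabsM cabs_eiu mul1r cabsC.
Qed.

(** Convergence to 0 in the extended reals makes the errors finite only from some truncation on,
    hence the [near] in the first conclusion. *)
Lemma L2_fourier_cvg : (\forall A \near \oo, sqintegrable (D A)) /\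
  (fun A => Rinteg leb (fun u => cabs (D A u) ^+ 2)) @ \oo --> (0 : R).
Proof.
have [mG1 [mG2 cG]] := gG.
have /fine_cvgP[fG cG'] := cG; split => //.
apply: filterS fG => A fA; apply/integrableP; split.
  apply/measurable_EFinP; apply: measurable_funX; apply: measurable_cabs.
  by apply: cmeasurableB => //; exact: cmeasurable_fourier.
rewrite [X in (X < _)%E](_ : _ = \int[leb]_x ((cabs (D A x)) ^+ 2)%:E)%E.
  by rewrite ltey_eq; apply/orP; left; exact: fA.
by apply: eq_integral => x _ /=; rewrite ger0_norm// sqr_ge0.
Qed.

Variables (H : R -> R[i]) (M : R).
Hypotheses (iH : cintegrable leb H) (HM : forall u, cabs (H u) <= M).

Let mH : cmeasurable H. Proof. exact: cintegrable_meas iH. Qed.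

Let sqH : sqintegrable H.
Proof.
apply: (rintegrable_le _ _ (rintegrableZ M (cintegrable_cabs iH))).
  by apply: measurable_funX; exact: measurable_cabs.
by move=> u; rewrite ger0_norm ?sqr_ge0// expr2 ler_wpM2r ?cabs_ge0.
Qed.

(** The difference of the two sides is the square of [a - e * b] up to a positive factor. The free
    [e] replaces Cauchy-Schwarz: it is later taken close to the [L^2] distance being estimated. *)
Let young (a b e : R) : 0 < e -> a * b <= e^-1 / 2 * a ^+ 2 + e / 2 * b ^+ 2.
Proof.
move=> e0; rewrite -subr_ge0.
have -> : e^-1 / 2 * a ^+ 2 + e / 2 * b ^+ 2 - a * b = e^-1 / 2 * (a - e * b) ^+ 2.
  by field; rewrite gt_eqF.
by rewrite mulr_ge0 ?sqr_ge0// divr_ge0// invr_ge0 ltW.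
Qed.

Lemma cintegrable_g_ift : cintegrable leb (fun x => (g x)%:C * ift H x).
Proof.
apply: (cintegrable_le _ _ (rintegrableD rintegrable_g2 (sqintegrable_ift iH HM))).
  by apply: cmeasurableM; [exact: cmeasurable_real|exact: cmeasurable_ift].
move=> x; rewrite cabsM cabsC; have := @young `|g x| (cabs (ift H x)) 1 ltr01.
rewrite real_normK ?num_real// invr1.
have := sqr_ge0 (g x); have := sqr_ge0 (cabs (ift H x)); lra.
Qed.

(** A truncated [g] is bounded on a compact interval, hence integrable, and Fubini applies
    directly. *)
Let parseval_trunc A : cint leb (fun x => (gA A x)%:C * ift H x) =
  cint leb (fun u => fourier (gA A) (- u) * H u).
Proof.
have iK (x : R) : cintegrable leb (fun u => eiu (- (u * x)) * H u).
  by apply: cintegrable_eiuM => //; apply: measurable_funN; exact: measurable_funM.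
transitivity (cint leb (fun x => cint leb (fun u => (gA A x)%:C * (eiu (- (u * x)) * H u)))).
  by apply: eq_cint => x; rewrite cintZ.
rewrite (@cint_fubini _ _ _ _ _ leb leb
  (fun z : R * R => (gA A z.1)%:C * (eiu (- (z.2 * z.1)) * H z.2))
  (fun x => `|gA A x|) (fun u => cabs (H u))) //=.
- apply: eq_cint => u; rewrite /fourier -cintZr; last first.
    apply: cintegrable_eiuM; [exact: measurable_funM|].
    exact: cintegrable_real (rintegrable_gA A).
  by apply: eq_cint => x; rewrite mulNr; ring.
- apply: cmeasurableM.
    by apply: (cmeasurable_fst (f := fun x => (gA A x)%:C)); exact: cmeasurable_real.
  by apply: cmeasurableM; [exact: cmeasurable_kernel|exact: cmeasurable_snd].
- by move=> x u; rewrite !cabsM cabs_eiu mul1r cabsC.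
- exact: rintegrable_norm (rintegrable_gA A).
- exact: cintegrable_cabs.
Qed.

Let sqD_opp A : sqintegrable (D A) -> sqintegrable (fun u => D A (- u)) /\
  Rinteg leb (fun u => cabs (D A (- u)) ^+ 2) = Rinteg leb (fun u => cabs (D A u) ^+ 2).
Proof.
move=> iD; split; last exact: (Rinteg_opp iD).
have N1 : (-1 : R) != 0 by rewrite oppr_eq0 oner_eq0.
have := rintegrable_affine 0 N1 iD.
by under eq_fun do rewrite addr0 mulN1r.
Qed.

Let cmeasurable_GN : cmeasurable (fun u : R => G (- u)).
Proof.
by have [m1 [m2 _]] := gG; apply: (cmeasurable_comp (f := G)).
Qed.
Let cmeasurable_FN A : cmeasurable (fun u : R => fourier (gA A) (- u)).
Proof.
apply: (cmeasurable_comp (f := fourier (gA A))); last exact: measurable_funN.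
exact: cmeasurable_fourier.
Qed.
Let cintegrable_FH A : cintegrable leb (fun u => fourier (gA A) (- u) * H u).
Proof.
apply: (cintegrable_le _ _ (rintegrableZ (Rinteg leb (fun x => `|gA A x|)) (cintegrable_cabs iH))).
  by apply: cmeasurableM; [exact: cmeasurable_FN|exact: mH].
move=> u; rewrite cabsM ler_wpM2r ?cabs_ge0//; apply: cabs_fourier.
exact: rintegrable_gA.
Qed.
Let DH_le A (e : R) : 0 < e -> sqintegrable (D A) ->
  cintegrable leb (fun u => D A (- u) * H u) /\
  cabs (cint leb (fun u => D A (- u) * H u)) <=
    e^-1 / 2 * Rinteg leb (fun u => cabs (D A u) ^+ 2) + e / 2 * Rinteg leb (fun u => cabs (H u) ^+ 2).
Proof.
move=> e0 iD; have [iDN <-] := sqD_opp iD.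
have i1 := rintegrableZ (e^-1 / 2) iDN; have i2 := rintegrableZ (e / 2) sqH.
have m12 : cmeasurable (fun u : R => D A (- u) * H u).
  apply: cmeasurableM; last exact: mH.
  by apply: cmeasurableB; [exact: cmeasurable_GN|exact: cmeasurable_FN].
have le12 u : cabs (D A (- u) * H u) <= e^-1 / 2 * cabs (D A (- u)) ^+ 2 + e / 2 * cabs (H u) ^+ 2.
  by rewrite cabsM; exact: young.
split; first exact: (cintegrable_le _ _ (rintegrableD i1 i2)).
by rewrite -RintegZ// -RintegZ// -RintegD//; apply: cabs_cint_bound => //; exact: rintegrableD.
Qed.

(** For one large truncation, [G] is the error [D A], square integrable and so integrable against
    [H] by Young, plus the transform of an integrable function, which is bounded. *)
Lemma cintegrable_GH : cintegrable leb (fun u => G (- u) * H u).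
Proof.
have [[A _ iD] _] := L2_fourier_cvg.
have [iDH _] := DH_le ltr01 (iD A (leqnn A)).
have := cintegrableD iDH (cintegrable_FH A).
by under eq_fun do rewrite -mulrDl subrK.
Qed.

(** The truncated identity passes to the limit: the space side by dominated convergence, the
    frequency side by the Young bound on [D A (- u) * H u]. *)
Lemma parseval : cint leb (fun x => (g x)%:C * ift H x) = cint leb (fun u => G (- u) * H u).
Proof.
have [nD cD] := L2_fourier_cvg.
have [_ c1] : cintegrable leb (fun x => (g x)%:C * ift H x) /\
    ccvg (fun A => cint leb (fun x => (gA A x)%:C * ift H x)) (cint leb (fun x => (g x)%:C * ift H x)).
  apply: (cint_dct _ _ (cintegrable_cabs cintegrable_g_ift)).
  - move=> A; apply: cmeasurableM; first exact: cmeasurable_real (measurable_gA A).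
    exact: cmeasurable_ift.
  - move=> A x; rewrite !cabsM !cabsC ler_wpM2r ?cabs_ge0// /gA normrM ler_piMl//.
    by rewrite indicE; case: (_ \in _); rewrite ?normr1 ?normr0.
  - move=> x; apply: ccvgM; last exact: ccvg_cst.
    apply: ccvg_real; apply: (@cvg_near_cst nat).
    exists (Num.truncn `|x|).+1 => // n /= mn; rewrite /gA indicE mem_set ?mul1r//= in_itv/= -ler_norml.
    by apply: ltW; apply: (lt_le_trans (truncnS_gt _)); rewrite ler_nat.
apply: (ccvg_unique c1).
apply: near_ccvg; first by apply: nearW => A; exact/esym/parseval_trunc.
pose d A := Rinteg leb (fun u => cabs (D A u) ^+ 2).
(* The choice [e = sqrt d] would make [d / e] equal to [e]; the harmonic term keeps [e] positive
   when [d A = 0] and still vanishes in the limit. *)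
pose e A : R := Num.sqrt (d A) + harmonic A.
have d0 A : 0 <= d A by apply: Rinteg_ge0 => u; exact: sqr_ge0.
have h0 A : 0 < harmonic A :> R by rewrite invr_gt0.
have e0 A : 0 < e A by apply: ltr_wpDl => //; exact: sqrtr_ge0.
pose h2 := Rinteg leb (fun u => cabs (H u) ^+ 2).
have ce : (fun A => e A / 2 + e A / 2 * h2) @ \oo --> (0 : R).
  have ce0 : e @ \oo --> (0 : R).
    rewrite -[X in _ --> X]addr0; apply: cvgD; last exact: cvg_harmonic.
    by rewrite -[X in _ --> X](@sqrtr0 R); apply: (continuous_cvg _ (@sqrt_continuous R 0) cD).
  rewrite (_ : (0:R) = 0 / 2 + 0 / 2 * h2); last by rewrite !mul0r addr0.
  by apply: cvgD; [|apply: cvgM; last exact: cvg_cst]; apply: cvgM => //; exact: cvg_cst.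
apply: (ccvg_le _ ce); apply: filterS nD => A iD.
have [iDH leDH] := DH_le (e0 A) iD.
rewrite cabs_distC -cintB//; last exact: cintegrable_GH.
under eq_cint do rewrite -mulrBl.
apply: (le_trans leDH); rewrite lerD2r -/(d A).
rewrite mulrAC ler_pM2r ?invr_gt0// ler_pdivrMl// -expr2.
rewrite -[X in X <= _](sqr_sqrtr (d0 A)); apply: lerXn2r; rewrite ?nnegrE ?sqrtr_ge0//.
  exact: ltW.
by rewrite lerDl ltW.
Qed.
End Parseval.
End FourierL2.

Lemma realcM (R : realType) (x y : R) : (x * y)%:C = x%:C * y%:C.
Proof. exact: rmorphM. Qed.

(** * Fourier inversion almost everywhere *)

Section FourierInversion.
Context {R : realType}.
Local Notation leb := (@leb R).

(** Smoothed indicators of [[a, b]] need not converge to the indicator at the two endpoints, so a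
    version with a null exceptional set is required. *)
Lemma Rinteg_dct_ae d (T : measurableType d) (mu : {measure set T -> \bar R})
    (r : nat -> T -> R) (l s : T -> R) :
  (forall n, measurable_fun setT (r n)) -> measurable_fun setT l ->
  (forall n x, `|r n x| <= s x) ->
  mu.-integrable setT (EFin \o s) -> {ae mu, forall x, (fun n => r n x) @ \oo --> l x} ->
  (fun n => Rinteg mu (r n)) @ \oo --> Rinteg mu l.
Proof.
move=> mr ml rs is_ rl.
have [] := @dominated_convergence _ _ _ mu _ measurableT (fun n => EFin \o r n)
  (EFin \o l) (EFin \o s).
- by move=> n; exact/measurable_EFinP.
- exact/measurable_EFinP.
- by apply: filterS rl => x rlx _; apply/fine_cvgP; split; [exact: nearW|exact: rlx].
- exact: is_.
- by apply: aeW => x n _; rewrite /= lee_fin.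
move=> il _ cl.
have fl : (\int[mu]_x (l x)%:E)%E \is a fin_num by exact: integrable_fin_num.
by apply: fine_cvg; rewrite fineK.
Qed.

Lemma ae_neq (a : R) : {ae leb, forall x, x != a}.
Proof.
exists [set a]; split; [exact: measurable_set1|exact: lebesgue_measure_set1|].
by move=> x /= /negP; rewrite negbK => /eqP.
Qed.

Lemma indic_cvg_interior (a b x : R) (y : nat -> R) : x != a -> x != b ->
  y @ \oo --> x -> (fun n => \1_`[a, b] (y n) : R) @ \oo --> (\1_`[a, b] x : R).
Proof.
move=> xa xb yx; apply: cvg_near_cst.
pose e := Num.min `|x - a| `|x - b|.
have e0 : 0 < e by rewrite lt_min !normr_gt0 !subr_eq0 xa xb.
move/cvgrPdist_lt : yx => /(_ e e0); apply: filterS => n.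
rewrite lt_min => /andP[ha hb]; rewrite !indicE; congr ((nat_of_bool _)%:R).
apply/idP/idP; rewrite !inE/= !in_itv/= => /andP[h1 h2]; apply/andP; split;
 move: ha hb; rewrite !ltr_norml; case: (ger0P (x - a)) => ?; case: (ger0P (x - b)) => ?; move=> /andP[? ?] /andP[? ?]; lra.
Qed.

Lemma cvg_harmonic_mull (x : R) : (fun n : nat => harmonic n * x) @ \oo --> (0 : R).
Proof. by rewrite -[X in _ --> X](mul0r x); apply: cvgM; [exact: cvg_harmonic|exact: cvg_cst]. Qed.

Lemma harmonic_gt0 n : 0 < harmonic n :> R. Proof. by rewrite invr_gt0. Qed.

Section Smoothing.
Variables (K : R -> R) (a b : R).
Hypotheses (iK : leb.-integrable setT (EFin \o K)) (iFK : cintegrable leb (fourier K)).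

Let mK : measurable_fun setT K. Proof. exact: rintegrable_meas iK. Qed.
Let I (y : R) : R := \1_`[a, b] y.
Let mI : measurable_fun setT I. Proof. exact: measurable_indic. Qed.
Let I1 y : I y <= 1. Proof. by rewrite /I indicE; case: (_ \in _). Qed.
Let I0 y : 0 <= I y. Proof. by rewrite /I indicE. Qed.
Let iI : leb.-integrable setT (EFin \o I). Proof. exact: integrable_indic_itv. Qed.
(** The indicator of [[a, b]] mollified by a Gaussian: it appears when Fubini moves the smoothing
    from [K], which is merely integrable, to the indicator. *)
Let rho (s x : R) : R := Rinteg leb (fun y => I y * gdens s (y - x)).

Let gdens_le (s x : R) : 0 < s -> gdens s x <= (s * @gmass R)^-1.
Proof. by move=> s0; rewrite ler_piMr ?gexp_le1// invr_ge0 mulr_ge0 ?ltW// gmass_gt0. Qed.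

Let rhoE (s x : R) : 0 < s -> rho s x = Rinteg leb (fun v => I (s * v + x) * (gmass^-1 * gexp v)).
Proof.
move=> s0; have sn0 : s != 0 by rewrite gt_eqF.
have igs : leb.-integrable setT (EFin \o (fun y => gdens s (y - x))).
  have := rintegrable_affine (- x) (oner_neq0 R) (rintegrable_gdens s0).
  by under eq_fun do rewrite mul1r.
have iIg : leb.-integrable setT (EFin \o (fun y => I y * gdens s (y - x))).
  apply: (rintegrable_le _ _ igs).
    by apply: measurable_funM; [exact: mI|exact: rintegrable_meas igs].
  by move=> y; rewrite normrM !ger0_norm ?gdens_ge0// ler_piMl ?gdens_ge0.
rewrite /rho (Rinteg_affine x sn0 iIg) gtr0_norm// -RintegZ; last exact: (rintegrable_affine x sn0 iIg).
congr Rinteg; apply/funext => v; rewrite addrK /gdens mulrCA; congr (_ * _).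
by rewrite mulrA invfM mulrA divff// mul1r mulrA mulVf// mul1r.
Qed.

Let igm : leb.-integrable setT (EFin \o (fun v => gmass^-1 * gexp v : R)).
Proof. by apply: rintegrableZ; exact: rintegrable_gexp. Qed.
Let Rinteg_gm : Rinteg leb (fun v => gmass^-1 * gexp v : R) = 1.
Proof. by rewrite RintegZ ?Rinteg_gexp ?mulVf// ?gt_eqF ?gmass_gt0//; exact: rintegrable_gexp. Qed.
Let gm0 (v : R) : 0 <= gmass^-1 * gexp v.
Proof. by rewrite mulr_ge0 ?gexp_ge0// invr_ge0 ltW// gmass_gt0. Qed.
Let mIaff s x : measurable_fun setT (fun v : R => I (s * v + x)).
Proof. by apply: (measurableT_comp mI); exact: measurable_affine. Qed.
Let iIaff s x : leb.-integrable setT (EFin \o (fun v => I (s * v + x) * (gmass^-1 * gexp v))).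
Proof.
apply: (rintegrable_le _ _ igm).
  by apply: measurable_funM; [exact: mIaff|exact: rintegrable_meas igm].
by move=> v; rewrite normrM !ger0_norm// ler_piMl.
Qed.

Let rho_bound (s x : R) : 0 < s -> `|rho s x| <= 1.
Proof.
move=> s0; rewrite rhoE// -[leRHS]Rinteg_gm.
apply: (le_trans (normr_Rinteg (iIaff _ _))); apply: le_Rinteg => //.
  exact: rintegrable_norm (iIaff s x).
by move=> v; rewrite normrM !ger0_norm// ler_piMl.
Qed.

Let rho_cvg x : x != a -> x != b -> (fun n => rho (harmonic n) x) @ \oo --> I x.
Proof.
move=> xa xb.
have -> : (fun n => rho (harmonic n) x) =
    (fun n => Rinteg leb (fun v => I (harmonic n * v + x) * (gmass^-1 * gexp v))).
  by apply/funext => n; rewrite rhoE ?harmonic_gt0.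
have -> : I x = Rinteg leb (fun v => I x * (gmass^-1 * gexp v)).
  by rewrite RintegZ// Rinteg_gm mulr1.
apply: (proj2 (@Rinteg_dct R _ _ leb (fun n v => I (harmonic n * v + x) * (gmass^-1 * gexp v))
  _ (fun v => gmass^-1 * gexp v) _ _ igm _)).
- by move=> n; exact: rintegrable_meas (iIaff _ _).
- by move=> n v; rewrite normrM !ger0_norm// ler_piMl.
move=> v; apply: cvgM; last exact: cvg_cst.
apply: indic_cvg_interior => //.
by rewrite -[X in _ --> X]add0r; apply: cvgD; [exact: cvg_harmonic_mull|exact: cvg_cst].
Qed.

Let mgdens2 s : measurable_fun setT (fun z : R * R => gdens s (z.2 - z.1)).
Proof.
apply: (measurableT_comp (@measurable_gdens R s)); apply: measurable_funB.
  exact: measurable_snd.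
exact: measurable_fst.
Qed.

Let measurable_rho s : measurable_fun setT (rho s).
Proof.
apply: (@measurable_Rinteg_param _ _ _ _ _ leb (fun z : R * R => I z.2 * gdens s (z.2 - z.1))).
by apply: measurable_funM; [exact: measurable_snd_comp mI|exact: mgdens2].
Qed.

Let rho_lim : (fun n => Rinteg leb (fun x => rho (harmonic n) x * K x)) @ \oo -->
  Rinteg leb (fun x => I x * K x).
Proof.
apply: (@Rinteg_dct_ae _ _ leb (fun n x => rho (harmonic n) x * K x) _ (fun x => `|K x|)).
- by move=> n; apply: measurable_funM; [exact: measurable_rho|exact: mK].
- by apply: measurable_funM; [exact: mI|exact: mK].
- by move=> n x; rewrite normrM ler_piMl// rho_bound// harmonic_gt0.
- exact: rintegrable_norm.
have FF : Filter (almost_everywhere leb) := ae_filter_ringOfSetsType _.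
apply: filterS2 (ae_neq a) (ae_neq b) => x xa xb.
by apply: cvgM; [exact: rho_cvg|exact: cvg_cst].
Qed.

Let KG (s y : R) := cint leb (fun u => eiu (u * y) * (gexp (s * u))%:C * fourier K (- u)).

Let iFKN : cintegrable leb (fun u => fourier K (- u)). Proof. exact: cintegrable_opp. Qed.

(** The Gaussian density is replaced by its own Fourier integral and the order of integration is
    exchanged; the damping factor supplies integrability in [u]. *)
Let smoothE s y : 0 < s ->
  cint leb (fun x => (gdens s (y - x) * K x)%:C) = ((pi *+ 2)^-1)%:C * KG s y.
Proof.
move=> s0; have pi0 : (pi *+ 2 : R) != 0 by rewrite gt_eqF// mulrn_wgt0// pi_gt0.
have igs := gexp_integrable_scale s0.
have ie x : cintegrable leb (fun u => eiu (u * x) * (gexp (s * u))%:C).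
  by apply: cintegrable_eiuM; [exact: measurable_funM|exact: cintegrable_real].
have E x : (gdens s (y - x) * K x)%:C = ((pi *+ 2)^-1)%:C *
    cint leb (fun u => eiu (u * (y - x)) * (gexp (s * u))%:C * (K x)%:C).
  rewrite cintZr// cint_eiu_gexp_scale// mulrA -!rmorphM/= -[in RHS]mulrA.
  by rewrite mulrA mulrA mulVf// mul1r.
under eq_cint do rewrite E.
rewrite cintZ; last first.
  apply: (@cintegrable_inner _ _ _ _ _ leb leb
    (fun z : R * R => eiu (z.2 * (y - z.1)) * (gexp (s * z.2))%:C * (K z.1)%:C)
    (fun x => `|K x|) (fun u => gexp (s * u))) => //.
  - apply: cmeasurableM; last first.
      by apply: (cmeasurable_fst (f := fun x => (K x)%:C)); exact: cmeasurable_real.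
    apply: cmeasurableM; last first.
      apply: (cmeasurable_snd (f := fun u : R => (gexp (s * u))%:C)); apply: cmeasurable_real.
      exact: measurable_gexp_scale.
    apply: cmeasurable_eiu; apply: measurable_funM; first exact: measurable_snd.
    by apply: measurable_funB => //; exact: measurable_fst.
  - by move=> x u; rewrite !cabsM cabs_eiu mul1r !cabsC ger0_norm ?gexp_ge0// mulrC.
  - exact: rintegrable_norm.
congr (_ * _).
rewrite (@cint_fubini _ _ _ _ _ leb leb
    (fun z : R * R => eiu (z.2 * (y - z.1)) * (gexp (s * z.2))%:C * (K z.1)%:C)
    (fun x => `|K x|) (fun u => gexp (s * u))) //.
- apply: eq_cint => u; rewrite -cintZ; last first.
    apply: cintegrable_eiuM; [exact: measurable_funM|exact: cintegrable_real].
  apply: eq_cint => x /=; have -> : u * (y - x) = u * y + - u * x by ring.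
  by rewrite eiuD; ring.
- apply: cmeasurableM; last first.
    by apply: (cmeasurable_fst (f := fun x => (K x)%:C)); exact: cmeasurable_real.
  apply: cmeasurableM; last first.
    apply: (cmeasurable_snd (f := fun u : R => (gexp (s * u))%:C)); apply: cmeasurable_real.
    exact: measurable_gexp_scale.
  apply: cmeasurable_eiu; apply: measurable_funM; first exact: measurable_snd.
  by apply: measurable_funB => //; exact: measurable_fst.
- by move=> x u; rewrite !cabsM cabs_eiu mul1r !cabsC ger0_norm ?gexp_ge0// mulrC.
- exact: rintegrable_norm.
Qed.

Let NF := Rinteg leb (fun u => cabs (fourier K (- u))).

Let cKG (s y : R) : cmeasurable (fun u : R => eiu (u * y) * (gexp (s * u))%:C * fourier K (- u)).
Proof.
apply: cmeasurableM; last exact: cintegrable_meas iFKN.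
apply: cmeasurableM; first by apply: cmeasurable_eiu; exact: measurable_funM.
by apply: cmeasurable_real; exact: measurable_gexp_scale.
Qed.
Let bKG (s y u : R) : cabs (eiu (u * y) * (gexp (s * u))%:C * fourier K (- u)) <= cabs (fourier K (- u)).
Proof.
rewrite !cabsM cabs_eiu mul1r cabsC ger0_norm ?gexp_ge0//.
by rewrite ler_piMl ?cabs_ge0// gexp_le1.
Qed.

Let KG_cvg y : ccvg (fun n => KG (harmonic n) y) (ift (fourier K) y).
Proof.
have -> : ift (fourier K) y = cint leb (fun u => eiu (u * y) * fourier K (- u)).
  rewrite -[LHS]cint_opp; last first.
    by apply: cintegrable_eiuM => //; apply: measurable_funN; exact: measurable_funM.
  by apply: eq_cint => u; rewrite mulNr opprK.
apply: (proj2 (@cint_dct R _ _ leb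
  (fun n u => eiu (u * y) * (gexp (harmonic n * u))%:C * fourier K (- u)) _
  (fun u => cabs (fourier K (- u))) _ _ (cintegrable_cabs iFKN) _)).
- by move=> n; exact: cKG.
- by move=> n u; exact: bKG.
move=> u; apply: ccvgM; last exact: ccvg_cst.
rewrite -[X in ccvg _ X]mulr1; apply: ccvgM; first exact: ccvg_cst.
rewrite -[1]/(1%:C) -(@gexp0 R); apply: ccvg_real.
exact: (cvg_comp _ _ (cvg_harmonic_mull u) (@continuous_gexp R 0)).
Qed.

(** The damped inversion formula is integrated over [[a, b]] and the damping is removed. On one side
    the mollified indicator tends to the indicator off the endpoints, on the other the damping
    factor tends to one under the integrable bound [|F K|]. *)
Lemma interval_inversion : cint leb (fun y => (I y * K y)%:C) =
  cint leb (fun y => (I y)%:C * (((pi *+ 2)^-1)%:C * ift (fourier K) y)).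
Proof.
have h1 : ccvg (fun n => (Rinteg leb (fun x => rho (harmonic n) x * K x))%:C)
    (cint leb (fun y => (I y * K y)%:C)).
  by rewrite cint_real; exact: ccvg_real rho_lim.
apply: (ccvg_unique h1).
have E n : cint leb (fun y => (I y)%:C * (((pi *+ 2)^-1)%:C * KG (harmonic n) y)) =
  (Rinteg leb (fun x => rho (harmonic n) x * K x))%:C.
  have s0 := harmonic_gt0 n; set s := harmonic n in s0 *.
  have igs x : leb.-integrable setT (EFin \o (fun y => I y * gdens s (y - x))).
    apply: (rintegrable_le _ _ (rintegrableZ (s * gmass)^-1 iI)).
      apply: measurable_funM; first exact: mI.
      exact: (measurable_fun_pair2 x (mgdens2 s)).
    move=> y; rewrite normrM !ger0_norm ?gdens_ge0// mulrC ler_wpM2r//.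
    exact: gdens_le.
  have F : Rinteg leb (fun x => rho s x * K x) =
      Rinteg leb (fun y => Rinteg leb (fun x => I y * (gdens s (y - x) * K x))).
    transitivity (Rinteg leb (fun x => Rinteg leb (fun y => I y * (gdens s (y - x) * K x)))).
      congr Rinteg; apply/funext => x; rewrite mulrC -RintegZ//.
      by congr Rinteg; apply/funext => y; ring.
    rewrite (@Rinteg_fubini _ _ _ _ _ leb leb
      (fun z : R * R => I z.2 * (gdens s (z.2 - z.1) * K z.1))
      (fun x => (s * gmass)^-1 * `|K x|) I) //.
    - apply: measurable_funM; first exact: measurable_snd_comp mI.
      by apply: measurable_funM; [exact: mgdens2|exact: measurable_fst_comp mK].
    - move=> x y /=; rewrite normrM (ger0_norm (I0 y)) normrM (ger0_norm (gdens_ge0 _ s0)) mulrC.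
      by rewrite ler_wpM2r// ler_wpM2r// gdens_le.
    - by apply: rintegrableZ; exact: rintegrable_norm.
  rewrite F -cint_real; apply: eq_cint => y; rewrite -smoothE// cint_real -rmorphM; congr (_ %:C).
  rewrite -RintegZ//.
  apply: (rintegrable_le _ _ (rintegrableZ (s * gmass)^-1 (rintegrable_norm iK))).
    by apply: measurable_funM => //; exact: (measurable_fun_pair1 y (mgdens2 s)).
  by move=> x; rewrite normrM ger0_norm ?gdens_ge0// ler_wpM2r// gdens_le.
apply: near_ccvg; first by apply: nearW => n; exact: E.
apply: (proj2 (@cint_dct R _ _ leb
  (fun n y => (I y)%:C * (((pi *+ 2)^-1)%:C * KG (harmonic n) y)) _
  (fun y => `|(pi *+ 2)^-1| * NF * I y) _ _ (rintegrableZ _ iI) _)) => //.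
- move=> n; apply: cmeasurableM; first exact: cmeasurable_real.
  apply: cmeasurableM; first exact: cmeasurable_cst.
  apply: (@cmeasurable_cint_param _ _ _ _ _ leb
    (fun z : R * R => eiu (z.2 * z.1) * (gexp (harmonic n * z.2))%:C * fourier K (- z.2))).
  apply: cmeasurableM; last first.
    by apply: (cmeasurable_snd (f := fun u : R => fourier K (- u))); exact: cintegrable_meas iFKN.
  apply: cmeasurableM; last first.
    apply: (cmeasurable_snd (f := fun u : R => (gexp (harmonic n * u))%:C)); apply: cmeasurable_real.
    exact: measurable_gexp_scale.
  by apply: cmeasurable_eiu; apply: measurable_funM; [exact: measurable_snd|exact: measurable_fst].
- move=> n y; rewrite cabsM cabsC ger0_norm// mulrC ler_wpM2r// cabsM cabsC ler_wpM2l//.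
  by apply: cabs_cint_bound; [exact: cKG|exact: bKG|exact: cintegrable_cabs iFKN].
- by move=> y; apply: ccvgM; [exact: ccvg_cst|apply: ccvgM; [exact: ccvg_cst|exact: KG_cvg]].
Qed.
End Smoothing.

(** Every primitive of [f] is constant, and by Lebesgue differentiation its derivative is [f] almost
    everywhere. *)
Lemma ae_eq0_of_intervals (f : R -> R) : measurable_fun setT f ->
  (forall a b, leb.-integrable setT (EFin \o (fun x => \1_`[a, b] x * f x))) ->
  (forall a b, Rinteg leb (fun x => \1_`[a, b] x * f x) = 0) ->
  {ae leb, forall x, f x = 0}.
Proof.
move=> mf if_ f0.
have restrE a b : (f \_ `[a, b]) = (fun x => \1_`[a, b] x * f x).
  by apply/funext => x; rewrite patchE indicE; case: ifP; rewrite ?mul1r ?mul0r.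
have ifab a b : leb.-integrable `[a, b] (EFin \o f).
  apply/(integrable_mkcond _ _).2 => //.
  by have := if_ a b; rewrite -restrE; apply: eq_integrable => // x _; rewrite /= restrict_EFin.
have lf : locally_integrable setT f.
  split=> //; first exact: openT.
  move=> A _ cA; have [M [_ HM]] := compact_bounded cA.
  have AM : A `<=` `[- (M + 1), M + 1]%classic.
    move=> x Ax /=; rewrite in_itv/= -ler_norml; apply: (HM (M + 1)) => //; lra.
  have /integrableP[_] := ifab (- (M + 1)) (M + 1).
  apply: le_lt_trans; apply: ge0_subset_integral => //.
  - exact: compact_measurable.
  - by apply/measurable_EFinP; apply: measurableT_comp => //; exact: measurable_funTS.
have FF : Filter (almost_everywhere leb) := ae_filter_ringOfSetsType _.
(* Primitives have a base point and give information only to its right; the countably many base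
   points [- n] cover the line up to a null set. *)
have H n : {ae leb, forall x, - n%:R < x -> f x = 0}.
  have := @FTC1 R f (BLeft (- n%:R)) _ lf.
  move=> /(_ (fun y => ifab _ y)); apply: filterS => x fx nx.
  have [|_ <-] := fx; first by rewrite lte_fin.
  have -> : (fun y => (\int[lebesgue_measure]_(t in [set` Interval (BLeft (- n%:R)) (BRight y)]) (f t))%R) = cst 0.
    apply/funext => y; rewrite -[RHS](f0 (- n%:R) y) -restrE.
    by rewrite Rintegral_mkcond.
  by rewrite derive1_cst.
have := ae_foralln H; apply: filterS => x Hx.
apply: (Hx (Num.truncn `|x|).+1).
have := truncnS_gt `|x|; have := ler_norm (- x); rewrite normrN; lra.
Qed.

(** [K] may be discontinuous, so equality is claimed almost everywhere only; this suffices because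
    the formula is used under a Lebesgue integral. *)
Lemma fourier_inversion_ae (K : R -> R) : leb.-integrable setT (EFin \o K) ->
  cintegrable leb (fourier K) ->
  {ae leb, forall x, (K x)%:C = ifourier (fourier K) x}.
Proof.
move=> iK iFK; have mK := rintegrable_meas iK; have mFK := cintegrable_meas iFK.
pose q x := (K x)%:C - ((pi *+ 2)^-1)%:C * ift (fourier K) x.
have mi : cmeasurable (fun x => ((pi *+ 2)^-1)%:C * ift (fourier K) x).
  by apply: cmeasurableM; [exact: cmeasurable_cst|exact: cmeasurable_ift].
have mq : cmeasurable q by apply: cmeasurableB; [exact: cmeasurable_real|exact: mi].
have iI a b : leb.-integrable setT (EFin \o (\1_`[a, b] : R -> R)) by exact: integrable_indic_itv.
have i1 a b : cintegrable leb (fun x => (\1_`[a, b] x * K x)%:C).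
  apply: cintegrable_real; apply: (rintegrable_le _ _ (rintegrable_norm iK)).
    by apply: measurable_funM; [exact: measurable_indic|exact: mK].
  by move=> x; rewrite normrM ler_piMl// indicE; case: (_ \in _); rewrite ?normr1 ?normr0.
have i2 a b : cintegrable leb (fun x => (\1_`[a, b] x)%:C * (((pi *+ 2)^-1)%:C * ift (fourier K) x)).
  apply: (cintegrable_le _ _ (rintegrableZ (`|(pi *+ 2)^-1| * Rinteg leb (fun u => cabs (fourier K u))) (iI a b))).
    by apply: cmeasurableM; [apply: cmeasurable_real; exact: measurable_indic|exact: mi].
  move=> x; rewrite cabsM cabsC ger0_norm ?indicE// mulrC ler_wpM2r// cabsM cabsC ler_wpM2l//.
  exact: cabs_ift.
have iq a b : cintegrable leb (fun x => (\1_`[a, b] x)%:C * q x).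
  have := cintegrableB (i1 a b) (i2 a b).
  by under eq_fun do rewrite rmorphM -mulrBr.
have q0 a b : cint leb (fun x => (\1_`[a, b] x)%:C * q x) = 0.
  under eq_cint do rewrite mulrBr -realcM.
  by rewrite cintB// (interval_inversion a b iK iFK) subrr.
have R0 : {ae leb, forall x, cre (q x) = 0}.
  apply: (ae_eq0_of_intervals mq.1) => a b.
    by have := (iq a b).1; under eq_fun do rewrite creZ.
  rewrite -[RHS]/(cre (0 : R[i])) -(q0 a b).
  rewrite -[RHS]/(Rinteg leb (fun x => cre ((\1_`[a, b] x)%:C * q x))).
  by congr Rinteg; apply/funext => x; rewrite creZ.
have I0 : {ae leb, forall x, cim (q x) = 0}.
  apply: (ae_eq0_of_intervals mq.2) => a b.
    by have := (iq a b).2; under eq_fun do rewrite cimZ.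
  rewrite -[RHS]/(cim (0 : R[i])) -(q0 a b).
  rewrite -[RHS]/(Rinteg leb (fun x => cim ((\1_`[a, b] x)%:C * q x))).
  by congr Rinteg; apply/funext => x; rewrite cimZ.
have FF : Filter (almost_everywhere leb) := ae_filter_ringOfSetsType _.
apply: filterS2 R0 I0 => x r0 i0.
by apply/eqP; rewrite -subr_eq0; apply/eqP; apply: complex_eqP.
Qed.
End FourierInversion.

(** * Complex derivatives along a real parameter and the exponential series *)

Section ComplexDerivative.
Context {R : realType}.
Implicit Types (f g : R -> R[i]) (t : R) (z w : R[i]).

Definition is_cderive t f w := is_derive t (1 : R) (fun s => cre (f s)) (cre w) /\
  is_derive t (1 : R) (fun s => cim (f s)) (cim w).

Lemma is_cderive_eq t f w z : is_cderive t f w -> w = z -> is_cderive t f z.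
Proof. by move=> ? <-. Qed.
Lemma is_cderive_cst t z : is_cderive t (fun=> z) 0.
Proof. by split; exact: is_derive_cst. Qed.
Lemma is_cderiveD t f g w z : is_cderive t f w -> is_cderive t g z ->
  is_cderive t (fun s => f s + g s) (w + z).
Proof.
move=> [f1 f2] [g1 g2]; split; rewrite !cparts.
  by under eq_fun do rewrite creD; exact: is_deriveD.
by under eq_fun do rewrite cimD; exact: is_deriveD.
Qed.
Lemma is_cderiveM t f g w z : is_cderive t f w -> is_cderive t g z ->
  is_cderive t (fun s => f s * g s) (w * g t + f t * z).
Proof.
move=> [f1 f2] [g1 g2]; split; rewrite !cparts.
  under eq_fun do rewrite creM.
  apply: (is_derive_eq (is_deriveB (is_deriveM f1 g1) (is_deriveM f2 g2))).
  by rewrite /GRing.scale/=; ring.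
under eq_fun do rewrite cimM.
apply: (is_derive_eq (is_deriveD (is_deriveM f1 g2) (is_deriveM f2 g1))).
by rewrite /GRing.scale/=; ring.
Qed.
Lemma is_cderive_lin t z : is_cderive t (fun s => s%:C * z) z.
Proof.
split.
  under eq_fun do rewrite creZ.
  by apply: is_derive_eq; rewrite /GRing.scale/=; ring.
under eq_fun do rewrite cimZ.
by apply: is_derive_eq; rewrite /GRing.scale/=; ring.
Qed.
Lemma is_cderive_sum t n (f : 'I_n -> R -> R[i]) (w : 'I_n -> R[i]) :
  (forall i, is_cderive t (f i) (w i)) ->
  is_cderive t (fun s => \sum_(i < n) f i s) (\sum_(i < n) w i).
Proof.
elim: n f w => [|n IH] f w fw.
  by under eq_fun do rewrite big_ord0; rewrite big_ord0; exact: is_cderive_cst.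
under eq_fun do rewrite big_ord_recl; rewrite big_ord_recl.
by apply: is_cderiveD => //; exact: IH.
Qed.
Lemma is_cderive_powlin t z k : is_cderive t (fun s => (s%:C * z) ^+ k)
  (k%:R * z * (t%:C * z) ^+ k.-1).
Proof.
elim: k => [|k IH]; first by rewrite !mul0r; under eq_fun do rewrite expr0; exact: is_cderive_cst.
under eq_fun do rewrite exprS.
apply: is_cderive_eq (is_cderiveM (is_cderive_lin t z) IH) _.
case: k {IH} => [|k]; first by rewrite !mul0r expr0 !mulr0 !mulr1 addr0 mul1r.
by rewrite /= exprS -[k.+2%:R]natr1; ring.
Qed.
Lemma is_cderive_cexplin t z : is_cderive t (fun s => cexp (s%:C * z)) (z * cexp (t%:C * z)).
Proof.
split.
  have -> : (fun s => cre (cexp (s%:C * z))) =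
    (expR \o (fun s => s * cre z)) * (cos \o (fun s => s * cim z)).
    by apply/funext => s; rewrite /cexp creZ cimZ.
  by apply: is_derive_eq; rewrite creM /cexp creZ cimZ /= /GRing.scale/=; ring.
have -> : (fun s => cim (cexp (s%:C * z))) =
  (expR \o (fun s => s * cre z)) * (sin \o (fun s => s * cim z)).
  by apply/funext => s; rewrite /cexp creZ cimZ.
by apply: is_derive_eq; rewrite cimM /cexp creZ cimZ /= /GRing.scale/=; ring.
Qed.

Lemma MVT_bound (f df : R -> R) (C : R) : (forall t, is_derive t (1 : R) f (df t)) ->
  (forall t, 0 <= t <= 1 -> `|df t| <= C) -> `|f 1 - f 0| <= C.
Proof.
move=> fd dfC.
have cf : {within `[0, 1], continuous f}.
  by apply: derivable_within_continuous => t _; case: (fd t).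
have [c c01 ->] := MVT ltr01 (fun t _ => fd t) cf.
rewrite subr0 mulr1; apply: dfC.
by move: c01; rewrite in_itv/= => /andP[c0 c1]; rewrite !ltW.
Qed.

Definition cexp_sum z n : R[i] := \sum_(k < n) (k`!%:R^-1)%:C * z ^+ k.

(** A bound independent of [n], so that the partial sums can be dominated when the series is summed
    under an integral. *)
Lemma cabs_cexp_sum z n : cabs (cexp_sum z n) <= expR (cabs z).
Proof.
apply: (le_trans (cabs_sum _ _ _)).
apply: (@le_trans _ _ (series (sequences.exp_coeff (cabs z)) n)).
  rewrite /series/= big_mkord; apply: ler_sum => k _.
  rewrite cabsM cabsC cabsX ger0_norm ?invr_ge0// /sequences.exp_coeff mulrC//.
rewrite /expR; apply: nondecreasing_cvgn_le; last exact: is_cvg_series_exp_coeff.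
by apply: nondecreasing_series => k _ _; rewrite /sequences.exp_coeff divr_ge0// exprn_ge0// cabs_ge0.
Qed.

(* The derivative of [t |-> cexp (- t z) * cexp_sum (t z) n] telescopes to a single term. *)
Lemma cexp_sum_error z n : cabs (cexp_sum z n.+1 - cexp z) <=
  expR (cabs z) * (2 * (cabs z * (expR (cabs z) * sequences.exp_coeff (cabs z) n))).
Proof.
pose f (t : R) := cexp (t%:C * - z) * cexp_sum (t%:C * z) n.+1.
pose df (t : R) := - (z * (cexp (t%:C * - z) * ((n`!%:R^-1)%:C * (t%:C * z) ^+ n))).
have dS (t : R) m : is_cderive t (fun s => cexp_sum (s%:C * z) m.+1) (z * cexp_sum (t%:C * z) m).
  rewrite /cexp_sum; apply: is_cderive_eq.
    apply: (is_cderive_sum (w := fun k : 'I_m.+1 => (k`!%:R^-1)%:C * (k%:R * z * (t%:C * z) ^+ k.-1))).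
    move=> i; apply: is_cderive_eq.
      by apply: is_cderiveM; [exact: is_cderive_cst|exact: is_cderive_powlin].
    by rewrite mul0r add0r.
  rewrite big_ord_recl /= !mul0r mulr0 add0r mulr_sumr; apply: eq_bigr => i _.
  rewrite /bump /= add1n.
  have <- : (i.+1`!%:R^-1)%:C * i.+1%:R = (i`!%:R^-1)%:C :> R[i].
    rewrite -(rmorph_nat (real_complex R)) -realcM factS natrM invfM mulrAC mulVf ?mul1r//.
  by rewrite add0n; ring.
have fdf t : is_cderive t f (df t).
  apply: is_cderive_eq (is_cderiveM (is_cderive_cexplin t (- z)) (dS t n)) _.
  by rewrite /df /cexp_sum big_ord_recr /=; ring.
have bdf t : 0 <= t <= 1 -> cabs (df t) <= cabs z * (expR (cabs z) * sequences.exp_coeff (cabs z) n).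
  move=> /andP[t0 t1]; rewrite cabsN !cabsM ler_wpM2l ?cabs_ge0//.
  have tz : cabs (t%:C * z) <= cabs z.
    by rewrite cabsM cabsC ger0_norm// ler_piMl ?cabs_ge0.
  apply: ler_pM => //; rewrite ?cabs_ge0 ?mulr_ge0 ?cabs_ge0//.
    rewrite cabs_cexp ler_expR; apply: (le_trans (ler_norm _)).
    by apply: (le_trans (cre_le_cabs _)); rewrite mulrN cabsN.
  rewrite /sequences.exp_coeff cabsC ger0_norm ?invr_ge0// mulrC ler_wpM2r ?invr_ge0//.
  by rewrite cabsX; apply: lerXn2r; rewrite ?nnegrE ?cabs_ge0.
set B := cabs z * _ in bdf *.
have f1 : f 1 = cexp (- z) * cexp_sum z n.+1 by rewrite /f !mul1r.
have f0 : f 0 = 1.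
  rewrite /f !mul0r cexp0 mul1r /cexp_sum big_ord_recl expr0 big1 ?addr0 ?mulr1 ?fact0 ?invr1//.
  by move=> i _; rewrite expr0n mulr0.
(* The factor 2 comes from applying the real mean value theorem to the real and the imaginary part
   separately. *)
have b1 : cabs (f 1 - f 0) <= 2 * B.
  apply: (le_trans (cabs_le_parts _)); rewrite creB cimB mulr_natl mulr2n; apply: lerD.
    apply: (@MVT_bound (fun t => cre (f t)) (fun t => cre (df t))) => t; first exact: (fdf t).1.
    by move=> /bdf; apply: le_trans; exact: cre_le_cabs.
  apply: (@MVT_bound (fun t => cim (f t)) (fun t => cim (df t))) => t; first exact: (fdf t).2.
  by move=> /bdf; apply: le_trans; exact: cim_le_cabs.
have -> : cexp_sum z n.+1 - cexp z = cexp z * (f 1 - f 0).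
  by rewrite f1 f0 mulrBr mulr1 mulrA -cexpD subrr cexp0 mul1r.
rewrite cabsM; apply: ler_pM => //; rewrite ?cabs_ge0// cabs_cexp ler_expR.
by apply: (le_trans (ler_norm _)); exact: cre_le_cabs.
Qed.

Lemma cexp_sum_cvg z : ccvg (cexp_sum z) (cexp z).
Proof.
suff : ccvg (fun n => cexp_sum z n.+1) (cexp z).
  move=> [h1 h2]; split.
    by rewrite -(cvg_shiftS (fun n => cre (cexp_sum z n))).
  by rewrite -(cvg_shiftS (fun n => cim (cexp_sum z n))).
have c0 : (fun n => expR (cabs z) * (2 * (cabs z * (expR (cabs z) * sequences.exp_coeff (cabs z) n))))
    @ \oo --> (0 : R).
  rewrite -[X in _ --> X](mulr0 (expR (cabs z))); apply: cvgM; first exact: cvg_cst.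
  rewrite -[X in _ --> X](mulr0 2); apply: cvgM; first exact: cvg_cst.
  rewrite -[X in _ --> X](mulr0 (cabs z)); apply: cvgM; first exact: cvg_cst.
  rewrite -[X in _ --> X](mulr0 (expR (cabs z))); apply: cvgM; first exact: cvg_cst.
  exact: cvg_exp_coeff.
by apply: (ccvg_le _ c0); apply: nearW => n; exact: cexp_sum_error.
Qed.
End ComplexDerivative.

(** * Fourier representations of convolutions with the kernel and with [M] *)

Section Convolutions.
Context {R : realType}.
Local Notation leb := (@leb R).
Local Notation "'pi2V'" := (((pi *+ 2)^-1)%:C : R[i]).

Lemma ae_eq_cint (f g : R -> R[i]) : cmeasurable f -> cmeasurable g ->
  {ae leb, forall x, f x = g x} -> cint leb f = cint leb g.
Proof.
move=> [f1 f2] [g1 g2] fg.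
have FF : Filter (almost_everywhere leb) := ae_filter_ringOfSetsType _.
apply: complex_eqP; congr fine; apply: ae_eq_integral => //; try exact/measurable_EFinP;
  by apply: filterS fg => x /= ->.
Qed.

Section ConvolutionFourier.
Variables (g : R -> R) (G : R -> R[i]) (C A : R) (k : R -> R).
Hypotheses (mg : measurable_fun setT g) (gC : forall x, `|g x| <= C)
  (g2 : (\int[leb]_x (g x ^+ 2)%:E < +oo)%E) (gG : is_L2_fourier g G).
Hypotheses (ik : leb.-integrable setT (EFin \o k)) (ksym : forall x, k (- x) = k x)
  (kA : forall u, A < `|u| -> fourier k u = 0).

Lemma fourier_sym u : fourier k (- u) = fourier k u.
Proof.
rewrite /fourier -[RHS]cint_opp; last first.
  by apply: cintegrable_eiuM; [exact: measurable_funM|exact: cintegrable_real].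
by apply: eq_cint => x; rewrite ksym mulrN mulNr.
Qed.
Lemma cintegrable_compact_fourier : cintegrable leb (fourier k).
Proof.
have iI : leb.-integrable setT (EFin \o (\1_`[- A, A] : R -> R)) by exact: integrable_indic_itv.
apply: (cintegrable_le _ _ (rintegrableZ (Rinteg leb (fun x => `|k x|)) iI)).
  by apply: cmeasurable_fourier; exact: rintegrable_meas ik.
move=> u; have [uA|uA] := leP `|u| A.
  rewrite indicE mem_set ?mulr1; first exact: cabs_fourier.
  by rewrite /= in_itv/= -ler_norml.
by rewrite kA// cabs0 mulr_ge0// ?indicE//; exact: Rinteg_ge0.
Qed.
Let iF := cintegrable_compact_fourier.

(** Since [k] is symmetric, this plays the role of the transform of [g * k] at [- u]; hence the
    phases [eiu (u * x)], without a minus sign, in the inversion formulas. *)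
Definition spectral (u : R) := G (- u) * fourier k u.

Lemma cintegrable_spectral : cintegrable leb spectral.
Proof.
apply: (cintegrable_GH mg gC gG iF (M := Rinteg leb (fun x => `|k x|))).
by move=> u; exact: cabs_fourier.
Qed.

(** Parseval is applied to [H u = eiu (u * x) * F k u], whose inverse transform is a translate of
    that of [k]. The inversion of [k] changes the integrand on a null set only, so the formula holds
    at every [x]. *)
Lemma fconv_fourier x : (fconv g k x)%:C = pi2V * cint leb (fun u => eiu (u * x) * spectral u).
Proof.
pose H u := eiu (u * x) * fourier k u.
have iH : cintegrable leb H by apply: cintegrable_eiuM => //; exact: measurable_funM.
have HM u : cabs (H u) <= Rinteg leb (fun x => `|k x|).
  by rewrite cabsM cabs_eiu mul1r; exact: cabs_fourier.
have := parseval mg gC g2 gG iH HM.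
have -> : cint leb (fun u => G (- u) * H u) = cint leb (fun u => eiu (u * x) * spectral u).
  by apply: eq_cint => u; rewrite /H /spectral mulrCA.
move=> <-; have iP := cintegrable_g_ift mg g2 iH HM.
have N1 : (-1 : R) != 0 by rewrite oppr_eq0 oner_eq0.
rewrite (cint_affine x N1 iP) normrN normr1 mul1r.
have iN y : ift (fourier k) (- y) = ift (fourier k) y.
  rewrite /ift -[RHS]cint_opp; last first.
    by apply: cintegrable_eiuM => //; apply: measurable_funN; exact: measurable_funM.
  by apply: eq_cint => u; rewrite fourier_sym mulrN mulNr.
have E y : (g (-1 * y + x))%:C * ift H (-1 * y + x) = (g (x - y))%:C * ift (fourier k) y.
  rewrite mulN1r addrC -[in RHS]iN; congr (_ * _); apply: eq_cint => u.
  by rewrite /H mulrA -eiuD; congr (eiu _ * _); ring.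
under eq_cint do rewrite E.
have i1 : cintegrable leb (fun y => (g (x - y))%:C * ift (fourier k) y).
  by have := cintegrable_affine x N1 iP; under eq_fun do rewrite E.
have mgx : measurable_fun setT (fun y : R => g (x - y)).
  by apply: (measurableT_comp mg); exact: measurable_funB.
rewrite -cintZ// -cint_real; apply: ae_eq_cint.
- apply: cmeasurable_real; apply: measurable_funM => //; exact: rintegrable_meas ik.
- exact: cintegrable_meas (cintegrableZ _ i1).
- have FF : Filter (almost_everywhere leb) := ae_filter_ringOfSetsType _.
  apply: filterS (fourier_inversion_ae ik iF) => y ky.
  by rewrite realcM ky mulrCA.
Qed.
End ConvolutionFourier.

Lemma rintegrable_Kh h (K : R -> R) : 0 < h -> leb.-integrable setT (EFin \o K) ->
  leb.-integrable setT (EFin \o Kh h K).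
Proof.
move=> h0 iK; have hn0 : h^-1 != 0 by rewrite invr_eq0 gt_eqF.
have -> : Kh h K = (fun x => h^-1 * K (h^-1 * x + 0)).
  by apply/funext => x; rewrite addr0 /Kh [h^-1 * x]mulrC.
exact: rintegrableZ (rintegrable_affine 0 hn0 iK).
Qed.
Lemma fourier_Kh h (K : R -> R) u : 0 < h -> leb.-integrable setT (EFin \o K) ->
  fourier (Kh h K) u = fourier K (h * u).
Proof.
move=> h0 iK; have hn0 : h^-1 != 0 by rewrite invr_eq0 gt_eqF.
have iE : cintegrable leb (fun x => eiu (h * u * x) * (K x)%:C).
  by apply: cintegrable_eiuM; [exact: measurable_funM|exact: cintegrable_real].
rewrite [RHS](cint_affine 0 hn0 iE) gtr0_norm ?invr_gt0// -cintZ; last exact: (cintegrable_affine 0 hn0 iE).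
apply: eq_cint => x; rewrite addr0 /Kh realcM mulrCA [h^-1 * x]mulrC.
by congr (_ * (eiu _ * _)); field; rewrite gt_eqF.
Qed.
Lemma fourier_Kh_eq0 h (K : R -> R) u : 0 < h -> leb.-integrable setT (EFin \o K) ->
  (forall u, 1 < `|u| -> fourier K u = 0) -> h^-1 < `|u| -> fourier (Kh h K) u = 0.
Proof.
move=> h0 iK K0 hu; rewrite fourier_Kh//; apply: K0.
by rewrite normrM gtr0_norm// -ltr_pdivrMl// mulr1.
Qed.
Lemma Rinteg_norm_Kh h (K : R -> R) : 0 < h -> leb.-integrable setT (EFin \o K) ->
  Rinteg leb (fun x => `|Kh h K x|) = Rinteg leb (fun x => `|K x|).
Proof.
move=> h0 iK; have hn0 : h^-1 != 0 by rewrite invr_eq0 gt_eqF.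
rewrite [RHS](Rinteg_affine 0 hn0 (rintegrable_norm iK)) -RintegZ; last first.
  exact: (rintegrable_affine 0 hn0 (rintegrable_norm iK)).
congr Rinteg; apply/funext => x.
by rewrite /Kh normrM addr0 mulrC [h^-1 * x]mulrC mulrC.
Qed.

Section ConvM.
Variables (nu : {finite_measure set (measurableTypeR R) -> \bar R}) (lam gam Del : R).
Hypotheses (nulam : nu setT = lam%:E) (Del0 : 0 < Del).

Lemma rintegrable_cst_fin (c : R) : nu.-integrable setT (EFin \o (fun=> c)).
Proof. exact: finite_measure_integrable_cst. Qed.
Lemma Rinteg_cst_nu (c : R) : Rinteg nu (fun=> c) = c * lam.
Proof.
transitivity (fine (c%:E * nu setT)%E); last by rewrite nulam.
by rewrite /Rinteg integral_cst.
Qed.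
Lemma lam_ge0 : 0 <= lam. Proof. by rewrite -lee_fin -nulam. Qed.

Lemma cabs_mfourier u : cabs (mfourier nu u) <= lam.
Proof.
rewrite -[lam]mul1r -Rinteg_cst_nu; apply: cabs_cint_bound; last exact: rintegrable_cst_fin.
  by apply: cmeasurable_eiu; exact: measurable_funM.
by move=> x; rewrite cabs_eiu.
Qed.
Lemma cmeasurable_mfourier : cmeasurable (fun u : R => mfourier nu u).
Proof.
apply: (@cmeasurable_cint_param _ _ _ _ _ nu (fun z : R * (measurableTypeR R) => eiu (z.1 * z.2))).
by apply: cmeasurable_eiu; apply: measurable_funM; [exact: measurable_fst|exact: measurable_snd].
Qed.

Lemma measurable_shift2 (f : R -> R) : measurable_fun setT f ->
  measurable_fun setT (fun z : R * (measurableTypeR R) => f (z.1 + z.2)).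
Proof.
move=> mf; apply: (measurableT_comp mf); apply: measurable_funD.
  exact: measurable_fst.
exact: measurable_snd.
Qed.

Lemma conv_nubar_pow_bounded (f : R -> R) C k : measurable_fun setT f ->
  (forall x, `|f x| <= C) -> measurable_fun setT (conv_nubar_pow nu f k) /\
  forall x, `|conv_nubar_pow nu f k x| <= C * lam ^+ k.
Proof.
move=> mf fC; elim: k => [|k [mk kC]]; first by split => // x; rewrite expr0 mulr1.
have m2 := measurable_shift2 mk; split.
  exact: (@measurable_Rinteg_param _ _ _ _ _ nu (fun z : R * measurableTypeR R => conv_nubar_pow nu f k (z.1 + z.2))).
move=> x; rewrite exprSr mulrA -Rinteg_cst_nu.
have im : nu.-integrable setT (EFin \o (fun y => conv_nubar_pow nu f k (x + y))).
  apply: (rintegrable_le _ _ (rintegrable_cst_fin (C * lam ^+ k))) => //.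
  exact: (measurable_fun_pair2 x m2).
apply: (le_trans (normr_Rinteg im)); apply: le_Rinteg => //.
  exact: rintegrable_norm.
exact: rintegrable_cst_fin.
Qed.

(** Since [nu] may have atoms, it is convergence at every point that survives an integration against
    [nu]; dominated convergence then carries the induction. *)
Lemma conv_nubar_pow_cvg (fn : nat -> R -> R) (f : R -> R) C k x :
  (forall n, measurable_fun setT (fn n)) -> (forall n x, `|fn n x| <= C) ->
  (forall x, (fun n => fn n x) @ \oo --> f x) ->
  (fun n => conv_nubar_pow nu (fn n) k x) @ \oo --> conv_nubar_pow nu f k x.
Proof.
move=> mfn fnC fnf; elim: k x => [|k IH] x; first exact: fnf.
have bk n := conv_nubar_pow_bounded k (mfn n) (fnC n).
apply: (proj2 (@Rinteg_dct R _ _ nu (fun n y => conv_nubar_pow nu (fn n) k (x + y)) _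
  (fun=> C * lam ^+ k) _ _ _ _)).
- move=> n; exact: (measurable_fun_pair2 x (measurable_shift2 (bk n).1)).
- by move=> n y; exact: (bk n).2.
- exact: rintegrable_cst_fin.
- by move=> y; exact: IH.
Qed.

Section Spectral.
Variables (f : R -> R) (psi : R -> R[i]).
Hypotheses (ipsi : cintegrable leb psi)
  (fpsi : forall x, (f x)%:C = pi2V * cint leb (fun u => eiu (u * x) * psi u)).

Let cintegrable_eiux (x : R) (h : R -> R[i]) : cintegrable leb h ->
  cintegrable leb (fun u => eiu (u * x) * h u).
Proof. by move=> ih; apply: cintegrable_eiuM => //; exact: measurable_funM. Qed.

Let cintegrable_bounded (m h : R -> R[i]) (B : R) : cintegrable leb h -> cmeasurable m ->
  (forall u, cabs (m u) <= B) -> cintegrable leb (fun u => m u * h u).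
Proof.
move=> ih mm mB; apply: (cintegrable_le _ _ (rintegrableZ B (cintegrable_cabs ih))).
  by apply: cmeasurableM => //; exact: cintegrable_meas ih.
by move=> u; rewrite cabsM ler_wpM2r ?cabs_ge0.
Qed.

(** Convolution with the reflected measure acts in frequency as multiplication by [F nu u]:
    integrating the phase [eiu (u * y)] over [y] produces this factor. *)
Let cint_nu_shift (h : R -> R[i]) x : cintegrable leb h ->
  cint nu (fun y => cint leb (fun u => eiu (u * (x + y)) * h u)) =
  cint leb (fun u => eiu (u * x) * (mfourier nu u * h u)).
Proof.
move=> ih.
rewrite (@cint_fubini _ _ _ _ _ nu leb (fun z : (measurableTypeR R) * R => eiu (z.2 * (x + z.1)) * h z.2)
  (fun=> 1) (fun u => cabs (h u))) //.
- apply: eq_cint => u; rewrite /mfourier /charfun mulrA -cintZ; last first.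
    apply: (cintegrable_le _ _ (rintegrable_cst_fin 1)) => [|y]; last by rewrite cabs_eiu.
    by apply: cmeasurable_eiu; exact: measurable_funM.
  rewrite -cintZr; last first.
    apply: cintegrableZ; apply: (cintegrable_le _ _ (rintegrable_cst_fin 1)) => [|y]; last by rewrite cabs_eiu.
    by apply: cmeasurable_eiu; exact: measurable_funM.
  by apply: eq_cint => y /=; rewrite -eiuD mulrDr.
- apply: cmeasurableM; last by apply: cmeasurable_snd; exact: cintegrable_meas ih.
  apply: cmeasurable_eiu; apply: measurable_funM; first exact: measurable_snd.
  by apply: measurable_funD => //; exact: measurable_fst.
- by move=> y u; rewrite cabsM cabs_eiu mul1r.
- exact: rintegrable_cst_fin.
- exact: cintegrable_cabs.
Qed.

Let mpow k : cmeasurable (fun u => mfourier nu u ^+ k).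
Proof. by apply: cmeasurableX; exact: cmeasurable_mfourier. Qed.
Let bpow k u : cabs (mfourier nu u ^+ k) <= lam ^+ k.
Proof. by rewrite cabsX; apply: lerXn2r; rewrite ?nnegrE ?cabs_ge0 ?lam_ge0 ?cabs_mfourier. Qed.

Lemma conv_nubar_pow_fourier k x : (conv_nubar_pow nu f k x)%:C =
  pi2V * cint leb (fun u => eiu (u * x) * (mfourier nu u ^+ k * psi u)).
Proof.
elim: k x => [|k IH] x.
  by rewrite fpsi; congr (_ * _); apply: eq_cint => u; rewrite expr0 mul1r.
have ik := cintegrable_bounded ipsi (mpow k) (bpow k).
rewrite -[LHS]/((Rinteg nu (fun y => conv_nubar_pow nu f k (x + y)))%:C) -cint_real.
under eq_cint do rewrite IH.
rewrite cintZ; last first.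
  apply: (@cintegrable_inner _ _ _ _ _ nu leb
    (fun z : (measurableTypeR R) * R => eiu (z.2 * (x + z.1)) * (mfourier nu z.2 ^+ k * psi z.2))
    (fun=> 1) (fun u => cabs (mfourier nu u ^+ k * psi u))) => //.
  - apply: cmeasurableM; last first.
      apply: (cmeasurable_snd (f := fun u : R => mfourier nu u ^+ k * psi u)).
      exact: cintegrable_meas ik.
    apply: cmeasurable_eiu; apply: measurable_funM; first exact: measurable_snd.
    by apply: measurable_funD => //; exact: measurable_fst.
  - by move=> y u; rewrite cabsM cabs_eiu mul1r.
  - exact: rintegrable_cst_fin.
  - exact: cintegrable_cabs.
rewrite cint_nu_shift//; congr (_ * _); apply: eq_cint => u.
by rewrite exprS !mulrA.
Qed.

(** The three factors mirror the definition of [M]: the constant [exp (lam Del)], the shift by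
    [gam * Del], and the exponential whose power series gives the iterated convolutions. *)
Lemma cpp_phi_inv u : (cpp_phi gam lam Del nu u)^-1 =
  (expR (lam * Del))%:C * (eiu (- (u * (gam * Del))) * cexp (- Del%:C * mfourier nu u)).
Proof.
rewrite /cpp_phi -cexpN.
have -> : - (Del%:C * (0 +i* (gam * u) + mfourier nu u - lam%:C)) =
   (lam * Del)%:C + (0 +i* (- (u * (gam * Del))) + - Del%:C * mfourier nu u).
  by apply: complex_eqP; rewrite !cparts /=; ring.
rewrite !cexpD; congr (_ * (_ * _)).
  by rewrite cexpE /= eiu0 mulr1.
by rewrite cexpE /= expR0 mul1r.
Qed.
Lemma cmeasurable_phi_inv : cmeasurable (fun u : R => (cpp_phi gam lam Del nu u)^-1).
Proof.
under eq_fun do rewrite cpp_phi_inv.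
apply: cmeasurableM; first exact: cmeasurable_cst.
apply: cmeasurableM; first by apply: cmeasurable_eiu; apply: measurable_funN; exact: measurable_funM.
apply: cmeasurable_cexp; apply: cmeasurableM; [exact: cmeasurable_cst|exact: cmeasurable_mfourier].
Qed.
(** The constant factor and the exponential of [- Del F nu] contribute at most [exp (lam Del)] each,
    the latter because [|F nu| <= lam]. *)
Lemma cabs_phi_inv u : cabs (cpp_phi gam lam Del nu u)^-1 <= expR (2 * (lam * Del)).
Proof.
rewrite cpp_phi_inv !cabsM cabs_eiu mul1r cabsC ger0_norm ?expR_ge0// cabs_cexp -expRD ler_expR.
rewrite mulr_natl mulr2n lerD2l; apply: (le_trans (ler_norm _)); apply: (le_trans (cre_le_cabs _)).
rewrite cabsM cabsN cabsC gtr0_norm// [leLHS]mulrC.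
  by apply: ler_wpM2r; [exact: ltW|exact: cabs_mfourier].
Qed.

(** The partial sums of the series of convolutions are the integrals with [cexp_sum] in place of the
    exponential; dominated convergence with bound [exp (lam Del) * |psi|] sums the series. *)
Lemma convM_fourier x : (convM gam lam Del nu f x)%:C =
  pi2V * cint leb (fun u => eiu (u * x) * (psi u / cpp_phi gam lam Del nu u)).
Proof.
pose y := x - gam * Del.
pose z u := - Del%:C * mfourier nu u.
have zB u : cabs (z u) <= lam * Del.
  rewrite cabsM cabsN cabsC gtr0_norm// [leLHS]mulrC.
  by apply: ler_wpM2r; [exact: ltW|exact: cabs_mfourier].
have mz : cmeasurable z.
  by apply: cmeasurableM; [exact: cmeasurable_cst|exact: cmeasurable_mfourier].
pose a k := (- Del) ^+ k / (k`!)%:R * conv_nubar_pow nu f k y.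
have E N : (series a N)%:C = pi2V * cint leb (fun u => eiu (u * y) * (cexp_sum (z u) N * psi u)).
  rewrite /series /= big_mkord rmorph_sum/=.
  transitivity (\sum_(k < N) pi2V * cint leb (fun u => eiu (u * y) * ((k`!%:R^-1)%:C * z u ^+ k * psi u))).
    apply: eq_bigr => k _; rewrite /a realcM conv_nubar_pow_fourier mulrCA; congr (_ * _).
    rewrite -cintZ; last by apply: cintegrable_eiux; exact: cintegrable_bounded ipsi (mpow k) (bpow k).
    apply: eq_cint => u; rewrite /z exprMn realcM rmorphXn rmorphN/=; ring.
  have iz k : cintegrable leb (fun u => (k`!%:R^-1)%:C * z u ^+ k * psi u).
    apply: (cintegrable_bounded (B := k`!%:R^-1 * (lam * Del) ^+ k) ipsi).
      by apply: cmeasurableM; [exact: cmeasurable_cst|exact: cmeasurableX].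
    move=> u; rewrite cabsM cabsC ger0_norm ?invr_ge0// ler_wpM2l ?invr_ge0// cabsX.
    by apply: lerXn2r; rewrite ?nnegrE ?cabs_ge0 ?mulr_ge0 ?lam_ge0 ?(ltW Del0).
  rewrite -mulr_sumr -cint_sum; last by move=> k; apply: cintegrable_eiux; exact: iz.
  congr (_ * _); apply: eq_cint => u; rewrite /cexp_sum mulr_suml mulr_sumr.
  by [].
have mexps N : cmeasurable (fun u => cexp_sum (z u) N).
  by apply: cmeasurable_sum => k; apply: cmeasurableM; [exact: cmeasurable_cst|exact: cmeasurableX].
have [_ L] : cintegrable leb (fun u => eiu (u * y) * (cexp (z u) * psi u)) /\
    ccvg (fun N => cint leb (fun u => eiu (u * y) * (cexp_sum (z u) N * psi u)))
         (cint leb (fun u => eiu (u * y) * (cexp (z u) * psi u))).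
  apply: (cint_dct _ _ (rintegrableZ (expR (lam * Del)) (cintegrable_cabs ipsi))).
  - move=> N; apply: cmeasurableM; first by apply: cmeasurable_eiu; exact: measurable_funM.
    by apply: cmeasurableM; [exact: mexps|exact: cintegrable_meas ipsi].
  - move=> N u; rewrite !cabsM cabs_eiu mul1r ler_wpM2r ?cabs_ge0//.
    by apply: (le_trans (cabs_cexp_sum _ _)); rewrite ler_expR.
  - move=> u; apply: ccvgM; first exact: ccvg_cst.
    by apply: ccvgM; [exact: cexp_sum_cvg|exact: ccvg_cst].
have [L1 L2] : ccvg (fun N => (series a N)%:C) (pi2V * cint leb (fun u => eiu (u * y) * (cexp (z u) * psi u))).
  by under eq_fun do rewrite E; apply: ccvgM => //; exact: ccvg_cst.
set S := pi2V * cint leb _ in L1 L2 *.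
(* The partial sums are real, hence so is the limit [S]; this allows its identification with the
   real [limn] in [convM]. *)
have im0 : cim S = 0.
  apply: (@cvg_unique _ _ ((fun N => cim ((series a N)%:C)) @ \oo)) => //; exact: cvg_cst.
have SE : S = (cre S)%:C by apply: complex_eqP.
have limS : limn (series a) = cre S by apply/cvg_lim.
rewrite /convM -/a limS realcM -SE mulrCA; congr (_ * _).
rewrite -cintZ; last first.
  apply: cintegrable_eiux; apply: (cintegrable_bounded (B := expR (lam * Del)) ipsi).
    exact: cmeasurable_cexp.
  move=> u; rewrite cabs_cexp ler_expR; apply: (le_trans (ler_norm _)).
  by apply: (le_trans (cre_le_cabs _)).
apply: eq_cint => u; rewrite cpp_phi_inv.
have -> : u * y = u * x + - (u * (gam * Del)) by rewrite /y; ring.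
by rewrite eiuD /z; ring.
Qed.
End Spectral.
End ConvM.
End Convolutions.

(** * The continuous logarithm and its quadratic remainder *)

Section ComplexLog.
Context {R : realType}.
Local Notation leb := (@leb R).
Implicit Types (z w : R[i]) (t : R).

Lemma normsq_neq0 z : z != 0 -> cre z ^+ 2 + cim z ^+ 2 != 0.
Proof. by move=> z0; rewrite -cabs_sqr expf_neq0// gt_eqF// cabs_gt0. Qed.

Lemma is_cderiveV t (f : R -> R[i]) w : is_cderive t f w -> f t != 0 ->
  is_cderive t (fun s => (f s)^-1) (- (w * ((f t)^-1 * (f t)^-1))).
Proof.
move=> [f1 f2] ft0.
pose n s := cre (f s) * cre (f s) + cim (f s) * cim (f s).
have n0 : n t != 0 by rewrite /n -!expr2 normsq_neq0.
have dn := is_deriveD (is_deriveM f1 f1) (is_deriveM f2 f2).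
have dV := is_deriveV n0 dn.
have n0' : cre (f t) ^+ 2 + cim (f t) ^+ 2 != 0 by rewrite normsq_neq0.
split.
  have -> : (fun s => cre (f s)^-1) = (fun s => cre (f s) * (n s)^-1).
    by apply/funext => s; rewrite creV /n -!expr2.
  apply: (is_derive_eq (is_deriveM f1 dV)).
  by rewrite /GRing.scale/= !(creV, cimV, creN, cimN, creM, cimM) /n -!expr2; field.
have -> : (fun s => cim (f s)^-1) = (fun s => - (cim (f s) * (n s)^-1)).
  by apply/funext => s; rewrite cimV /n -!expr2.
apply: (is_derive_eq (is_deriveN (is_deriveM f2 dV))).
by rewrite /GRing.scale/= !(creV, cimV, creN, cimN, creM, cimM) /n -!expr2; field.
Qed.

(* The principal logarithm on the half-plane [cre z > 0]. *)
Definition hlog z : R[i] := (2^-1 * ln (cre z ^+ 2 + cim z ^+ 2)) +i* atan (cim z / cre z).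

Lemma is_cderive_hlog t (f : R -> R[i]) w : is_cderive t f w -> 0 < cre (f t) ->
  is_cderive t (fun s => hlog (f s)) (w / f t).
Proof.
move=> [f1 f2] ft0.
pose n s := cre (f s) * cre (f s) + cim (f s) * cim (f s).
have dn := is_deriveD (is_deriveM f1 f1) (is_deriveM f2 f2).
have n0 : 0 < n t by rewrite ltr_pwDl ?mulr_gt0// -expr2 sqr_ge0.
have n0' : cre (f t) ^+ 2 + cim (f t) ^+ 2 != 0 by rewrite !expr2 gt_eqF.
have p0 : cre (f t) != 0 by rewrite gt_eqF.
split.
  have -> : (fun s => cre (hlog (f s))) = (fun s => 2^-1 *: (@ln R \o n) s).
    by apply/funext => s; rewrite /hlog /= /n -!expr2.
  have dl := is_derive1_comp (is_derive1_ln n0) dn.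
  apply: (is_derive_eq (is_deriveZ 2^-1 dl)).
  by rewrite /GRing.scale/= !(creV, cimV, creN, cimN, creM, cimM) /n -!expr2; field.
have dq := is_deriveM f2 (is_deriveV p0 f1).
have -> : (fun s => cim (hlog (f s))) = @atan R \o (fun s => cim (f s) * (cre (f s))^-1) by [].
apply: (is_derive_eq (is_derive1_comp (is_derive1_atan _) dq)).
have n1 : 1 + (cim (f t) * (cre (f t))^-1) ^+ 2 != 0 by rewrite gt_eqF// ltr_pwDl// sqr_ge0.
rewrite /GRing.scale/= !(creV, cimV, creN, cimN, creM, cimM).
have -> : 1 + (cim (f t) * (cre (f t))^-1) ^+ 2 =
  (cre (f t) ^+ 2 + cim (f t) ^+ 2) / cre (f t) ^+ 2 by field.
rewrite invf_div.
by field; rewrite n0' p0.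
Qed.

(** Regularity is required on [[a, b]] alone: the points [1 + t * (z - 1)] are known to lie in the
    right half-plane only for [t] in [[0, 1]]. *)
Lemma Rinteg_itv_FTC_in (F f : R -> R) (a b : R) : a < b ->
  (forall x : R, a <= x <= b -> is_derive x (1 : R) F (f x)) ->
  (forall x, a <= x <= b -> {for x, continuous f}) ->
  Rinteg leb (fun x => \1_`[a, b] x * f x) = F b - F a.
Proof.
move=> ab dF cf.
have cF x : a <= x <= b -> {for x, continuous F}.
  move=> /dF dFx; apply: differentiable_continuous; apply/derivable1_diffP.
  by case: dFx.
have aa : a <= a <= b by rewrite lexx ltW.
have bb : a <= b <= b by rewrite lexx ltW.
have E : (\int[leb]_(x in `[a, b]) (f x)%:E = (F b)%:E - (F a)%:E)%E.
  apply: continuous_FTC2 => //.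
  - by apply: continuous_in_subspaceT => x; rewrite inE/= in_itv/=; exact: cf.
  - split; first by move=> x; rewrite in_itv/= => /andP[/ltW ax /ltW xb]; case: (dF x) => //; rewrite ax.
    + by apply: cvg_at_right_filter; exact: cF.
    + by apply: cvg_at_left_filter; exact: cF.
  - by move=> x; rewrite in_itv/= derive1E => /andP[/ltW ax /ltW xb]; case: (dF x) => //; rewrite ax.
rewrite -[RHS]/(fine (F b - F a)%:E) EFinB -E integral_mkcond.
congr fine; apply: eq_integral => x _; rewrite patchE indicE.
by case: ifP => _; rewrite ?mul1r ?mul0r.
Qed.

Lemma is_derive_continuous (f : R -> R) (t df : R) : is_derive t (1 : R) f df -> {for t, continuous f}.
Proof.
move=> dft; apply: differentiable_continuous; apply/derivable1_diffP.
by case: dft.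
Qed.

Definition Rfun_integrand z t : R[i] :=
  ((1 + t%:C * (z - 1)) - z) / (1 + t%:C * (z - 1)) ^+ 2 * (z - 1).

Lemma near1_re z : cabs (z - 1) <= 1 / 2 -> 1 / 2 <= cre z.
Proof.
move=> h; have := le_trans (cre_le_cabs _) h.
rewrite creB cre1 ler_norml => /andP[]; lra.
Qed.

Lemma segment_re z t : cabs (z - 1) <= 1 / 2 -> 0 <= t <= 1 -> 1 / 2 <= cre (1 + t%:C * (z - 1)).
Proof.
move=> h /andP[t0 t1]; rewrite creD cre1 creZ; have := le_trans (cre_le_cabs _) h.
rewrite ler_norml => /andP[]; set a := cre (z - 1); nra.
Qed.

(** A primitive of [(s - z) / s^2] is [log s + z / s]; between [1] and [z] it grows by
    [log z + 1 - z]. *)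
Lemma RfunE z : cabs (z - 1) <= 1 / 2 -> Rfun z = hlog z - (z - 1).
Proof.
move=> z1; pose s t : R[i] := 1 + t%:C * (z - 1).
have ds t : is_cderive t s (z - 1).
  by apply: is_cderive_eq (is_cderiveD (is_cderive_cst t 1) (is_cderive_lin t (z - 1))) _; rewrite add0r.
have s0 t : 0 <= t <= 1 -> 0 < cre (s t).
  by move=> /(segment_re z1); rewrite -/(s t); lra.
have sn0 t : 0 <= t <= 1 -> s t != 0.
  by move=> /s0; case: (eqVneq (s t) 0) => // ->; rewrite cre0 ltxx.
pose F t := hlog (s t) + z * (s t)^-1.
have dF t : 0 <= t <= 1 -> is_cderive t F (Rfun_integrand z t).
  move=> t01; apply: is_cderive_eq.
    apply: is_cderiveD; first exact: is_cderive_hlog (ds t) (s0 t t01).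
    by apply: is_cderiveM; [exact: is_cderive_cst|exact: is_cderiveV (ds t) (sn0 t t01)].
  by rewrite mul0r add0r /Rfun_integrand -/(s t); field; exact: sn0.
have dI t : 0 <= t <= 1 -> {for t, continuous (fun t => cre (Rfun_integrand z t))} /\
    {for t, continuous (fun t => cim (Rfun_integrand z t))}.
  move=> t01.
  have [d1 d2] : is_cderive t (Rfun_integrand z) 
      (((z - 1) * ((s t)^-1 * (s t)^-1) + (s t - z) *
       (- ((z - 1) * ((s t)^-1 * (s t)^-1)) * (s t)^-1 + (s t)^-1 * - ((z - 1) * ((s t)^-1 * (s t)^-1)))) * (z - 1)
       + (s t - z) * ((s t)^-1 * (s t)^-1) * 0).
    have -> : Rfun_integrand z = (fun t => (s t + - z) * ((s t)^-1 * (s t)^-1) * (z - 1)).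
      by apply/funext => x; rewrite /Rfun_integrand -/(s x) expr2 invfM.
    have dV := is_cderiveV (ds t) (sn0 t t01).
    apply: is_cderiveM; last exact: is_cderive_cst.
    apply: is_cderiveM; last exact: is_cderiveM.
    by apply: is_cderive_eq (is_cderiveD (ds t) (is_cderive_cst t (- z))) _; rewrite addr0.
  by split; [exact: is_derive_continuous d1|exact: is_derive_continuous d2].
have E : F 1 - F 0 = hlog z - (z - 1).
  have z0 : z != 0.
    by have := near1_re z1; case: (eqVneq z 0) => // ->; rewrite cre0; lra.
  have s1 : s 1 = z by rewrite /s mul1r addrC subrK.
  have s00 : s 0 = 1 by rewrite /s mul0r addr0.
  rewrite /F s1 s00 mulfV// invr1 mulr1.
  have -> : hlog 1 = 0 :> R[i].
    by rewrite /hlog /= expr1n expr0n addr0 ln1 mulr0 mul0r atan0.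
  by ring.
rewrite -E; apply: complex_eqP; rewrite ?creB ?cimB.
  transitivity (Rinteg leb (fun t => \1_`[0, 1] t * cre (Rfun_integrand z t))).
    by congr Rinteg; apply/funext => t; rewrite creZ.
  apply: (@Rinteg_itv_FTC_in (fun t => cre (F t)) _ 0 1 ltr01) => t t01.
    exact: (dF t t01).1.
  exact: (dI t t01).1.
transitivity (Rinteg leb (fun t => \1_`[0, 1] t * cim (Rfun_integrand z t))).
  by congr Rinteg; apply/funext => t; rewrite cimZ.
apply: (@Rinteg_itv_FTC_in (fun t => cim (F t)) _ 0 1 ltr01) => t t01.
  exact: (dF t t01).2.
exact: (dI t t01).2.
Qed.

Lemma cmeasurable_Rfun d (T : measurableType d) (f : T -> R[i]) : cmeasurable f ->
  cmeasurable (fun x => Rfun (f x)).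
Proof.
move=> mf.
apply: (@cmeasurable_cint_param _ _ _ _ _ leb
  (fun p : T * R => (\1_`[0, 1] p.2)%:C * Rfun_integrand (f p.1) p.2)).
have mf1 : cmeasurable (fun p : T * R => f p.1) by exact: cmeasurable_fst.
have m1 : cmeasurable (fun p : T * R => f p.1 - 1).
  by apply: cmeasurableB => //; exact: cmeasurable_cst.
have mt : cmeasurable (fun p : T * R => (p.2)%:C : R[i]).
  by apply: cmeasurable_real; exact: measurable_snd.
have ms : cmeasurable (fun p : T * R => 1 + (p.2)%:C * (f p.1 - 1)).
  by apply: cmeasurableD; [exact: cmeasurable_cst|exact: cmeasurableM].
apply: cmeasurableM.
  apply: (cmeasurable_snd (f := fun t : R => (\1_`[0, 1] t)%:C)).
  by apply: cmeasurable_real; exact: measurable_indic.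
apply: cmeasurableM => //; apply: cmeasurableM; first exact: cmeasurableB.
by apply: cmeasurableV; exact: cmeasurableX.
Qed.

(** On the segment [s - z = (t - 1) * (z - 1)] and [|s| >= 1 / 2], so the integrand is at most
    [|z - 1|^2] divided by [1 / 4]. *)
Lemma cabs_Rfun z : cabs (z - 1) <= 1 / 2 -> cabs (Rfun z) <= 4 * cabs (z - 1) ^+ 2.
Proof.
move=> z1.
have iI : leb.-integrable setT (EFin \o (\1_`[0, 1] : R -> R)) by exact: integrable_indic_itv.
have -> : 4 * cabs (z - 1) ^+ 2 = Rinteg leb (fun t => 4 * cabs (z - 1) ^+ 2 * \1_`[0, 1] t).
  rewrite RintegZ// /Rinteg integral_indic// setIT.
  transitivity (4 * cabs (z - 1) ^+ 2 * fine (@lebesgue_measure R `[0%R, 1%R]%classic)) => //.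
  by rewrite lebesgue_measure_itv/= lte_fin ltr01 oppr0 adde0 mulr1.
apply: cabs_cint_bound; last exact: rintegrableZ.
  have mt : cmeasurable (fun t : R => t%:C) by exact: cmeasurable_real.
  have ms : cmeasurable (fun t : R => 1 + t%:C * (z - 1)).
    apply: cmeasurableD; first exact: cmeasurable_cst.
    by apply: cmeasurableM => //; exact: cmeasurable_cst.
  apply: cmeasurableM; first by apply: cmeasurable_real; exact: measurable_indic.
  apply: cmeasurableM; last exact: cmeasurable_cst.
  apply: cmeasurableM; first by apply: cmeasurableB => //; exact: cmeasurable_cst.
  by apply: cmeasurableV; exact: cmeasurableX.
move=> t; rewrite cabsM cabsC mulrC; rewrite indicE.
case: (boolP (t \in _)) => [|_]; last by rewrite normr0 !mulr0.
rewrite inE/= in_itv/= => t01; rewrite normr1 !mulr1.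
have s2 := segment_re z1 t01; set s := 1 + t%:C * (z - 1) in s2 *.
have sa : 1 / 2 <= cabs s by apply: (le_trans s2); apply: (le_trans (ler_norm _)); exact: cre_le_cabs.
rewrite !cabsM cabsV cabsX.
have -> : s - z = (t - 1)%:C * (z - 1) by rewrite /s rmorphB/=; ring.
rewrite cabsM cabsC.
have t1 : `|t - 1| <= 1 by move: t01 => /andP[? ?]; rewrite ler_norml; apply/andP; split; lra.
rewrite [X in _ <= _ * X]expr2 [X in _ <= X]mulrA; apply: ler_wpM2r; first exact: cabs_ge0.
rewrite mulrAC; apply: ler_wpM2r; first exact: cabs_ge0.
apply: (@le_trans _ _ (1 * 4)); last by rewrite mul1r.
apply: ler_pM => //; first by rewrite invr_ge0 exprn_ge0// cabs_ge0.
rewrite -[4]invrK lef_pV2 ?posrE ?exprn_gt0 ?invr_gt0//; last by lra.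
have -> : 4^-1 = (1 / 2) ^+ 2 :> R by field.
by apply: lerXn2r => //; rewrite ?nnegrE; lra.
Qed.

Lemma eiu_atan z : 0 < cre z -> z = (cabs z)%:C * eiu (atan (cim z / cre z)).
Proof.
move=> z0.
have c0 := gt_eqF z0.
have cE : cos (atan (cim z / cre z)) = cre z / cabs z.
  rewrite cos_atan.
  have -> : 1 + (cim z / cre z) ^+ 2 = (cabs z / cre z) ^+ 2.
    by rewrite !expr_div_n cabs_sqr; field; rewrite c0.
  by rewrite sqrtr_sqr ger0_norm ?invf_div// divr_ge0 ?cabs_ge0// ltW.
have a0 : cabs z != 0.
  by rewrite gt_eqF// cabs_gt0//; apply: contraTneq z0 => ->; rewrite cre0 ltxx.
have sE : sin (atan (cim z / cre z)) = cim z / cabs z.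
  have := atanK (cim z / cre z); rewrite /tan cE => /(congr1 (fun x => x * (cre z / cabs z))).
  rewrite divfK; last by rewrite mulf_neq0 ?invr_eq0 ?c0.
  by move=> ->; field; rewrite a0 c0.
apply: complex_eqP; rewrite ?creZ ?cimZ /= ?cE ?sE; by field.
Qed.

Lemma hlogE z : 0 < cre z -> hlog z = ln (cabs z) +i* atan (cim z / cre z).
Proof.
move=> z0; rewrite /hlog; congr (_ +i* _).
have a0 : 0 < cabs z.
  by rewrite cabs_gt0//; apply: contraTneq z0 => ->; rewrite cre0 ltxx.
by rewrite -cabs_sqr lnXn// [X in _ * X]mulr2n; lra.
Qed.

(** Where [cre z > 0] the cosine of the argument is positive. If [|theta|] reached [pi / 2], the
    intermediate value theorem from [theta 0 = 0] would give a point where this cosine vanishes.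
    Confined to the branch where [tan] is inverted by [atan], the argument is unique. *)
Lemma cont_arg_atan (A : R) (z : R -> R[i]) (theta : R -> R) : is_cont_arg A z theta ->
  (forall u, `|u| <= A -> 0 < cre (z u)) ->
  forall u, `|u| <= A -> theta u = atan (cim (z u) / cre (z u)).
Proof.
move=> [ct [t0 zt]] z0.
have cpos u : `|u| <= A -> 0 < cos (theta u).
  move=> uA; have := z0 u uA; rewrite {1}(zt u uA) creZ /=.
  by rewrite pmulr_rgt0// lt_def cabs_ge0 andbT; apply: contraTneq (z0 u uA) => /cabs_eq0 ->; rewrite cre0 ltxx.
have small u : `|u| <= A -> `|theta u| < pi / 2.
  move=> uA; rewrite ltNge; apply/negP => big.
  have pi20 : 0 < pi / 2 :> R by rewrite divr_gt0// pi_gt0.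
  have [v vA cv] : exists2 v, `|v| <= A & `|theta v| = pi / 2.
    pose a := Num.min 0 u; pose b := Num.max 0 u.
    have ab : a <= b by rewrite /a /b; case: (leP 0 u) => [//|/ltW].
    have sub v : v \in `[a, b] -> `|v| <= A.
      rewrite in_itv/= /a /b; case: (leP 0 u) => u0 /andP[? ?]; move: uA; rewrite !ler_norml => /andP[? ?]; apply/andP; split; lra.
    have cn : {within `[a, b], continuous (fun v => `|theta v|)}.
      have cth : {within `[a, b], continuous theta}.
        apply: continuous_subspaceW ct => v /= vab; rewrite in_itv/= -ler_norml; exact: sub.
      by move=> v; apply: continuous_comp; [exact: cth|exact: norm_continuous].
    have [|v vab <-] := @IVT R (fun v => `|theta v|) a b (pi / 2) ab cn.
      rewrite /a /b; case: (leP 0 u) => u0; rewrite t0 normr0.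
        by rewrite ge_min le_max (ltW pi20) big orbT.
      by rewrite ge_min le_max (ltW pi20) big !orbT.
    by exists v => //; exact: sub.
  have := cpos v vA; have : theta v = pi / 2 \/ theta v = - (pi / 2).
    by move: cv; case: (ger0P (theta v)) => _; [left|right; lra].
  by move=> [->|->]; rewrite ?cosN cos_pihalf ltxx.
move=> u uA.
have -> : cim (z u) / cre (z u) = tan (theta u).
  have c0 := cpos u uA.
  rewrite (zt u uA) cimZ creZ /= /tan.
  have a0 : cabs (z u) != 0 by apply: contraTneq (z0 u uA) => /cabs_eq0 ->; rewrite cre0 ltxx.
  by field; rewrite a0 gt_eqF.
by rewrite tanK// in_itv/= -ltr_norml small.
Qed.

(** Through the logarithm this reduces to the oddness of [atan]. It yields the Hermitian symmetry
    that makes the remainder integral real. *)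
Lemma RfunJ z : cabs (z - 1) <= 1 / 2 -> Rfun (conjc z) = conjc (Rfun z).
Proof.
move=> z1.
have zJ : cabs (conjc z - 1) <= 1 / 2.
  have -> : conjc z - 1 = conjc (z - 1) by apply: complex_eqP; rewrite !cparts; ring.
  by rewrite cabsJ.
rewrite !RfunE//; apply: complex_eqP; rewrite !cparts /hlog /= !cparts ?sqrrN//.
by rewrite mulNr atanN; ring.
Qed.
End ComplexLog.

(** * Staircase approximation by superlevel sets *)

Section LayerCake.
Context {R : realType}.

(** For [x >= 0] this is the integer part of [x] capped at [m]. Rescaled, it approximates a function
    with values in [[0, 1]] by indicators, for which independence is stated. *)
Definition layers (m : nat) (x : R) : R := \sum_(j < m) (j.+1%:R <= x)%R%:R.

Lemma layers_full m x : m%:R <= x -> layers m x = m%:R.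
Proof.
elim: m => [|m IH] mx; first by rewrite /layers big_ord0.
rewrite /layers big_ord_recr /= mx -/(layers m x) IH ?natr1//.
by apply: le_trans mx; rewrite ler_nat.
Qed.
Lemma layers_le m x : 0 <= x -> layers m x <= x.
Proof.
move=> x0; elim: m => [|m IH]; first by rewrite /layers big_ord0.
rewrite /layers big_ord_recr /= -/(layers m x).
case: (leP m.+1%:R x) => mx; last by rewrite addr0.
by rewrite layers_full ?natr1//; apply: le_trans mx; rewrite ler_nat.
Qed.
Lemma layers_ge m x : 0 <= x -> x <= m%:R -> x <= layers m x + 1.
Proof.
move=> x0; elim: m => [|m IH] xm; first by rewrite /layers big_ord0 add0r (le_trans xm).
rewrite /layers big_ord_recr /= -/(layers m x).
have [xm'|mx] := leP x m%:R; first by apply: (le_trans (IH xm')); rewrite lerD2r lerDl.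
by rewrite layers_full ?(ltW mx)//; apply: (le_trans xm); rewrite -natr1 lerD2r lerDl.
Qed.
Lemma layers_cvg x : 0 <= x <= 1 -> (fun n => harmonic n * layers n.+1 (n.+1%:R * x)) @ \oo --> x.
Proof.
move=> /andP[x0 x1]; apply/subr_cvg0; apply: (cvg0_le _ (@cvg_harmonic R)).
apply: nearW => n; have n0 : 0 < n.+1%:R :> R by [].
have y0 : 0 <= n.+1%:R * x by rewrite mulr_ge0.
have yn : n.+1%:R * x <= n.+1%:R by rewrite ler_piMr.
have h1 := layers_le n.+1 y0; have h2 := layers_ge y0 yn.
have -> : harmonic n * layers n.+1 (n.+1%:R * x) - x = harmonic n * (layers n.+1 (n.+1%:R * x) - n.+1%:R * x).
  by rewrite mulrBr mulrA mulVf ?mul1r// gt_eqF.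
rewrite normrM ger0_norm ?harmonic_ge0// ler_piMr ?harmonic_ge0// ler_norml.
by apply/andP; split; lra.
Qed.
End LayerCake.

(** * Product formulas, exponential moments and variance for i.i.d. samples *)

Section Independence.
Context {R : realType} d {Omega : measurableType d} (Pr : probability Omega R).
Variables (Z : nat -> Omega -> R) (P : probability (measurableTypeR R) R).
Hypothesis iid : iid_law Pr Z P.

Let mZ k : measurable_fun setT (Z k). Proof. by have [h _] := iid; exact: h. Qed.

Lemma rintegrable_prob d' (T : measurableType d') (mu : probability T R) (f : T -> R) C :
  measurable_fun setT f -> (forall x, `|f x| <= C) -> mu.-integrable setT (EFin \o f).
Proof.
move=> mf fC; apply: (rintegrable_le mf fC).
exact: finite_measure_integrable_cst.
Qed.
Lemma cintegrable_prob d' (T : measurableType d') (mu : probability T R) (f : T -> R[i]) C :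
  cmeasurable f -> (forall x, cabs (f x) <= C) -> cintegrable mu f.
Proof.
move=> mf fC; apply: (cintegrable_le mf fC).
exact: finite_measure_integrable_cst.
Qed.
Lemma Rinteg_prob_cst d' (T : measurableType d') (mu : probability T R) (c : R) :
  Rinteg mu (fun=> c) = c.
Proof.
transitivity (fine (c%:E * mu setT)%E); last by rewrite probability_setT mule1.
by rewrite /Rinteg integral_cst.
Qed.
Lemma cint_prob_cst d' (T : measurableType d') (mu : probability T R) (c : R[i]) :
  cint mu (fun=> c) = c.
Proof. by apply: complex_eqP; rewrite /cint/= Rinteg_prob_cst. Qed.
Lemma Rinteg_prob_le d' (T : measurableType d') (mu : probability T R) (f : T -> R) C :
  measurable_fun setT f -> (forall x, `|f x| <= C) -> `|Rinteg mu f| <= C.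
Proof.
move=> mf fC; have if_ := rintegrable_prob mu mf fC.
apply: (le_trans (normr_Rinteg if_)); rewrite -[leRHS](Rinteg_prob_cst mu).
apply: le_Rinteg => //; first exact: rintegrable_norm.
exact: finite_measure_integrable_cst.
Qed.
Lemma Rinteg_indic d' (T : measurableType d') (mu : probability T R) (A : set T) :
  measurable A -> Rinteg mu \1_A = fine (mu A).
Proof. by move=> mA; rewrite /Rinteg integral_indic// setIT. Qed.

Lemma measurable_compZ (f : R -> R) k : measurable_fun setT f ->
  measurable_fun setT (fun w => f (Z k w)).
Proof. by move=> mf; exact: (measurableT_comp mf (mZ k)). Qed.
Lemma cmeasurable_compZ (f : R -> R[i]) k : cmeasurable f -> cmeasurable (fun w => f (Z k w)).
Proof. by move=> mf; exact: (cmeasurable_comp mf (mZ k)). Qed.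

Lemma Rinteg_law (f : R -> R) C k : measurable_fun setT f -> (forall x, `|f x| <= C) ->
  Rinteg Pr (fun w => f (Z k w)) = Rinteg P f.
Proof.
move=> mf fC; congr fine.
have mE : measurable_fun setT (EFin \o f) by exact/measurable_EFinP.
have iE : Pr.-integrable (Z k @^-1` setT) ((EFin \o f) \o Z k).
  rewrite preimage_setT; apply: (@rintegrable_prob _ _ Pr (fun w => f (Z k w)) C) => //.
  exact: measurable_compZ.
rewrite -[LHS]/(\int[Pr]_(w in setT) ((EFin \o f) \o Z k) w)%E -(preimage_setT (Z k)).
rewrite -(@integral_pushforward _ _ Omega (measurableTypeR R) R (Z k) (mZ k) Pr setT (EFin \o f) mE iE measurableT).
apply: eq_measure_integral; first exact: (mZ k).
by move=> mZ' A mA _; have [_ [h _]] := iid; exact: h.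
Qed.

Section Extend.
Variables (W : Omega -> R[i]) (CW : R) (k : nat).
Hypotheses (mW : cmeasurable W) (WC : forall w, cabs (W w) <= CW).
Hypothesis ind : forall B : set (measurableTypeR R), measurable B ->
  cint Pr (fun w => W w * (\1_B (Z k w))%:C) = cint Pr W * (Rinteg P \1_B)%:C.


Let iWf (f : R -> R[i]) C : cmeasurable f -> (forall x, cabs (f x) <= C) ->
  cintegrable Pr (fun w => W w * f (Z k w)).
Proof.
move=> mf fC; apply: (@cintegrable_prob _ _ _ _ (CW * C)).
  by apply: cmeasurableM => //; exact: cmeasurable_compZ.
by move=> w; rewrite cabsM; apply: ler_pM; rewrite ?cabs_ge0.
Qed.

(** The staircase approximations are finite sums of indicators, for which the factorisation is the
    hypothesis [ind]; they are bounded by one, so both sides pass to the limit. *)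
Let extend01 (f : R -> R) : measurable_fun setT f -> (forall x, 0 <= f x <= 1) ->
  cint Pr (fun w => W w * (f (Z k w))%:C) = cint Pr W * (Rinteg P f)%:C.
Proof.
move=> mf f01.
pose B (m j : nat) : set (measurableTypeR R) := [set x | j.+1%:R <= m.+1%:R * f x].
have mB m j : measurable (B m j).
  rewrite -[B m j]setTI; apply: (measurable_fun_ler (f := cst j.+1%:R) (g := fun x => m.+1%:R * f x)) => //.
  exact: measurable_funM.
pose g m (x : R) := harmonic m * layers m.+1 (m.+1%:R * f x).
have gE m x : g m x = \sum_(j < m.+1) harmonic m * \1_(B m j) x.
  rewrite /g /layers mulr_sumr; apply: eq_bigr => j _; congr (_ * _); rewrite indicE.
  congr ((nat_of_bool _)%:R); apply/idP/idP => [h|]; first by rewrite inE.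
  by rewrite inE.
have mg m : measurable_fun setT (g m).
  have -> : g m = (fun x => \sum_(j < m.+1) harmonic m * \1_(B m j) x) by apply/funext => x; exact: gE.
  by apply: measurable_sum => j; apply: measurable_funM; [exact: measurable_cst|exact: (@measurable_indic _ (measurableTypeR R) R setT _ (mB m j))].
have g1 m x : `|g m x| <= 1.
  have /andP[f0 f1] := f01 x.
  have y0 : 0 <= m.+1%:R * f x by rewrite mulr_ge0.
  have l0 : 0 <= layers m.+1 (m.+1%:R * f x) by apply: sumr_ge0 => j _.
  rewrite /g ger0_norm ?mulr_ge0 ?harmonic_ge0// /harmonic ler_pdivrMl// mulr1.
  by apply: (le_trans (layers_le _ y0)); rewrite ler_piMr.
have gl x : (fun m => g m x) @ \oo --> f x by exact: layers_cvg.
have E m : cint Pr (fun w => W w * (g m (Z k w))%:C) = cint Pr W * (Rinteg P (g m))%:C.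
  have iB j : P.-integrable setT (EFin \o (\1_(B m j) : R -> R)).
    apply: (@rintegrable_prob _ _ _ _ 1); first exact: measurable_indic.
    by move=> x; rewrite indicE; case: (_ \in _); rewrite ?normr1 ?normr0.
  have -> : (Rinteg P (g m))%:C = \sum_(j < m.+1) (harmonic m)%:C * (Rinteg P \1_(B m j))%:C.
    rewrite -cint_real; under eq_cint do rewrite gE rmorph_sum.
    rewrite cint_sum; last by move=> j; apply: cintegrable_real; exact: rintegrableZ.
    by apply: eq_bigr => j _; rewrite cint_real RintegZ// realcM.
  rewrite mulr_sumr.
  transitivity (cint Pr (fun w => \sum_(j < m.+1) (harmonic m)%:C * (W w * (\1_(B m j) (Z k w))%:C))).
    apply: eq_cint => w; rewrite gE rmorph_sum mulr_sumr; apply: eq_bigr => j _.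
    by rewrite [LHS]/= realcM mulrCA.
  have iWB j : cintegrable Pr (fun w => W w * (\1_(B m j) (Z k w))%:C).
    apply: (@iWf (fun x => (\1_(B m j) x)%:C) 1).
      by apply: cmeasurable_real; exact: (@measurable_indic _ (measurableTypeR R) R setT _ (mB m j)).
    by move=> x; rewrite cabsC indicE; case: (_ \in _); rewrite ?normr1 ?normr0.
  rewrite cint_sum; last by move=> j; exact: cintegrableZ.
  by apply: eq_bigr => j _; rewrite cintZ// ind// mulrCA.
have iC (r : R) : Pr.-integrable setT (EFin \o (fun=> r)) by exact: finite_measure_integrable_cst.
have [_ L1] : cintegrable Pr (fun w => W w * (f (Z k w))%:C) /\
  ccvg (fun m => cint Pr (fun w => W w * (g m (Z k w))%:C)) (cint Pr (fun w => W w * (f (Z k w))%:C)).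
  apply: (cint_dct _ _ (iC CW)).
  - move=> m; apply: cmeasurableM => //; apply: (cmeasurable_compZ (f := fun x => (g m x)%:C)).
    exact: cmeasurable_real.
  - move=> m w; rewrite cabsM cabsC -[leRHS]mulr1; apply: ler_pM => //; exact: cabs_ge0.
  - by move=> w; apply: ccvgM; [exact: ccvg_cst|exact: ccvg_real].
apply: (ccvg_unique L1).
apply: near_ccvg; first by apply: nearW => m; exact/esym/E.
apply: ccvgM; first exact: ccvg_cst.
apply: ccvg_real.
apply: (proj2 (@Rinteg_dct R _ _ P g f (fun=> 1) mg g1 _ gl)).
exact: finite_measure_integrable_cst.
Qed.

Let extend_real (f : R -> R) C : measurable_fun setT f -> (forall x, `|f x| <= C) ->
  cint Pr (fun w => W w * (f (Z k w))%:C) = cint Pr W * (Rinteg P f)%:C.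
Proof.
(* The function is rescaled into [[0, 1]] by an affine map; the added 1 keeps [c] positive when
   [C = 0]. *)
move=> mf fC; pose c := C + 1.
have c0 : 0 < c by have := le_trans (normr_ge0 _) (fC 0); rewrite /c; lra.
pose g x := (c^-1 * f x + 1) * 2^-1.
have mg : measurable_fun setT g.
  by apply: measurable_funM => //; apply: measurable_funD => //; exact: measurable_funM.
have g01 x : 0 <= g x <= 1.
  have : `|c^-1 * f x| <= 1.
    rewrite normrM gtr0_norm ?invr_gt0// ler_pdivrMl// mulr1 (le_trans (fC x))// /c; lra.
  by rewrite ler_norml /g => /andP[? ?]; apply/andP; split; lra.
have fE x : f x = 2 * c * g x - c by rewrite /g; field; rewrite gt_eqF.
have gC x : `|g x| <= 1 by have /andP[? ?] := g01 x; rewrite ger0_norm.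
have ig := rintegrable_prob P mg gC.
have iW : cintegrable Pr W by exact: cintegrable_prob mW WC.
have iWg : cintegrable Pr (fun w => W w * (g (Z k w))%:C).
  apply: (@iWf (fun x => (g x)%:C) 1); first exact: cmeasurable_real.
  by move=> x; rewrite cabsC.
transitivity (cint Pr (fun w => (2 * c)%:C * (W w * (g (Z k w))%:C) - c%:C * W w)).
  by apply: eq_cint => w; rewrite fE rmorphB/= realcM; ring.
rewrite cintB ?cintZ ?extend01//; [|exact: cintegrableZ|exact: cintegrableZ].
have -> : Rinteg P f = 2 * c * Rinteg P g - c.
  rewrite -RintegZ// -[X in _ - X](Rinteg_prob_cst P c) -RintegB//.
  - by congr Rinteg; apply/funext => x; rewrite fE.
  - exact: rintegrableZ.
  - exact: finite_measure_integrable_cst.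
by rewrite rmorphB/= realcM; ring.
Qed.

Lemma indep_extend (f : R -> R[i]) C : cmeasurable f -> (forall x, cabs (f x) <= C) ->
  cint Pr (fun w => W w * f (Z k w)) = cint Pr W * cint P f.
Proof.
move=> mf fC; have [m1 m2] := mf.
have C1 x : `|cre (f x)| <= C by apply: le_trans (fC x); exact: cre_le_cabs.
have C2 x : `|cim (f x)| <= C by apply: le_trans (fC x); exact: cim_le_cabs.
have fE z : z = (cre z)%:C + (0 +i* 1) * (cim z)%:C :> R[i].
  by apply: complex_eqP; rewrite !cparts/=; ring.
have iW1 : cintegrable Pr (fun w => W w * (cre (f (Z k w)))%:C).
  apply: (@iWf (fun x => (cre (f x))%:C) C); first exact: cmeasurable_real.
  by move=> x; rewrite cabsC.
have iW2 : cintegrable Pr (fun w => W w * (cim (f (Z k w)))%:C).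
  apply: (@iWf (fun x => (cim (f x))%:C) C); first exact: cmeasurable_real.
  by move=> x; rewrite cabsC.
transitivity (cint Pr (fun w => W w * (cre (f (Z k w)))%:C + (0 +i* 1) * (W w * (cim (f (Z k w)))%:C))).
  by apply: eq_cint => w; rewrite [f (Z k w) in LHS]fE; ring.
rewrite cintD ?cintZ//; last exact: cintegrableZ.
rewrite (extend_real m1 C1) (extend_real m2 C2) [cint P f]fE /cint /=.
by ring.
Qed.
End Extend.

Lemma prod_indic (s : seq nat) (B : nat -> set (measurableTypeR R)) w :
  \prod_(k <- s) (\1_(B k) (Z k w) : R) = \1_(\bigcap_(k in [set` s]) (Z k @^-1` B k)) w.
Proof.
elim: s => [|k s IH].
  by rewrite big_nil indicE mem_set.
rewrite big_cons IH !indicE -natrM mulnb; congr ((nat_of_bool _)%:R).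
apply/andP/idP => [[h1 h2]|].
  rewrite inE => j /=; rewrite inE => /orP[/eqP ->|js]; first by move: h1; rewrite inE.
  by move: h2; rewrite inE; apply.
rewrite inE => h; split; rewrite inE.
  by apply: h; rewrite /= mem_head.
by move=> j /= js; apply: h; rewrite /= inE js orbT.
Qed.

Lemma prod_cabs_le (s : seq nat) (f : nat -> R[i]) (C : nat -> R) :
  (forall k, cabs (f k) <= C k) -> cabs (\prod_(k <- s) f k) <= \prod_(k <- s) C k.
Proof.
move=> fC; elim: s => [|k s IH]; first by rewrite !big_nil cabs1.
by rewrite !big_cons cabsM; apply: ler_pM; rewrite ?cabs_ge0.
Qed.
Lemma cmeasurable_prod d' (T : measurableType d') (s : seq nat) (F : nat -> T -> R[i]) :
  (forall k, cmeasurable (F k)) -> cmeasurable (fun w => \prod_(k <- s) F k w).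
Proof.
move=> mF; elim: s => [|k s IH].
  by under eq_fun do rewrite big_nil; exact: cmeasurable_cst.
by under eq_fun do rewrite big_cons; exact: cmeasurableM.
Qed.

(** The induction moves indices one by one from the list [s2] of indicators to the list [s1] of
    bounded functions. With [s1] empty it is the definition of independence, and the induction
    hypothesis with the new index still in [s2] is what [indep_extend] asks for. *)
Let indep_prod_indic (s1 s2 : seq nat) (f : nat -> R -> R[i]) (C : nat -> R)
    (B : nat -> set (measurableTypeR R)) :
  uniq (s1 ++ s2) -> (forall k, cmeasurable (f k)) -> (forall k x, cabs (f k x) <= C k) ->
  (forall k, measurable (B k)) ->
  cint Pr (fun w => \prod_(k <- s1) f k (Z k w) * \prod_(k <- s2) (\1_(B k) (Z k w))%:C) =
  \prod_(k <- s1) cint P (f k) * \prod_(k <- s2) (Rinteg P \1_(B k))%:C.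
Proof.
move=> us mf fC; elim: s1 s2 B us => [|k s1 IH] s2 B /= us mB.
  under eq_cint do rewrite big_nil mul1r -rmorph_prod prod_indic.
  rewrite big_nil mul1r cint_real -rmorph_prod /=; congr (_ %:C).
  rewrite Rinteg_indic; last first.
    apply: fin_bigcap_measurable; first exact: finite_seq.
    by move=> k _; have := mZ k measurableT (mB k); rewrite setTI.
  have [_ [lawZ indZ]] := iid; rewrite indZ//.
  by apply: eq_bigr => k _; rewrite Rinteg_indic// lawZ.
have [ks us'] := andP us.
have kns2 : k \notin s2 by move: ks; rewrite mem_cat negb_or => /andP[].
pose W w := \prod_(j <- s1) f j (Z j w) * \prod_(j <- s2) ((\1_(B j) (Z j w))%:C : R[i]).
have mW : cmeasurable W.
  apply: cmeasurableM; apply: cmeasurable_prod => j; first exact: cmeasurable_compZ.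
  apply: (cmeasurable_compZ (f := fun x => (\1_(B j) x)%:C)).
  by apply: cmeasurable_real; exact: (@measurable_indic _ (measurableTypeR R) R setT _ (mB j)).
have WC w : cabs (W w) <= \prod_(j <- s1) C j * \prod_(j <- s2) 1.
  rewrite cabsM; apply: ler_pM; rewrite ?cabs_ge0//; apply: prod_cabs_le => j; first exact: fC.
  by rewrite cabsC indicE; case: (_ \in _); rewrite ?normr1 ?normr0.
transitivity (cint Pr (fun w => W w * f k (Z k w))).
  by apply: eq_cint => w; rewrite big_cons /W; ring.
rewrite (indep_extend mW WC _ (mf k) (fC k)).
  by rewrite (IH s2 B us' mB) big_cons; ring.
move=> B0 mB0.
(* The family [B] is overridden at [k] by the arbitrary test set [B0]; the factors in [s2] do not
   change because [k] is not in that list. *)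
pose B' j := if j == k then B0 else B j.
have mB' j : measurable (B' j) by rewrite /B'; case: ifP.
have E2 (F : nat -> set (measurableTypeR R) -> R[i]) :
    \prod_(j <- k :: s2) F j (B' j) = F k B0 * \prod_(j <- s2) F j (B j).
  rewrite big_cons /B' eqxx; congr (_ * _); apply: eq_big_seq => j js.
  by case: eqP => // jk; rewrite jk (negbTE kns2) in js.
have us'' : uniq (s1 ++ k :: s2) by rewrite -cat1s uniq_catCA.
have := IH (k :: s2) B' us'' mB'.
rewrite (E2 (fun _ B => (Rinteg P \1_B)%:C)).
move=> h; rewrite [in RHS]/W (IH s2 B us' mB).
transitivity (cint Pr (fun w => \prod_(j <- s1) f j (Z j w) * \prod_(j <- k :: s2) (\1_(B' j) (Z j w))%:C)).
  by apply: eq_cint => w; rewrite (E2 (fun j B => (\1_B (Z j w))%:C)) /W; ring.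
by rewrite h; ring.
Qed.

Lemma indep_prod (s : seq nat) (f : nat -> R -> R[i]) (C : nat -> R) :
  uniq s -> (forall k, cmeasurable (f k)) -> (forall k x, cabs (f k x) <= C k) ->
  cint Pr (fun w => \prod_(k <- s) f k (Z k w)) = \prod_(k <- s) cint P (f k).
Proof.
move=> us mf fC; have := @indep_prod_indic s [::] f C (fun=> setT).
rewrite cats0 => /(_ us mf fC (fun=> measurableT)); rewrite big_nil mulr1 => <-.
by apply: eq_cint => w; rewrite big_nil mulr1.
Qed.

Lemma indep_prod_iid n (f : R -> R[i]) C : cmeasurable f -> (forall x, cabs (f x) <= C) ->
  cint Pr (fun w => \prod_(k < n) f (Z k w)) = cint P f ^+ n.
Proof.
move=> mf fC; have := @indep_prod (index_iota 0 n) (fun=> f) (fun=> C) (iota_uniq _ _) (fun=> mf) (fun=> fC).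
under eq_cint do rewrite big_mkord; move=> ->.
by rewrite big_mkord prodr_const card_ord.
Qed.

(** From [exp (- y) >= 1 - y] comes [(1 - y) * exp y <= 1], while [(1 - y) * (1 + y + 2 y^2) = 1 +
    y^2 * (1 - 2 y) >= 1]. *)
Lemma expR_quadratic (y : R) : `|y| <= 1 / 2 -> expR y <= 1 + y + 2 * y ^+ 2.
Proof.
rewrite ler_norml => /andP[y1 y2].
have h := expR_ge1Dx (- y); rewrite expRN in h.
have e0 := expR_gt0 y.
have h1 : (1 - y) * expR y <= 1 by rewrite -ler_pdivlMr// div1r.
have y3 : 0 < 1 - y by lra.
rewrite -(ler_pM2l y3); apply: (le_trans h1).
have : 0 <= y ^+ 2 * (1 - 2 * y) by rewrite mulr_ge0 ?sqr_ge0//; lra.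
lra.
Qed.

(** For one factor, [|f - m| <= 2] and the vanishing mean of [f - m] give at most
    [1 + 8 s^2 <= exp (8 s^2)]. The bound [|s| <= 1 / 4] keeps the exponent within the range of
    [expR_quadratic], and independence raises the result to the power [n]. *)
Lemma hoeffding n (f : R -> R) (s : R) : measurable_fun setT f -> (forall x, `|f x| <= 1) ->
  `|s| <= 1 / 4 ->
  Rinteg Pr (fun w => expR (s * \sum_(k < n) (f (Z k w) - Rinteg P f))) <= expR (8 * s ^+ 2 * n%:R).
Proof.
move=> mf f1 s4; set m := Rinteg P f.
have m1 : `|m| <= 1 by exact: Rinteg_prob_le.
pose F x := expR (s * (f x - m)).
have fm x : `|s * (f x - m)| <= 1 / 2.
  rewrite normrM; have : `|f x - m| <= 2.
    by apply: (le_trans (ler_normB _ _)); have := f1 x; lra.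
  move=> h; apply: (@le_trans _ _ (1 / 4 * 2)); last by lra.
  exact: ler_pM.
have mF : measurable_fun setT F.
  apply: (measurableT_comp (f := expR)) => //; apply: measurable_funM => //.
  exact: measurable_funB.
have FC x : `|F x| <= expR 1.
  rewrite ger0_norm ?expR_ge0// ler_expR; apply: (le_trans (ler_norm _)).
  by apply: (le_trans (fm x)); lra.
have ifm : P.-integrable setT (EFin \o (fun x => f x - m)).
  apply: (@rintegrable_prob _ _ _ _ (1 + 1)); first exact: measurable_funB.
  by move=> x; apply: (le_trans (ler_normB _ _)); apply: lerD.
have FE : Rinteg P F <= expR (8 * s ^+ 2).
  apply: le_trans (expR_ge1Dx _).
  have -> : 1 + 8 * s ^+ 2 = Rinteg P (fun x => (1 + 8 * s ^+ 2) + s * (f x - m)).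
    rewrite RintegD; last exact: rintegrableZ; last exact: finite_measure_integrable_cst.
    rewrite Rinteg_prob_cst RintegZ// RintegB; last exact: finite_measure_integrable_cst.
      by rewrite Rinteg_prob_cst subrr mulr0 addr0.
    exact: (@rintegrable_prob _ _ P f 1).
  apply: le_Rinteg.
  - exact: (@rintegrable_prob _ _ P F (expR 1)).
  - by apply: rintegrableD; [exact: finite_measure_integrable_cst|exact: rintegrableZ].
  move=> x; apply: (le_trans (expR_quadratic (fm x))).
  have : (f x - m) ^+ 2 <= 2 ^+ 2.
    rewrite -[leLHS]real_normK ?num_real//; apply: lerXn2r; rewrite ?nnegrE//.
    by apply: (le_trans (ler_normB _ _)); have := f1 x; lra.
  by rewrite exprMn; have := sqr_ge0 s; set a := s ^+ 2; set b := (f x - m) ^+ 2; nra.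
have -> : Rinteg Pr (fun w => expR (s * \sum_(k < n) (f (Z k w) - m))) = Rinteg P F ^+ n.
  have FC' x : cabs ((F x)%:C : R[i]) <= expR 1 by rewrite cabsC.
  have := congr1 (@cre R) (indep_prod_iid n (cmeasurable_real mF) FC').
  rewrite cint_real -rmorphXn creC => <-.
  under eq_cint do rewrite -rmorph_prod; rewrite cint_real creC.
  congr Rinteg; apply/funext => w; rewrite mulr_sumr expR_sum.
  by [].
rewrite [8 * _ * _]mulrC expRM_natl; apply: lerXn2r => //; rewrite nnegrE ?expR_ge0//.
by apply: Rinteg_ge0 => x; exact: expR_ge0.
Qed.

(** The centred summands are uncorrelated and of modulus at most 2, so only the [n] diagonal terms
    remain, each at most 4, over [n^2]. *)
Lemma phin_variance n u : (0 < n)%N ->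
  Rinteg Pr (fun w => cabs (phin Z n w u - mfourier P u) ^+ 2) <= 4 / n%:R.
Proof.
move=> n0; have nn0 : n%:R != 0 :> R by rewrite pnatr_eq0 -lt0n.
set p := mfourier P u.
have me : cmeasurable (fun x : R => eiu (u * x)) by apply: cmeasurable_eiu; exact: measurable_funM.
have p1 : cabs p <= 1.
  rewrite -[leRHS](Rinteg_prob_cst P); apply: cabs_cint_bound => //.
    by move=> x; rewrite cabs_eiu.
  exact: finite_measure_integrable_cst.
pose y (x : R) := eiu (u * x) - p.
have my : cmeasurable y by apply: cmeasurableB => //; exact: cmeasurable_cst.
have y2 x : cabs (y x) <= 2.
  by apply: (le_trans (cabsB _ _)); rewrite cabs_eiu; lra.
have y0 : cint P y = 0.
  rewrite cintB ?cint_prob_cst ?subrr//.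
    by apply: (@cintegrable_prob _ _ _ _ 1) => // x; rewrite cabs_eiu.
  by apply: (@cintegrable_prob _ _ _ _ (cabs p)) => //; exact: cmeasurable_cst.
have E w : phin Z n w u - p = (n%:R^-1)%:C * \sum_(k < n) y (Z k w).
  rewrite /phin /y sumrB mulrBr sumr_const card_ord; congr (_ - _).
  have nC : (n%:R : R[i]) = (n%:R : R)%:C by rewrite rmorph_nat.
  by rewrite -[p *+ n]mulr_natl nC mulrA -realcM mulVf// mul1r.
have iyy k l : cintegrable Pr (fun w => conjc (y (Z l w)) * y (Z k w)).
  apply: (@cintegrable_prob _ _ _ _ (2 * 2)).
    by apply: cmeasurableM; [apply: cmeasurableJ|]; exact: cmeasurable_compZ.
  by move=> w; rewrite cabsM cabsJ; apply: ler_pM; rewrite ?cabs_ge0.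
have cov k l : k != l -> cint Pr (fun w => conjc (y (Z l w)) * y (Z k w)) = 0.
  move=> kl.
  (* The family holds the conjugate at the index [l] and [y] itself elsewhere, so its product over
     [l] and [k] is the covariance term. *)
  have := @indep_prod [:: l; k] (fun j x => if j == l then conjc (y x) else y x) (fun=> 2).
  have h1 : uniq [:: l; k] by rewrite /= inE eq_sym kl.
  have h2 j : cmeasurable (fun x => if j == l then conjc (y x) else y x).
    by case: (j == l) => //; exact: cmeasurableJ.
  have h3 (j : nat) x : cabs (if j == l then conjc (y x) else y x) <= 2.
    by case: (j == l); rewrite ?cabsJ.
  move=> /(_ h1 h2 h3).
  rewrite !big_cons !big_nil eqxx (negbTE kl) y0 mul0r mulr0 => <-.
  by apply: eq_cint => w; rewrite !big_cons big_nil eqxx (negbTE kl) mulr1.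
have SE : Rinteg Pr (fun w => cabs (phin Z n w u - p) ^+ 2) =
   cre (((n%:R^-1) ^+ 2)%:C * \sum_(k < n) cint Pr (fun w => conjc (y (Z k w)) * y (Z k w))).
  rewrite -[LHS]creC -cint_real; congr cre.
  transitivity (cint Pr (fun w => ((n%:R^-1) ^+ 2)%:C *
      \sum_(l < n) \sum_(k < n) conjc (y (Z l w)) * y (Z k w))).
    apply: eq_cint => w; rewrite -mulJc E cmulJ.
    have -> : conjc ((n%:R^-1)%:C : R[i]) = (n%:R^-1)%:C.
      by apply: complex_eqP; rewrite !cparts ?oppr0.
    have -> : conjc (\sum_(k < n) y (Z k w)) = \sum_(k < n) conjc (y (Z k w)).
      by rewrite rmorph_sum.
    have -> : \sum_(l < n) \sum_(k < n) conjc (y (Z l w)) * y (Z k w) =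
       (\sum_(l < n) conjc (y (Z l w))) * \sum_(k < n) y (Z k w).
      by rewrite mulr_suml; apply: eq_bigr => l _; rewrite mulr_sumr.
    by rewrite rmorphXn/= expr2; ring.
  rewrite cintZ; last by apply: cintegrable_sum => l; apply: cintegrable_sum => k.
  congr (_ * _); rewrite cint_sum; last by move=> l; apply: cintegrable_sum => k.
  apply: eq_bigr => l _; rewrite cint_sum//.
  rewrite (bigD1 l)//= big1 ?addr0// => k kl; exact: cov.
rewrite SE creZ; apply: (@le_trans _ _ (n%:R^-1 ^+ 2 * (4 * n%:R))); last first.
  by rewrite le_eqVlt; apply/orP; left; apply/eqP; field.
apply: ler_wpM2l; first by rewrite sqr_ge0.
rewrite cre_sum; apply: (@le_trans _ _ (\sum_(k < n) 4)); last first.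
  by rewrite sumr_const card_ord mulr_natr.
apply: ler_sum => k _; apply: (le_trans (ler_norm _)); apply: (le_trans (cre_le_cabs _)).
rewrite -[leRHS](Rinteg_prob_cst Pr); apply: cabs_cint_bound.
- exact: cintegrable_meas (iyy k k).
- move=> w; rewrite cabsM cabsJ; apply: (@le_trans _ _ (2 * 2)); last by lra.
  by apply: ler_pM; rewrite ?cabs_ge0.
- exact: finite_measure_integrable_cst.
Qed.
End Independence.

(** * Taylor and Lipschitz bounds for [eiu] *)

Section ExponentialTaylor.
Context {R : realType}.

(* Projecting onto the direction of the increment reduces to the real mean value theorem. *)
Lemma cMVT_bound (f df : R -> R[i]) (C : R) : (forall t, is_cderive t f (df t)) ->
  (forall t, 0 <= t <= 1 -> cabs (df t) <= C) -> cabs (f 1 - f 0) <= C.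
Proof.
move=> fd dfC; set c := f 1 - f 0.
have [c0|c0] := eqVneq (cabs c) 0.
  by rewrite c0 (le_trans (cabs_ge0 _) (dfC 0 _))// lexx ler01.
have cp : 0 < cabs c by rewrite lt_def c0 cabs_ge0.
rewrite -(ler_pM2l cp) -expr2.
have D t : is_cderive t (fun s => conjc c * f s) (conjc c * df t).
  by apply: is_cderive_eq (is_cderiveM (is_cderive_cst t _) (fd t)) _; rewrite mul0r add0r.
have := @MVT_bound R (fun s => cre (conjc c * f s)) (fun s => cre (conjc c * df s)) (cabs c * C).
have h1 t := (D t).1.
have h2 (t : R) : 0 <= t <= 1 -> `|cre (conjc c * df t)| <= cabs c * C.
  move=> t01; apply: (le_trans (cre_le_cabs _)); rewrite cabsM cabsJ.
  by rewrite ler_wpM2l ?cabs_ge0//; exact: dfC.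
move=> /(_ h1 h2); rewrite -creB -mulrBr mulJc creC ger0_norm//.
by rewrite sqr_ge0.
Qed.

Let icexp (t s : R) : cexp (s%:C * (0 +i* t)) = eiu (s * t).
Proof. by rewrite cexpE creZ cimZ /= mulr0 expR0 mul1r. Qed.
Let cabs_i (t : R) : cabs (0 +i* t) = `|t|.
Proof. by rewrite /cabs/= expr0n/= add0r sqrtr_sqr. Qed.

Lemma eiu_taylor1 (t : R) : cabs (eiu t - 1) <= `|t|.
Proof.
pose z : R[i] := 0 +i* t.
have := @cMVT_bound (fun s => cexp (s%:C * z)) (fun s => z * cexp (s%:C * z)) `|t|
  (fun s => is_cderive_cexplin s z).
rewrite !icexp mul1r mul0r eiu0; apply=> s _.
by rewrite cabsM icexp cabs_eiu mulr1 cabs_i.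
Qed.

(** The derivative of this remainder along the segment is [i t] times the previous remainder, so
    each further order costs one factor [|t|]; the same argument gives the third order. *)
Lemma eiu_taylor2 (t : R) : cabs (eiu t - (1 + (0 +i* t))) <= `|t| ^+ 2.
Proof.
pose z : R[i] := 0 +i* t.
have D (s : R) : is_cderive s (fun s => cexp (s%:C * z) + (-1) * (s%:C * z)) (z * (cexp (s%:C * z) - 1)).
  apply: is_cderive_eq (is_cderiveD (is_cderive_cexplin s z)
    (is_cderiveM (is_cderive_cst s (-1)) (is_cderive_lin s z))) _.
  by ring.
have := cMVT_bound D; rewrite !icexp mul1r mul0r eiu0 => /(_ (`|t| ^+ 2)).
have -> : eiu t + -1 * (1%:C * z) - (1 + -1 * (0%:C * z)) = eiu t - (1 + (0 +i* t)).
  by rewrite /z; apply: complex_eqP; rewrite !cparts/=; ring.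
apply=> s /andP[s0 s1].
rewrite cabsM cabs_i expr2 ler_wpM2l// icexp (le_trans (eiu_taylor1 _))// normrM.
by rewrite ler_piMl// ger0_norm.
Qed.

Lemma eiu_taylor3 (t : R) : cabs (eiu t - ((1 - t ^+ 2 / 2) +i* t)) <= `|t| ^+ 3.
Proof.
pose z : R[i] := 0 +i* t.
have D (s : R) : is_cderive s (fun s => cexp (s%:C * z) + ((-1) * (s%:C * z) +
    ((- 2^-1)%:C * (s%:C * z)) * (s%:C * z))) (z * (cexp (s%:C * z) - (1 + s%:C * z))).
  apply: is_cderive_eq (is_cderiveD (is_cderive_cexplin s z)
    (is_cderiveD (is_cderiveM (is_cderive_cst s (-1)) (is_cderive_lin s z))
      (is_cderiveM (is_cderiveM (is_cderive_cst s (- 2^-1)%:C) (is_cderive_lin s z))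
         (is_cderive_lin s z)))) _.
  by rewrite /z; apply: complex_eqP; rewrite !cparts/=; field.
have := cMVT_bound D; rewrite !icexp mul1r mul0r eiu0 => /(_ (`|t| ^+ 3)).
have -> : eiu t + (-1 * (1%:C * z) + (- 2^-1)%:C * (1%:C * z) * (1%:C * z)) -
   (1 + (-1 * (0%:C * z) + (- 2^-1)%:C * (0%:C * z) * (0%:C * z))) = eiu t - ((1 - t ^+ 2 / 2) +i* t).
  by rewrite /z; apply: complex_eqP; rewrite !cparts/=; field.
apply=> s /andP[s0 s1].
rewrite cabsM cabs_i exprS ler_wpM2l// icexp.
have -> : 1 + s%:C * z = 1 + (0 +i* (s * t)) :> R[i].
  by rewrite /z; apply: complex_eqP; rewrite !cparts/=; ring.
rewrite (le_trans (eiu_taylor2 _))// normrM lerXn2r ?nnegrE ?mulr_ge0//.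
by rewrite ler_piMl// ger0_norm.
Qed.

(** The trivial bound 2 is kept beside the Lipschitz one so that, as a function of the sample point,
    the increment has a bounded majorant. *)
Lemma eiu_lipschitz (a b : R) : cabs (eiu a - eiu b) <= Num.min 2 `|a - b|.
Proof.
rewrite le_min; apply/andP; split.
  by apply: (le_trans (cabsB _ _)); rewrite !cabs_eiu; lra.
have -> : eiu a - eiu b = eiu b * (eiu (a - b) - 1).
  by rewrite mulrBr mulr1 -eiuD; congr (eiu _ - _); ring.
by rewrite cabsM cabs_eiu mul1r; exact: eiu_taylor1.
Qed.
End ExponentialTaylor.

(** * Continuity of characteristic functions *)

Section ComplexContinuity.
Context {R : realType}.
Implicit Types f g : R -> R[i].

Definition ccontinuous f := continuous (fun x => cre (f x)) /\ continuous (fun x => cim (f x)).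

Lemma ccontinuousM f g : ccontinuous f -> ccontinuous g -> ccontinuous (fun x => f x * g x).
Proof.
move=> [f1 f2] [g1 g2]; split => x.
  under eq_fun do rewrite creM.
  apply: cvgB; first by apply: cvgM; [exact: f1|exact: g1].
  by apply: cvgM; [exact: f2|exact: g2].
under eq_fun do rewrite cimM.
apply: cvgD; first by apply: cvgM; [exact: f1|exact: g2].
by apply: cvgM; [exact: f2|exact: g1].
Qed.

Lemma ccontinuousV f : (forall x, f x != 0) -> ccontinuous f -> ccontinuous (fun x => (f x)^-1).
Proof.
move=> f0 [f1 f2].
have n0 x : cre (f x) ^+ 2 + cim (f x) ^+ 2 != 0.
  by rewrite -cabs_sqr expf_neq0// gt_eqF// cabs_gt0.
have cn x : (fun x => (cre (f x) ^+ 2 + cim (f x) ^+ 2)^-1) @ x --> (cre (f x) ^+ 2 + cim (f x) ^+ 2)^-1.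
  apply: cvgV => //; apply: cvgD; rewrite !expr2.
    by under eq_fun do rewrite expr2; apply: cvgM; exact: f1.
  by under eq_fun do rewrite expr2; apply: cvgM; exact: f2.
split => x.
  have -> : (fun x => cre (f x)^-1) = (fun x => cre (f x) * (cre (f x) ^+ 2 + cim (f x) ^+ 2)^-1).
    by apply/funext => y; rewrite creV.
  by apply: cvgM; [exact: f1|exact: cn].
have -> : (fun x => cim (f x)^-1) = (fun x => - (cim (f x) * (cre (f x) ^+ 2 + cim (f x) ^+ 2)^-1)).
  by apply/funext => y; rewrite cimV.
by apply: cvgN; apply: cvgM; [exact: f2|exact: cn].
Qed.

Lemma ccontinuous_seq f : (forall x (u : nat -> R), u @ \oo --> x -> ccvg (fun n => f (u n)) (f x)) ->
  ccontinuous f.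
Proof.
move=> fs; split => x; apply/(@cvg_nbhsP _ R^o) => u ux.
  exact: (fs x u ux).1.
exact: (fs x u ux).2.
Qed.

Lemma ccontinuous_mfourier (mu : probability (measurableTypeR R) R) : ccontinuous (mfourier mu).
Proof.
apply: ccontinuous_seq => x u ux.
apply: (proj2 (@cint_dct R _ _ mu (fun n y => eiu (u n * y)) (fun y => eiu (x * y)) (fun=> 1) _ _ _ _)).
- by move=> n; apply: cmeasurable_eiu; exact: measurable_funM.
- by move=> n y; rewrite cabs_eiu.
- exact: finite_measure_integrable_cst.
move=> y; have uy : (fun n => u n * y) @ \oo --> x * y by apply: cvgM => //; exact: cvg_cst.
split; first exact: (cvg_comp _ _ uy (@continuous_cos R _)).
exact: (cvg_comp _ _ uy (@continuous_sin R _)).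
Qed.

Lemma ccontinuous_phin d (T : measurableType d) (Z : nat -> T -> R) n w : ccontinuous (phin Z n w).
Proof.
apply: ccontinuous_seq => x u ux; apply: ccvgM; first exact: ccvg_cst.
have H (m : nat) : ccvg (fun k => \sum_(j < m) eiu (u k * Z j w)) (\sum_(j < m) eiu (x * Z j w)).
  elim: m => [|m IH].
    by under eq_fun do rewrite big_ord0; rewrite big_ord0; exact: ccvg_cst.
  under eq_fun do rewrite big_ord_recr/=; rewrite big_ord_recr/=; apply: ccvgD => //.
  have uy : (fun n => u n * Z m w) @ \oo --> x * Z m w by apply: cvgM => //; exact: cvg_cst.
  split; first exact: (cvg_comp _ _ uy (@continuous_cos R _)).
  exact: (cvg_comp _ _ uy (@continuous_sin R _)).
exact: H.
Qed.
End ComplexContinuity.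

Section Arithmetic.
Context {R : realType}.
Implicit Types a b c e m : R.

Lemma lt1_summands a b c e : 0 <= a -> 0 <= b -> 0 <= c -> 0 <= e -> a + b + (c + e) < 1 ->
  [/\ a < 1, b < 1, c < 1 & e < 1].
Proof. by move=> ? ? ? ? ?; split; lra. Qed.
Lemma le_add_mid a b c : 0 <= c -> 0 <= b -> a <= c + (a + b).
Proof. lra. Qed.
Lemma sixth_le4 a : a <= 1 -> a / 6 <= 4.
Proof. lra. Qed.
(** The error budget of the grid argument: a third for the increment of [phin], a third at the grid
    point, a third for the increment of the true characteristic function. *)
Lemma third_sum a b c m e : a <= e / 3 -> b <= c + m -> c <= 2 * (e / 6) -> m <= e / 3 -> a + b <= e.
Proof. lra. Qed.
End Arithmetic.

Lemma Rinteg_sum_le (R : realType) d (T : measurableType d) (mu : {measure set T -> \bar R})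
    (F : nat -> T -> R) (c : R) m :
  (forall j, mu.-integrable setT (EFin \o F j) /\ Rinteg mu (F j) <= c) ->
  mu.-integrable setT (EFin \o (fun w => \sum_(j < m) F j w)) /\
  Rinteg mu (fun w => \sum_(j < m) F j w) <= m%:R * c.
Proof.
move=> Fc; elim: m => [|m [IH1 IH2]].
  under eq_fun do rewrite big_ord0.
  by rewrite Rinteg0 mul0r; split => //; exact: rintegrable0.
have [i1 c1] := Fc m.
have -> : (fun w => \sum_(j < m.+1) F j w) = (fun w => \sum_(j < m) F j w + F m w).
  by apply/funext => w; rewrite big_ord_recr.
split; first exact: rintegrableD.
by rewrite RintegD// -[m.+1%:R]natr1 mulrDl mul1r lerD.
Qed.

Lemma cvg_invn (R : realType) : (fun n => n%:R^-1) @ \oo --> (0 : R).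
Proof. by rewrite -cvg_shiftS; exact: cvg_harmonic. Qed.

(** * Uniform control of the empirical characteristic function on a grid *)

Section Events.
Context {R : realType} d {Omega : measurableType d} (Pr : probability Omega R).
Variables (Z : nat -> Omega -> R) (P : probability (measurableTypeR R) R).
Hypothesis iid : iid_law Pr Z P.

Let mZ k : measurable_fun setT (Z k). Proof. by have [h _] := iid; exact: h. Qed.

(** The Chernoff variable of one tail: for [s > 0] it is below 1 exactly when the empirical mean
    exceeds the true one by less than [eta], and [- s] gives the other tail. *)
Definition hexp n (f : R -> R) (s eta : R) w :=
  expR (s * \sum_(k < n) (f (Z k w) - Rinteg P f) - `|s| * (n%:R * eta)).

Lemma measurable_hexp n f s eta : measurable_fun setT f -> measurable_fun setT (hexp n f s eta).
Proof.
move=> mf; apply: (measurableT_comp (f := expR)) => //; apply: measurable_funB => //.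
apply: measurable_funM => //; apply: measurable_sum => k; apply: measurable_funB => //.
exact: measurable_compZ iid _ _ mf.
Qed.

Lemma hexp_le n (f : R -> R) s eta w : measurable_fun setT f -> (forall x, `|f x| <= 1) -> 0 <= eta ->
  `|hexp n f s eta w| <= expR (`|s| * (n%:R * 2)).
Proof.
move=> mf f1 e0; rewrite ger0_norm ?expR_ge0// ler_expR.
have : `|\sum_(k < n) (f (Z k w) - Rinteg P f)| <= n%:R * 2.
  apply: (le_trans (ler_norm_sum _ _ _)); rewrite mulrC mulr_natr.
  apply: (@le_trans _ _ (\sum_(k < n) 2)); last by rewrite sumr_const card_ord.
  apply: ler_sum => k _; apply: (le_trans (ler_normB _ _)); have := f1 (Z k w).
  by have := Rinteg_prob_le P mf f1; lra.
move=> h; have := ler_wpM2l (normr_ge0 s) h; rewrite -normrM => h'.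
have := ler_norm (s * \sum_(k < n) (f (Z k w) - Rinteg P f)).
have : 0 <= `|s| * (n%:R * eta) by rewrite !mulr_ge0.
lra.
Qed.

(** The exponent [8 s^2 - |s| * eta] is least at [|s| = eta / 16], with value [- eta^2 / 32];
    [eta <= 4] is the constraint [|s| <= 1 / 4] of [hoeffding]. *)
Lemma hexp_mean n (f : R -> R) s eta : measurable_fun setT f -> (forall x, `|f x| <= 1) ->
  0 <= eta <= 4 -> `|s| = eta / 16 -> Rinteg Pr (hexp n f s eta) <= expR (- (n%:R * (eta ^+ 2 / 32))).
Proof.
move=> mf f1 /andP[e0 e4] se.
have -> : hexp n f s eta = (fun w => expR (- (`|s| * (n%:R * eta))) *
    expR (s * \sum_(k < n) (f (Z k w) - Rinteg P f))).
  by apply/funext => w; rewrite /hexp -expRD addrC.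
have mS : measurable_fun setT (fun w => expR (s * \sum_(k < n) (f (Z k w) - Rinteg P f))).
  have := @measurable_hexp n f s 0 mf; rewrite /hexp.
  by under eq_fun do rewrite !mulr0 subr0.
have iS : Pr.-integrable setT (EFin \o (fun w => expR (s * \sum_(k < n) (f (Z k w) - Rinteg P f)))).
  apply: (@rintegrable_prob _ _ _ Pr _ (expR (`|s| * (n%:R * 2)))) => // w.
  by have := @hexp_le n f s 0 w mf f1 (lexx _); rewrite /hexp !mulr0 subr0.
rewrite RintegZ//.
have s4 : `|s| <= 1 / 4 by rewrite se; lra.
apply: (@le_trans _ _ (expR (- (`|s| * (n%:R * eta))) * expR (8 * s ^+ 2 * n%:R))).
  by apply: ler_wpM2l; [exact: expR_ge0|exact: (hoeffding iid)].
rewrite -expRD ler_expR -[s ^+ 2]real_normK ?num_real// se.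
by rewrite le_eqVlt; apply/orP; left; apply/eqP; field.
Qed.

Lemma hexp_lt1 n f s eta w : (0 < n)%N -> 0 < s -> hexp n f s eta w < 1 -> hexp n f (- s) eta w < 1 ->
  `|n%:R^-1 * \sum_(k < n) f (Z k w) - Rinteg P f| <= eta.
Proof.
move=> n0 s0; have nn0 : 0 < n%:R :> R by rewrite ltr0n.
rewrite /hexp !expR_lt1 normrN gtr0_norm// mulNr.
have -> : \sum_(k < n) (f (Z k w) - Rinteg P f) = n%:R * (n%:R^-1 * \sum_(k < n) f (Z k w) - Rinteg P f).
  by rewrite sumrB sumr_const card_ord mulrBr mulrA mulfV ?gt_eqF// mul1r mulr_natl.
set x := _ - Rinteg P f => h1 h2.
have {}h1 : s * n%:R * (x - eta) < 0 by lra.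
have {}h2 : s * n%:R * (- x - eta) < 0 by lra.
have sn : 0 < s * n%:R by rewrite mulr_gt0.
rewrite pmulr_rlt0// in h1; rewrite pmulr_rlt0// in h2.
by rewrite ler_norml; apply/andP; split; lra.
Qed.

(** A majorant of the increment of [eiu (u * x)] when [u] moves by at most [1 / n]. It is bounded by
    2, so its mean under [P] exists and tends to 0 by dominated convergence. *)
Definition modD n (x : R) : R := Num.min 2 (`|x| / n%:R).

Lemma modD_ge0 n x : 0 <= modD n x.
Proof. by rewrite le_min; apply/andP; split => //; rewrite divr_ge0. Qed.
Lemma modD_le2 n x : `|modD n x| <= 2.
Proof. by rewrite ger0_norm ?modD_ge0// ge_min lexx. Qed.
Lemma measurable_modD n : measurable_fun setT (modD n).
Proof.
by apply: measurable_minr => //; apply: measurable_funM.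
Qed.
Lemma Rinteg_modD_cvg : (fun n => Rinteg P (modD n)) @ \oo --> (0:R).
Proof.
rewrite -[X in _ --> X](Rinteg0 P).
apply: (proj2 (@Rinteg_dct R _ _ P modD (fun=> 0) (fun=> 2) measurable_modD modD_le2 _ _)).
  exact: finite_measure_integrable_cst.
move=> x; apply: (@cvg0_le _ _ (fun n => `|x| * n%:R^-1)).
  by apply: nearW => n; rewrite ger0_norm ?modD_ge0// ge_min lexx orbT.
by rewrite -[X in _ --> X](mulr0 `|x|); apply: cvgM; [exact: cvg_cst|exact: cvg_invn].
Qed.

Definition empD n w : R := n%:R^-1 * \sum_(k < n) modD n (Z k w).

Lemma empD_ge0 n w : 0 <= empD n w.
Proof. by rewrite mulr_ge0// sumr_ge0// => k _; exact: modD_ge0. Qed.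
Let iempk n k : Pr.-integrable setT (EFin \o (fun w => modD n (Z k w))).
Proof.
apply: (@rintegrable_prob _ _ _ Pr _ 2) => [|w]; last exact: modD_le2.
by apply: (measurable_compZ iid); exact: measurable_modD.
Qed.
Let rintegrable_sum_modD n (m : nat) : Pr.-integrable setT (EFin \o (fun w => \sum_(k < m) modD n (Z k w))) /\
  Rinteg Pr (fun w => \sum_(k < m) modD n (Z k w)) = m%:R * Rinteg P (modD n).
Proof.
elim: m => [|m [IH1 IH2]].
  have -> : (fun w => \sum_(k < 0) modD n (Z k w)) = (fun=> 0) by apply/funext => w; rewrite big_ord0.
  by rewrite mul0r Rinteg0; split => //; exact: rintegrable0.
have -> : (fun w => \sum_(k < m.+1) modD n (Z k w)) = (fun w => \sum_(k < m) modD n (Z k w) + modD n (Z m w)).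
  by apply/funext => w; rewrite big_ord_recr.
split; first exact: rintegrableD.
rewrite RintegD// IH2 (Rinteg_law iid _ (@measurable_modD n) (@modD_le2 n)).
by rewrite -natr1 mulrDl mul1r.
Qed.
Lemma rintegrable_empD n : Pr.-integrable setT (EFin \o empD n).
Proof. by apply: rintegrableZ; exact: (rintegrable_sum_modD n n).1. Qed.
Lemma Rinteg_empD n : (0 < n)%N -> Rinteg Pr (empD n) = Rinteg P (modD n).
Proof.
move=> n0; rewrite RintegZ; last exact: (rintegrable_sum_modD n n).1.
by rewrite (rintegrable_sum_modD n n).2 mulrA mulVf ?mul1r// pnatr_eq0 -lt0n.
Qed.

Lemma phin_mod n w u v : (0 < n)%N -> `|u - v| <= n%:R^-1 ->
  cabs (phin Z n w u - phin Z n w v) <= empD n w.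
Proof.
move=> n0 uv; rewrite /phin -mulrBr cabsM cabsC ger0_norm// ler_wpM2l//.
rewrite -sumrB; apply: (le_trans (cabs_sum _ _ _)); apply: ler_sum => k _.
apply: (le_trans (eiu_lipschitz _ _)); rewrite le_min !ge_min lexx /=.
apply/orP; right; rewrite -mulrBl normrM mulrC; exact: ler_wpM2l.
Qed.
Lemma mfourier_mod n u v : (0 < n)%N -> `|u - v| <= n%:R^-1 ->
  cabs (mfourier P u - mfourier P v) <= Rinteg P (modD n).
Proof.
move=> n0 uv.
have me t : cmeasurable (fun x : R => eiu (t * x)) by apply: cmeasurable_eiu; exact: measurable_funM.
have ie (t : R) : cintegrable P (fun x : R => eiu (t * x)).
  by apply: (@cintegrable_prob _ _ _ P _ 1); [exact: me|move=> x; rewrite cabs_eiu].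
rewrite /mfourier /charfun -cintB//; apply: cabs_cint_bound.
- by apply: cmeasurableB; exact: me.
- move=> x; apply: (le_trans (eiu_lipschitz _ _)); rewrite le_min !ge_min lexx /=.
  apply/orP; right; rewrite -mulrBl normrM mulrC; exact: ler_wpM2l.
- by apply: (@rintegrable_prob _ _ _ P _ 2); [exact: measurable_modD|exact: modD_le2].
Qed.

Lemma phin_parts n w u eta : 
  `|n%:R^-1 * \sum_(k < n) cos (u * Z k w) - Rinteg P (fun x => cos (u * x))| <= eta ->
  `|n%:R^-1 * \sum_(k < n) sin (u * Z k w) - Rinteg P (fun x => sin (u * x))| <= eta ->
  cabs (phin Z n w u - mfourier P u) <= 2 * eta.
Proof.
move=> h1 h2; apply: (le_trans (cabs_le_parts _)).
by rewrite creB cimB /phin creZ cimZ cre_sum cim_sum mulr_natl mulr2n lerD.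
Qed.

Section Grid.
Variables (n : nat) (A e0 : R).
Hypotheses (n0 : (0 < n)%N) (A0 : 0 < A) (e0p : 0 < e0) (e1 : e0 <= 1).
(** The grid starts at [- A] with mesh [1 / n], and the indices up to [N] cover the window. The
    tolerance [eta] is a sixth of [e0] because cosine and sine together must use up a third. *)
Let N := Num.truncn (2 * A * n%:R).
Let ug (j : nat) : R := - A + j%:R / n%:R.
Let eta := e0 / 6.
Let s := eta / 16.
Let hpair f w := hexp n f s eta w + hexp n f (- s) eta w.

(* [gridV w < 1] forces every nonnegative summand below 1, so that Markov's inequality for the single
   variable [gridV] controls all the grid points at once. *)
Definition gridV w : R := 3 / e0 * empD n w +
  \sum_(j < N.+1) (hpair (fun x => cos (ug j * x)) w + hpair (fun x => sin (ug j * x)) w).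

Let mcos j : measurable_fun setT (fun x : R => cos (ug j * x)).
Proof. by apply: measurable_cos_comp; exact: measurable_funM. Qed.
Let msin j : measurable_fun setT (fun x : R => sin (ug j * x)).
Proof. by apply: measurable_sin_comp; exact: measurable_funM. Qed.
Let eta0 : 0 < eta. Proof. by rewrite divr_gt0. Qed.
Let s0 : 0 < s. Proof. by rewrite divr_gt0. Qed.

Let hpair_ge0 f w : 0 <= hpair f w. Proof. by rewrite addr_ge0// expR_ge0. Qed.
Let ihexp (f : R -> R) r : measurable_fun setT f -> (forall x : R, `|f x| <= 1) ->
  Pr.-integrable setT (EFin \o hexp n f r eta).
Proof.
move=> mf f1; apply: (@rintegrable_prob _ _ _ Pr _ (expR (`|r| * (n%:R * 2)))).
  exact: measurable_hexp.
by move=> w; apply: hexp_le => //; exact: ltW.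
Qed.
Let ihpair (f : R -> R) : measurable_fun setT f -> (forall x : R, `|f x| <= 1) ->
  Pr.-integrable setT (EFin \o hpair f) /\ Rinteg Pr (hpair f) <= 2 * expR (- (n%:R * (eta ^+ 2 / 32))).
Proof.
move=> mf f1; split; first by apply: rintegrableD; exact: ihexp.
rewrite RintegD; [|exact: ihexp|exact: ihexp].
have e4 : 0 <= eta <= 4 by apply/andP; split; [exact: ltW|exact: sixth_le4].
have sE : `|s| = eta / 16 by rewrite gtr0_norm.
have sE' : `|- s| = eta / 16 by rewrite normrN.
by rewrite mulr_natl mulr2n; apply: lerD; [exact: hexp_mean mf f1 e4 sE|exact: hexp_mean mf f1 e4 sE'].
Qed.

Lemma gridV_ge0 w : 0 <= gridV w.
Proof.
rewrite addr_ge0//; first by rewrite mulr_ge0 ?empD_ge0 ?divr_ge0// ltW.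
by rewrite sumr_ge0// => j _; rewrite addr_ge0.
Qed.

(** Each grid point contributes four exponential variables, cosine and sine with both signs, and
    there are at most [2 A n + 1] points. *)
Lemma gridV_mean : Pr.-integrable setT (EFin \o gridV) /\ Rinteg Pr gridV <=
  3 / e0 * Rinteg P (modD n) + (2 * A * n%:R + 1) * (4 * expR (- (n%:R * (eta ^+ 2 / 32)))).
Proof.
have i0 : Pr.-integrable setT (EFin \o (fun w => 3 / e0 * empD n w)).
  by apply: rintegrableZ; exact: rintegrable_empD.
have H m : Pr.-integrable setT (EFin \o (fun w => \sum_(j < m)
     (hpair (fun x => cos (ug j * x)) w + hpair (fun x => sin (ug j * x)) w))) /\
   Rinteg Pr (fun w => \sum_(j < m)
     (hpair (fun x => cos (ug j * x)) w + hpair (fun x => sin (ug j * x)) w)) <=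
   m%:R * (4 * expR (- (n%:R * (eta ^+ 2 / 32)))).
  apply: (@Rinteg_sum_le _ _ _ Pr (fun j w => hpair (fun x => cos (ug j * x)) w + hpair (fun x => sin (ug j * x)) w)) => j0.
  have [c1 c2] := ihpair (mcos j0) (fun x => norm_cos_le1 _).
  have [d1 d2] := ihpair (msin j0) (fun x => norm_sin_le1 _).
  split; first exact: rintegrableD c1 d1.
  by rewrite (RintegD c1 d1); apply: (le_trans (lerD c2 d2)); rewrite -mulrDl -natrD.
have [i1 E1] := H N.+1.
split; first exact: rintegrableD.
rewrite RintegD// RintegZ; last exact: rintegrable_empD.
rewrite Rinteg_empD//; apply: lerD => //; apply: (le_trans E1).
apply: ler_wpM2r; first by rewrite mulr_ge0// expR_ge0.
rewrite -natr1 lerD2r.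
have y0 : 0 <= 2 * A * n%:R by rewrite !mulr_ge0// ltW.
by have /andP[] := truncn_itv y0.
Qed.

(** The grid point just left of [u] is within [1 / n] of it. The weight [3 / e0] in [gridV] turns
    the bound 1 into [empD <= e0 / 3], and the four exponentials below 1 control the deviation at
    that point. *)
Lemma gridV_lt1 w u : Rinteg P (modD n) <= e0 / 3 -> gridV w < 1 -> `|u| <= A ->
  cabs (phin Z n w u - mfourier P u) <= e0.
Proof.
move=> d3 V1 uA; have nn0 : 0 < n%:R :> R by rewrite ltr0n.
have /andP[u1 u2] : - A <= u <= A by rewrite -ler_norml.
have y0 : 0 <= (u + A) * n%:R by rewrite mulr_ge0//; lra.
pose j := Num.truncn ((u + A) * n%:R).
have /andP[j1 j2] := truncn_itv y0; rewrite -/j in j1 j2.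
have jN : (j < N.+1)%N.
  rewrite ltnS /N /j; apply: le_truncn; rewrite ler_pM2r//; lra.
have uj : `|u - ug j| <= n%:R^-1.
  have -> : u - ug j = ((u + A) * n%:R - j%:R) * n%:R^-1.
    by rewrite /ug; field; rewrite gt_eqF.
  rewrite normrM [X in _ * X]ger0_norm// ler_piMl// ger0_norm; first by rewrite -natr1 in j2; lra.
  by rewrite subr_ge0.
have S0 : 0 <= \sum_(j < N.+1) (hpair (fun x => cos (ug j * x)) w + hpair (fun x => sin (ug j * x)) w).
  by rewrite sumr_ge0// => i _; rewrite addr_ge0.
have D0 : 0 <= 3 / e0 * empD n w by rewrite mulr_ge0 ?empD_ge0 ?divr_ge0// ltW.
have D3 : empD n w <= e0 / 3.
  have : 3 / e0 * empD n w <= 1 by move: V1; rewrite /gridV; lra.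
  by rewrite -[3 / e0]invrK invf_div ler_pdivrMl ?mulr1// divr_gt0.
have Sj : hpair (fun x => cos (ug j * x)) w + hpair (fun x => sin (ug j * x)) w < 1.
  apply: le_lt_trans V1; rewrite /gridV (bigD1 (Ordinal jN))//=.
  apply: le_add_mid => //; by apply: sumr_ge0 => i _; rewrite addr_ge0.
have [q1 q2 q3 q4] := lt1_summands (expR_ge0 _) (expR_ge0 _) (expR_ge0 _) (expR_ge0 _) Sj.
have hj : cabs (phin Z n w (ug j) - mfourier P (ug j)) <= 2 * eta.
  by apply: phin_parts; [exact: (hexp_lt1 n0 s0 q1 q2)|exact: (hexp_lt1 n0 s0 q3 q4)].
have -> : phin Z n w u - mfourier P u = (phin Z n w u - phin Z n w (ug j)) +
   ((phin Z n w (ug j) - mfourier P (ug j)) - (mfourier P u - mfourier P (ug j))) by ring.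
apply: (le_trans (cabsD _ _)).
apply: (third_sum (le_trans (phin_mod w n0 uj) D3) (cabsB _ _) hj).
exact: le_trans (mfourier_mod n0 uj) d3.
Qed.
End Grid.

Lemma phin_uniform (A : nat -> R) (e0 : R) : 0 < e0 -> e0 <= 1 -> (forall n, 0 < A n) ->
  (forall c, 0 < c -> \forall n \near \oo, ln (A n) <= c * n%:R) ->
  exists B : nat -> set Omega, [/\ forall n, measurable (B n),
    (fun n => fine (Pr (B n))) @ \oo --> (1 : R) &
    forall n w, B n w -> (0 < n)%N /\ forall u, `|u| <= A n -> cabs (phin Z n w u - mfourier P u) <= e0].
Proof.
move=> e0p e1 A0 Ac.
(* For the finitely many [n] that are zero or have a modulus not yet small, the event is empty: the
   pointwise claim holds for all [n] and the limit of the probabilities is not affected. *)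
pose good n := (0 < n)%N && (Rinteg P (modD n) <= e0 / 3).
pose B n : set Omega := if good n then [set w | gridV n (A n) e0 w < 1] else set0.
have mB n : measurable (B n).
  rewrite /B; case: ifP => [/andP[n0 _]|_]; last exact: measurable0.
  have [iV _] := gridV_mean n0 (A0 n) e0p e1.
  rewrite -[X in measurable X]setTI.
  by apply: (measurable_fun_ltr (f := gridV n (A n) e0) (g := cst 1)) => //; exact: rintegrable_meas iV.
exists B; split => //; last first.
  move=> n w; rewrite /B; case: ifP => // /andP[n0 d3] V1; split=> // u uA.
  by apply: (@gridV_lt1 n (A n) e0).
pose c := (e0 / 6) ^+ 2 / 32.
have c0 : 0 < c by rewrite divr_gt0// exprn_gt0// divr_gt0.
have d_cvg := Rinteg_modD_cvg.
have d_near : \forall n \near \oo, Rinteg P (modD n) <= e0 / 3.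
  have e3 : 0 < e0 / 3 by rewrite divr_gt0.
  move/cvgrPdist_le : d_cvg => /(_ _ e3); apply: filterS => n.
  by rewrite sub0r normrN; apply: le_trans; exact: ler_norm.
have n_near : \forall n \near \oo, (0 < n)%N by exists 1%N.
have c2 : 0 < c / 2 by rewrite divr_gt0.
have L := Ac _ c2.
(* The second term bounds [12 n * exp (- c n / 2)] by means of [exp (c n / 2) >= (c n / 4)^2]; this
   is where 192 comes from. *)
have key : (fun n => 3 / e0 * Rinteg P (modD n) + 192 / c ^+ 2 * n%:R^-1) @ \oo --> (0 : R).
  rewrite -[X in _ --> X]addr0; apply: cvgD.
    by rewrite -[X in _ --> X](mulr0 (3 / e0)); apply: cvgM => //; exact: cvg_cst.
  rewrite -[X in _ --> X](mulr0 (192 / c ^+ 2)); apply: cvgM; first exact: cvg_cst.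
  exact: cvg_invn.
apply/subr_cvg0; apply: cvg0_le key.
near=> n.
have n0 : (0 < n)%N by near: n.
have nn1 : 1 <= n%:R :> R by rewrite ler1n.
have d3 : Rinteg P (modD n) <= e0 / 3 by near: n.
have [iV EV] := gridV_mean n0 (A0 n) e0p e1.
have BE : B n = [set w | gridV n (A n) e0 w < 1] by rewrite /B /good n0 d3.
have iB : Pr.-integrable setT (EFin \o (\1_(B n) : Omega -> R)).
  apply: (@rintegrable_prob _ _ _ Pr _ 1); first exact: measurable_indic.
  by move=> w; rewrite indicE; case: (_ \in _); rewrite ?normr1 ?normr0.
have i1 : Pr.-integrable setT (EFin \o (fun w => 1 - \1_(B n) w)).
  by apply: rintegrableB => //; exact: finite_measure_integrable_cst.
have h1 : 1 - fine (Pr (B n)) = Rinteg Pr (fun w => 1 - \1_(B n) w).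
  rewrite RintegB//; last exact: finite_measure_integrable_cst.
  by rewrite Rinteg_prob_cst -(Rinteg_indic Pr (mB n)).
have h2 : 0 <= 1 - fine (Pr (B n)).
  by rewrite h1; apply: Rinteg_ge0 => w; rewrite indicE; case: (_ \in _); rewrite ?subrr ?subr0.
have h3 : 1 - fine (Pr (B n)) <= Rinteg Pr (gridV n (A n) e0).
  rewrite h1; apply: le_Rinteg => // w; rewrite indicE BE; case: (boolP (_ \in _)) => [_|].
    by rewrite subrr; exact: gridV_ge0.
  by rewrite notin_setE /= => /negP; rewrite -leNgt subr0.
rewrite distrC ger0_norm//; apply: (le_trans h3); apply: (le_trans EV); rewrite lerD2l.
(* With [y = c n / 2] the number of grid points is at most [3 n * exp y], while each point has mean
   at most [4 * exp (- 2 y)]; half of the exponential rate survives. *)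
have LA : ln (A n) <= c / 2 * n%:R by near: n.
set y := c / 2 * n%:R in LA.
have AE : A n <= expR y by rewrite -[A n]lnK ?posrE// ler_expR.
have y0 : 0 < y by rewrite mulr_gt0// (lt_le_trans ltr01).
have -> : - (n%:R * ((e0 / 6) ^+ 2 / 32)) = - y - y by rewrite /y /c; field.
rewrite expRD !expRN.
set E := expR y in AE *.
have E1 : 1 <= E by rewrite -[leLHS]expR0 ler_expR ltW.
have E0 : 0 < E by exact: expR_gt0.
have E4 : (y / 2) ^+ 2 <= E.
  have -> : E = expR (y / 2) ^+ 2 by rewrite -expRM_natl mulrC divfK.
  have h := expR_ge1Dx (y / 2); rewrite lerXn2r ?nnegrE ?expR_ge0//; lra.
have T1 : (2 * A n * n%:R + 1) <= 3 * E * n%:R.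
  have : A n * n%:R <= E * n%:R by rewrite ler_wpM2r.
  have : 1 <= E * n%:R by rewrite mulr_ege1.
  lra.
apply: (@le_trans _ _ (3 * E * n%:R * (4 * (E^-1 * E^-1)))).
  by apply: ler_wpM2r => //; rewrite !mulr_ge0// invr_ge0 ltW.
have -> : 3 * E * n%:R * (4 * (E^-1 * E^-1)) = 12 * n%:R * E^-1 by field; rewrite gt_eqF.
have -> : 192 / c ^+ 2 / n%:R = 12 * n%:R * ((y / 2) ^+ 2)^-1.
  by rewrite /y; field; rewrite !gt_eqF// (lt_le_trans ltr01).
apply: ler_wpM2l; first by rewrite mulr_ge0.
by rewrite lef_pV2// posrE// exprn_gt0// divr_gt0.
Unshelve. all: by end_near. Qed.
End Events.

(** The exponent [(1 + 2 delta)^-1] is at most 1, so for [n >= 1] the denominator of the rate is at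
    most [n]. *)
Lemma log_rate (R : realType) (h : nat -> R) (delta : R) : 0 < delta -> (forall n, 0 < h n) ->
  (fun n => ln ((h n)^-1) / powR n%:R (1 + 2 * delta)^-1) @ \oo --> (0:R) ->
  forall c, 0 < c -> \forall n \near \oo, ln ((h n)^-1) <= c * n%:R.
Proof.
move=> d0 h0 L c c0; move/cvgrPdist_le : L => /(_ _ c0); near_simpl => L.
near=> n.
have n0 : (0 < n)%N by near: n; exists 1%N.
have n1 : 1 <= n%:R :> R by rewrite ler1n.
have p0 : 0 < n%:R `^ (1 + 2 * delta)^-1 :> R by rewrite powR_gt0// ltr0n.
have : `|0 - ln ((h n)^-1) / n%:R `^ (1 + 2 * delta)^-1| <= c by near: n.
rewrite sub0r normrN => /(le_trans (ler_norm _)); rewrite ler_pdivrMr// => /le_trans; apply.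
apply: ler_wpM2l; first exact: ltW.
rewrite -[leRHS](powRr1 (ler0n _ _)); apply: ler_powR => //.
rewrite invf_le1; lra.
Unshelve. all: by end_near. Qed.

(** * Gaussian smoothing of test functions *)

Section Smoothing.
Context {R : realType}.
Local Notation leb := (@leb R).
Local Notation "'pi2V'" := (((pi *+ 2)^-1)%:C : R[i]).

(** Compactness gives a common radius on [[- (A + 1), A + 1]]. A radius at most 1 ensures that, for
    a centre outside this interval, both points lie outside the support. *)
Lemma unif_cont_compact_supp (f : R -> R) A : continuous f -> (forall x, A < `|x| -> f x = 0) ->
  forall e, 0 < e -> exists2 r : R, 0 < r & forall x y, `|y - x| <= r -> `|f y - f x| <= e.
Proof.
move=> cf fA e e0.
have e2 : 0 < e / 2 by rewrite divr_gt0.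
have /compact_near_coveringP/near_covering_withinP H := @segment_compact R (- (A + 1)) (A + 1).
have := H _ (0 : R)^'+ (fun r x => forall y, `|y - x| <= r -> `|f y - f x| <= e) _ _.
case.
  move=> x _.
  have := cf x; move/cvgrPdist_le => /(_ _ e2) [r /= r0 fr].
  exists (ball x (r / 2), [set t | 0 < t < r / 2]) => /=.
    split; first by apply: nbhsx_ballx; rewrite divr_gt0.
    exists (r / 2) => /=; first by rewrite divr_gt0.
    by move=> t /= ; rewrite sub0r normrN => t1 t0; rewrite t0 (le_lt_trans (ler_norm _) t1).
  move=> [x' t] /= [xx' /andP[t0 tr]] _ y yx'.
  have h1 : `|f x - f x'| <= e / 2.
    apply: fr => /=; move: xx'; rewrite /ball/= => /lt_le_trans; apply.
    by rewrite ler_pdivrMr// ler_pMr// ler1n.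
  have h2 : `|f x - f y| <= e / 2.
    apply: fr => /=; move: xx'; rewrite /ball/= => xx'.
    have -> : x - y = (x - x') - (y - x') by ring.
    by apply: (le_lt_trans (ler_normB _ _)); lra.
  have -> : f y - f x' = (f x - f x') - (f x - f y) by ring.
  by apply: (le_trans (ler_normB _ _)); lra.
move=> r0 /= r0p Hr.
pose r := Num.min 1 (r0 / 2).
have r00 : 0 < r by rewrite lt_min ltr01 divr_gt0.
have rr0 : r < r0.
  by rewrite gt_min; apply/orP; right; rewrite ltr_pdivrMr// ltr_pMr// ltr1n.
exists r => // x y yx.
have [xA|xA] := leP `|x| (A + 1).
  apply: (Hr r) => //; first by rewrite /ball_/= sub0r normrN gtr0_norm.
  by rewrite /= in_itv/= -ler_norml.
have r1 : r <= 1 by rewrite ge_min lexx.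
have yA : A < `|y|.
  have : `|x| <= `|y| + `|y - x|.
    by rewrite -{1}[x](subKr y); apply: (le_trans (ler_normB _ _)).
  lra.
rewrite !fA ?subrr ?normr0 ?ltW//; lra.
Qed.

Lemma measurable_gdens_sub (s x : R) : measurable_fun setT (fun y : R => gdens s (x - y)).
Proof. by apply: (measurableT_comp (measurable_gdens s)); exact: measurable_funB. Qed.

Section Kernel.
Variables (f : R -> R) (C s : R).
Hypotheses (mf : measurable_fun setT f) (fC : forall x, `|f x| <= C) (s0 : 0 < s).

Definition smooth x := Rinteg leb (fun y => f y * gdens s (x - y)).

Lemma smoothE x : smooth x = Rinteg leb (fun t => f (x - s * t) * (gmass^-1 * gexp t)).
Proof.
have sn0 : - s != 0 by rewrite oppr_eq0 gt_eqF.
have ig : leb.-integrable setT (EFin \o (fun y => f y * gdens s (x - y))).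
  have := rintegrable_affine x (_ : -1 != 0) (rintegrable_gdens s0).
  rewrite oppr_eq0 oner_eq0 => /(_ isT); under eq_fun do rewrite mulN1r addrC.
  move=> /(rintegrableZ C); apply: rintegrable_le.
    by apply: measurable_funM; [exact: mf|exact: measurable_gdens_sub].
  by move=> y; rewrite normrM [X in _ * X]ger0_norm ?gdens_ge0// ler_wpM2r ?gdens_ge0.
rewrite /smooth (Rinteg_affine x sn0 ig) normrN gtr0_norm// -RintegZ; last first.
  exact: (rintegrable_affine x sn0 ig).
congr Rinteg; apply/funext => t.
have -> : - s * t + x = x - s * t by ring.
rewrite /gdens; have -> : s^-1 * (x - (x - s * t)) = t by field; rewrite gt_eqF.
by field; rewrite !gt_eqF// gmass_gt0.
Qed.

Lemma rintegrable_smooth_kernel x :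
  leb.-integrable setT (EFin \o (fun t => f (x - s * t) * (gmass^-1 * gexp t))).
Proof.
apply: rintegrable_le (rintegrableZ (C * gmass^-1) (@rintegrable_gexp R)).
  apply: measurable_funM; first by apply: (measurableT_comp mf); apply: measurable_funB => //; exact: measurable_mull.
  by apply: measurable_funM => //; exact: measurable_gexp.
move=> t; rewrite normrM -mulrA ler_pM// ger0_norm// mulr_ge0 ?gexp_ge0// invr_ge0 ltW// gmass_gt0//.
Qed.

(** Where the shift [s |t|] is at most [r], uniform continuity gives [e]; elsewhere [2 C] is at most
    [2 C / r * (s |t|)]. Hence the first absolute moment of the Gaussian in the bound. *)
Lemma smooth_error (e r : R) x : 0 <= e -> 0 < r -> (forall x y, `|y - x| <= r -> `|f y - f x| <= e) ->
  `|smooth x - f x| <= e + 2 * C / r * (s * (gmass^-1 * Rinteg leb (fun t => `|t| * gexp t))).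
Proof.
move=> e0 r0 fr; have C0 : 0 <= C by exact: le_trans (fC 0).
have gm0 := @gmass_gt0 R.
have ip : leb.-integrable setT (EFin \o (fun t => f x * (gmass^-1 * gexp t))).
  by do 2! apply: rintegrableZ; exact: rintegrable_gexp.
have ig1 : leb.-integrable setT (EFin \o (fun t : R => (e * gmass^-1) * gexp t)).
  by apply: rintegrableZ; exact: rintegrable_gexp.
have ig2 : leb.-integrable setT (EFin \o (fun t : R => (2 * C / r * (s * gmass^-1)) * (`|t| * gexp t))).
  by apply: rintegrableZ; exact: rintegrable_xgexp.
have fE : f x = Rinteg leb (fun t => f x * (gmass^-1 * gexp t)).
  rewrite RintegZ; last by apply: rintegrableZ; exact: rintegrable_gexp.
  rewrite RintegZ; last exact: rintegrable_gexp.
  by rewrite Rinteg_gexp mulVf ?mulr1// gt_eqF.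
rewrite smoothE [X in _ - X]fE -RintegB//; last exact: rintegrable_smooth_kernel.
have -> : e + 2 * C / r * (s * (gmass^-1 * Rinteg leb (fun t => `|t| * gexp t))) =
  Rinteg leb (fun t : R => (e * gmass^-1) * gexp t + (2 * C / r * (s * gmass^-1)) * (`|t| * gexp t)).
  rewrite RintegD// RintegZ ?Rinteg_gexp; last exact: rintegrable_gexp.
  rewrite RintegZ; last exact: rintegrable_xgexp.
  by rewrite divfK ?gt_eqF// !mulrA.
have id := rintegrableB (rintegrable_smooth_kernel x) ip.
apply: (le_trans (normr_Rinteg id)); apply: le_Rinteg.
- exact: rintegrable_norm.
- exact: rintegrableD.
move=> t; rewrite -mulrBl normrM.
have k0 : 0 <= gmass^-1 * gexp t by rewrite mulr_ge0 ?gexp_ge0// invr_ge0 ltW.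
rewrite [X in _ * X]ger0_norm//.
have -> : e / gmass * gexp t + 2 * C / r * (s / gmass) * (`|t| * gexp t) =
  (e + 2 * C / r * (s * `|t|)) * (gmass^-1 * gexp t) by ring.
apply: ler_wpM2r => //.
have D : `|x - s * t - x| = s * `|t|.
  by rewrite addrAC subrr add0r normrN normrM gtr0_norm.
have T0 : 0 <= s * `|t| by rewrite mulr_ge0// ltW.
have [tr|tr] := leP (s * `|t|) r.
  apply: (le_trans (fr _ _ _)); first by rewrite D.
  by rewrite lerDl mulr_ge0// divr_ge0 ?mulr_ge0// ltW.
apply: (@le_trans _ _ (2 * C)).
  by apply: (le_trans (ler_normB _ _)); have := fC x; have := fC (x - s * t); lra.
rewrite -[leLHS]add0r lerD// -mulrA ler_peMr ?mulr_ge0//.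
by rewrite ler_pdivlMl// mulr1 ltW.
Qed.
End Kernel.

Lemma pi2_neq0 : (pi *+ 2 : R) != 0.
Proof. by rewrite gt_eqF// mulrn_wgt0// pi_gt0. Qed.

Lemma pi2K (z : R[i]) : z = pi2V * ((pi *+ 2)%:C * z).
Proof. by rewrite mulrA -realcM mulVf ?pi2_neq0// mul1r. Qed.
Lemma gdens_le (s y : R) : 0 < s -> `|gdens s y| <= (s * gmass)^-1.
Proof.
move=> s0; rewrite ger0_norm ?gdens_ge0// /gdens.
by rewrite ler_piMr ?gexp_le1// invr_ge0 mulr_ge0 ?ltW// gmass_gt0.
Qed.
Lemma rintegrable_smoothing (f : R -> R) s x : leb.-integrable setT (EFin \o f) -> 0 < s ->
  leb.-integrable setT (EFin \o (fun y => f y * gdens s (x - y))).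
Proof.
move=> if_ s0; apply: (rintegrable_le _ _ (rintegrableZ (s * gmass)^-1 (rintegrable_norm if_))).
  by apply: measurable_funM; [exact: rintegrable_meas if_|exact: measurable_gdens_sub].
by move=> y; rewrite normrM mulrC ler_wpM2r// gdens_le.
Qed.

Lemma smooth_fourier (f : R -> R) s x : leb.-integrable setT (EFin \o f) -> 0 < s ->
  (smooth f s x)%:C = pi2V * cint leb (fun u => eiu (u * x) * ((gexp (s * u))%:C * fourier f (- u))).
Proof.
move=> if_ s0; have mf := rintegrable_meas if_; have igs := gexp_integrable_scale s0.
have mgs := measurable_gexp_scale s.
pose F (z : R * R) : R[i] := (f z.1)%:C * (eiu (z.2 * (x - z.1)) * (gexp (s * z.2))%:C).
have mF : cmeasurable F.
  apply: cmeasurableM; first by apply: (cmeasurable_fst (f := fun x => (f x)%:C)); exact: cmeasurable_real.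
  apply: cmeasurableM; last by apply: (cmeasurable_snd (f := fun u => (gexp (s * u))%:C)); exact: cmeasurable_real.
  apply: cmeasurable_eiu; apply: measurable_funM; first exact: measurable_snd.
  apply: measurable_funB => //; exact: measurable_fst.
have FB y u : cabs (F (y, u)) <= `|f y| * gexp (s * u).
  by rewrite /F /= !cabsM !cabsC cabs_eiu mul1r [`|gexp _|]ger0_norm ?gexp_ge0.
have FU := @cint_fubini R _ _ _ _ leb leb F (fun y => `|f y|) (fun u => gexp (s * u)) mF FB (rintegrable_norm if_) igs.
have iu y : cintegrable leb (fun u => eiu (u * (x - y)) * (gexp (s * u))%:C).
  by apply: cintegrable_eiuM; [exact: measurable_funM|exact: cintegrable_real].
have E1 : cint leb (fun y => cint leb (fun u => F (y, u))) = (pi *+ 2)%:C * (smooth f s x)%:C.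
  rewrite -cint_real -cintZ.
    apply: eq_cint => y; apply: (etrans (cintZ (f y)%:C (iu y))).
    rewrite (cint_eiu_gexp_scale (x - y) s0).
    rewrite (realcM (pi *+ 2) (gdens s (x - y))).
    rewrite (realcM (f y) (gdens s (x - y))).
    exact: mulrCA.
  apply: cintegrable_real.
  exact: rintegrable_smoothing.
have E2 : cint leb (fun u => cint leb (fun y => F (y, u))) =
   cint leb (fun u => eiu (u * x) * ((gexp (s * u))%:C * fourier f (- u))).
  apply: eq_cint => u; rewrite mulrA /fourier -cintZ.
    apply: eq_cint => y; rewrite /F/= mulrBr eiuB -mulNr; ring.
  by apply: cintegrable_eiuM; [exact: measurable_funM|exact: cintegrable_real].
apply: (etrans (pi2K _)); apply: (congr1 ( *%R _)); exact: etrans (etrans (esym E1) FU) E2.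
Qed.

Section Weighted.
Context d {T : measurableType d} (mu : {sigma_finite_measure set T -> \bar R}).
Variables (X W : T -> R).
Hypotheses (mX : measurable_fun setT X) (iW : mu.-integrable setT (EFin \o W)) (W0 : forall w, 0 <= W w).

(** The weight lets the same formulas serve the sample, with weight 1 under [Pr], and the normal
    limit, with its density as weight under Lebesgue measure. *)
Definition wcf u := cint mu (fun w => eiu (u * X w) * (W w)%:C).

Lemma smooth_wcf (f : R -> R) s : leb.-integrable setT (EFin \o f) -> 0 < s ->
  (Rinteg mu (fun w => smooth f s (X w) * W w))%:C =
  pi2V * cint leb (fun u => wcf u * ((gexp (s * u))%:C * fourier f (- u))).
Proof.
move=> if_ s0; have mf := rintegrable_meas if_; have igs := gexp_integrable_scale s0.
have mgs := measurable_gexp_scale s; have mW := rintegrable_meas iW.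
pose h u : R[i] := (gexp (s * u))%:C * fourier f (- u).
have mh : cmeasurable h.
  apply: cmeasurableM; first exact: cmeasurable_real.
  by apply: (cmeasurable_comp (cmeasurable_fourier mf)); exact: measurable_funN.
pose N := Rinteg leb (fun x => `|f x|).
have hN u : cabs (h u) <= N * gexp (s * u).
  rewrite cabsM cabsC [`|gexp _|]ger0_norm ?gexp_ge0// mulrC ler_wpM2r ?gexp_ge0//.
  exact: cabs_fourier.
pose F (z : T * R) : R[i] := (eiu (z.2 * X z.1) * (W z.1)%:C) * h z.2.
have mF : cmeasurable F.
  apply: cmeasurableM; last exact: cmeasurable_snd.
  apply: cmeasurableM; last by apply: (cmeasurable_fst (f := fun x => (W x)%:C)); exact: cmeasurable_real.
  by apply: cmeasurable_eiu; apply: measurable_funM; [exact: measurable_snd|exact: measurable_fst_comp].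
have FB w u : cabs (F (w, u)) <= W w * (N * gexp (s * u)).
  by rewrite /F cabsM cabsM cabs_eiu mul1r cabsC ger0_norm//; apply: ler_wpM2l => //; exact: hN.
have iN := rintegrableZ N igs.
have ih : cintegrable leb h by apply: (cintegrable_le _ _ iN); [exact: mh|exact: hN].
have := @cint_fubini R _ _ _ _ mu leb F W (fun u => N * gexp (s * u)) mF FB iW iN.
have iFw w : cintegrable leb (fun u => eiu (u * X w) * h u).
  by apply: cintegrable_eiuM => //; exact: measurable_funM.
have -> : cint leb (fun u => cint mu (fun w => F (w, u))) = cint leb (fun u => wcf u * h u).
  apply: eq_cint => u; rewrite /F/= cintZr//.
  by apply: (cintegrable_le _ _ iW) => [|w]; [apply: cmeasurableM; [apply: cmeasurable_eiu; exact: measurable_funM|exact: cmeasurable_real]|rewrite cabsM cabs_eiu mul1r cabsC ger0_norm].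
move=> <-; rewrite -cint_real -cintZ; last first.
  exact: (@cintegrable_inner R _ _ _ _ mu leb F W (fun u => N * gexp (s * u)) mF FB iW iN).
apply: eq_cint => w; rewrite realcM smooth_fourier// /F/= -/h.
transitivity (pi2V * cint leb (fun u => (W w)%:C * (eiu (u * X w) * h u))).
  by rewrite cintZ//; ring.
by congr (_ * _); apply: eq_cint => u; ring.
Qed.

Lemma Rinteg_weight_close (f g : R -> R) e C : measurable_fun setT f -> measurable_fun setT g ->
  (forall x, `|f x| <= C) -> (forall x, `|g x - f x| <= e) -> 
  mu.-integrable setT (EFin \o (fun w => f (X w) * W w)) /\
  `|Rinteg mu (fun w => g (X w) * W w) - Rinteg mu (fun w => f (X w) * W w)| <= e * Rinteg mu W.
Proof.
move=> mf mg fC fg; have mW := rintegrable_meas iW.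
have i1 : mu.-integrable setT (EFin \o (fun w => f (X w) * W w)).
  apply: (rintegrable_le _ _ (rintegrableZ C iW)).
    by apply: measurable_funM => //; exact: (measurableT_comp mf).
  by move=> w; rewrite normrM [`|W w|]ger0_norm// ler_wpM2r.
have id : mu.-integrable setT (EFin \o (fun w => (g (X w) - f (X w)) * W w)).
  apply: (rintegrable_le _ _ (rintegrableZ e iW)).
    apply: measurable_funM => //; apply: measurable_funB; first exact: (measurableT_comp mg).
    exact: (measurableT_comp mf).
  by move=> w; rewrite normrM [`|W w|]ger0_norm// ler_wpM2r.
split => //.
have i2 : mu.-integrable setT (EFin \o (fun w => g (X w) * W w)).
  by have := rintegrableD id i1; under eq_fun do rewrite -mulrDl subrK.
rewrite -RintegB//; under [X in Rinteg _ X]eq_fun do rewrite -mulrBl.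
apply: (le_trans (normr_Rinteg id)); rewrite -RintegZ//; apply: le_Rinteg.
- exact: rintegrable_norm.
- exact: rintegrableZ.
by move=> w; rewrite normrM [`|W w|]ger0_norm// ler_wpM2r.
Qed.
End Weighted.
End Smoothing.

Lemma continuous_maxr (R : realType) (f g : R -> R) : continuous f -> continuous g ->
  continuous (fun x => Num.max (f x) (g x)).
Proof.
move=> cf cg x; have -> : (fun x => Num.max (f x) (g x)) = (fun x => (f x + g x + `|f x - g x|) / 2).
  by apply/funext => y; exact: maxr_absE.
apply: cvgM; last exact: cvg_cst.
apply: cvgD; first by apply: cvgD; [exact: cf|exact: cg].
by apply: cvg_norm; apply: cvgB; [exact: cf|exact: cg].
Qed.

(** * The continuity theorem for a normal limit *)

Section LevyContinuity.
Context {R : realType} d {Omega : measurableType d} (Pr : probability Omega R).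
Local Notation leb := (@leb R).
Variables (Tn : nat -> Omega -> R) (v : R).
Hypotheses (mT : forall n, measurable_fun setT (Tn n)) (v0 : 0 <= v).
Hypothesis cfT : forall t, ccvg (fun n => charfun Pr (Tn n) t) (expR (- (v * t ^+ 2 / 2)))%:C.

Let X x : R := Num.sqrt v * x.
Let W x : R := normal_pdf 0 1 x.
Let L f := Rinteg leb (fun x => f (X x) * W x).
Let E n f := Rinteg Pr (fun w => f (Tn n w)).
Let mX : measurable_fun setT X. Proof. exact: measurable_mull. Qed.
Let iW : leb.-integrable setT (EFin \o W). Proof. exact: integrable_normal_pdf. Qed.
Let W0 x : 0 <= W x. Proof. exact: normal_pdf_ge0. Qed.
Let W1 : Rinteg leb W = 1. Proof. by rewrite /Rinteg integral_normal_pdf. Qed.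
Let i1 : Pr.-integrable setT (EFin \o (fun=> 1 : R)). Proof. exact: finite_measure_integrable_cst. Qed.

Let wcf_normal u : wcf leb X W u = (expR (- (v * u ^+ 2 / 2)))%:C.
Proof.
rewrite /wcf.
transitivity (cint leb (fun x => (gmass^-1)%:C * (eiu ((u * Num.sqrt v) * x) * (gexp x)%:C))).
  by apply: eq_cint => x; rewrite /W normal_pdf01E realcM /X [u * (_ * _)]mulrA; ring.
rewrite cintZ; last exact: cintegrable_eiu_gexp.
rewrite cint_eiu_gexp -realcM mulrA mulVf ?mul1r ?gt_eqF ?gmass_gt0//.
by rewrite /gexp exprMn sqr_sqrtr// [u ^+ 2 * v]mulrC.
Qed.

(** In frequency the smoothed expectation is an integral of the characteristic function against an
    integrable Gaussian-damped factor, so pointwise convergence of characteristic functions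
    suffices. *)
Let smooth_cvg (f : R -> R) s : leb.-integrable setT (EFin \o f) -> 0 < s ->
  (fun n => E n (smooth f s)) @ \oo --> L (smooth f s).
Proof.
move=> if_ s0; have mf := rintegrable_meas if_.
pose h u : R[i] := (gexp (s * u))%:C * fourier f (- u).
have mh : cmeasurable h.
  apply: cmeasurableM; first by apply: cmeasurable_real; exact: measurable_gexp_scale.
  by apply: (cmeasurable_comp (cmeasurable_fourier mf)); exact: measurable_funN.
pose N := Rinteg leb (fun x => `|f x|).
have hN u : cabs (h u) <= N * gexp (s * u).
  rewrite cabsM cabsC [`|gexp _|]ger0_norm ?gexp_ge0// mulrC ler_wpM2r ?gexp_ge0//.
  exact: cabs_fourier.
have iN := rintegrableZ N (gexp_integrable_scale s0).
have En n : (E n (smooth f s))%:C = ((pi *+ 2)^-1)%:C * cint leb (fun u => charfun Pr (Tn n) u * h u).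
  have -> : E n (smooth f s) = Rinteg Pr (fun w => smooth f s (Tn n w) * 1).
    by rewrite /E; congr Rinteg; apply/funext => w; rewrite mulr1.
  apply: (etrans (smooth_wcf (mT n) i1 (fun=> ler01) if_ s0)).
  apply: (congr1 ( *%R _)); apply: eq_cint => u.
  by have <- : wcf Pr (Tn n) (fun=> 1) u = charfun Pr (Tn n) u by apply: eq_cint => w; rewrite mulr1.
have Ln : (L (smooth f s))%:C = ((pi *+ 2)^-1)%:C * cint leb (fun u => (expR (- (v * u ^+ 2 / 2)))%:C * h u).
  have := @smooth_wcf R _ (measurableTypeR R) leb X W mX iW W0 f s if_ s0.
  rewrite /L => ->; congr (_ * _); apply: eq_cint => u.
  by rewrite wcf_normal.
have mc n : cmeasurable (fun u => charfun Pr (Tn n) u).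
  apply: (@cmeasurable_cint_param _ _ _ _ _ Pr (fun z : R * Omega => eiu (z.1 * Tn n z.2))).
  apply: cmeasurable_eiu; apply: measurable_funM; first exact: measurable_fst.
  exact: measurable_snd_comp.
have : ccvg (fun n => (E n (smooth f s))%:C) (L (smooth f s))%:C.
  rewrite Ln; have -> : (fun n => (E n (smooth f s))%:C) =
     (fun n => ((pi *+ 2)^-1)%:C * cint leb (fun u => charfun Pr (Tn n) u * h u)).
    by apply/funext => n; exact: En.
  apply: ccvgM; first exact: ccvg_cst.
  apply: (proj2 (@cint_dct R _ _ leb (fun n u => charfun Pr (Tn n) u * h u) _ (fun u => N * gexp (s * u)) _ _ iN _)).
  - by move=> n; apply: cmeasurableM; [exact: mc|exact: mh].
  - move=> n u; rewrite cabsM -[leRHS]mul1r; apply: ler_pM; rewrite ?cabs_ge0//.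
    rewrite -[leRHS](Rinteg_prob_cst Pr); apply: cabs_cint_bound => //.
      by apply: cmeasurable_eiu; apply: measurable_funM.
    by move=> w; rewrite cabs_eiu.
  - by move=> u; apply: ccvgM; [exact: cfT|exact: ccvg_cst].
by case.
Qed.

Let compact_cvg (f : R -> R) A C : continuous f -> (forall x, `|f x| <= C) ->
  (forall x, A < `|x| -> f x = 0) -> (fun n => E n f) @ \oo --> L f.
Proof.
move=> cf fC fA; have mf : measurable_fun setT f by exact: continuous_measurable_fun.
have C0 : 0 <= C := le_trans (normr_ge0 _) (fC 0).
have if_ : leb.-integrable setT (EFin \o f).
  have iI : leb.-integrable setT (EFin \o (\1_`[- A, A] : R -> R)) by exact: integrable_indic_itv.
  apply: (rintegrable_le _ _ (rintegrableZ C iI)) => [|x]; first exact: mf.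
  have [xA|xA] := leP `|x| A; first by rewrite indicE mem_set ?mulr1//= in_itv/= -ler_norml.
  by rewrite fA// normr0 mulr_ge0.
apply/cvgrPdist_le => e e0.
have e8 : 0 < e / 8 by rewrite divr_gt0.
have [r r0 fr] := unif_cont_compact_supp cf fA e8.
(* The added 1 makes [c] positive, so that [s = e / 8 / c] is a legitimate width; then
   [s * (c - 1) <= e / 8] and the smoothing error is at most [e / 4]. *)
pose c := 2 * C / r * (gmass^-1 * Rinteg leb (fun t => `|t| * gexp t)) + 1.
have c0 : 0 < c.
  rewrite ltr_wpDl// mulr_ge0//; first by rewrite divr_ge0 ?mulr_ge0// ltW.
  apply: mulr_ge0; first by rewrite invr_ge0 ltW// gmass_gt0.
  apply: Rinteg_ge0 => t.
  by rewrite mulr_ge0 ?gexp_ge0.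
pose s := e / 8 / c; have s0 : 0 < s by rewrite divr_gt0.
have sf x : `|smooth f s x - f x| <= e / 4.
  apply: (le_trans (smooth_error mf fC s0 x (ltW e8) r0 fr)).
  have -> : 2 * C / r * (s * (gmass^-1 * Rinteg leb (fun t => `|t| * gexp t))) = s * (c - 1).
    by rewrite /c; ring.
  have : s * (c - 1) <= s * c by rewrite ler_wpM2l ?ltW// gtrDl oppr_lt0.
  rewrite /s [e / 8 / c * c]divfK ?gt_eqF//; lra.
have ms : measurable_fun setT (smooth f s).
  apply: (@measurable_Rinteg_param _ _ _ _ _ leb (fun z : R * R => f z.2 * gdens s (z.1 - z.2))).
  apply: measurable_funM; first exact: measurable_snd_comp.
  apply: (measurableT_comp (measurable_gdens s)); apply: measurable_funB; [exact: measurable_fst|exact: measurable_snd].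
have [_ D1] := @Rinteg_weight_close R _ (measurableTypeR R) leb X W mX iW W0 f (smooth f s) _ C mf ms fC sf.
have D2 n : `|E n (smooth f s) - E n f| <= e / 4.
  have [_] := Rinteg_weight_close (mT n) i1 (fun=> ler01) mf ms fC sf.
  rewrite Rinteg_prob_cst mulr1.
  have F1 k : (fun w => k (Tn n w) * (1 : R)) = (fun w => k (Tn n w)) by apply/funext => w; rewrite mulr1.
  by rewrite !F1.
rewrite W1 mulr1 in D1.
have e4 : 0 < e / 4 by rewrite divr_gt0.
move/cvgrPdist_le : (smooth_cvg if_ s0) => /(_ _ e4); apply: filterS => n; move: D1 (D2 n).
rewrite -/(L (smooth f s)) -/(L f).
move: (L f) (L (smooth f s)) (E n f) (E n (smooth f s)) => a b a' b' h1 h2 h3.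
have -> : a - a' = (b - b') - (b - a) + (b' - a') by ring.
apply: (le_trans (ler_normD _ _)); have := ler_normB (b - b') (b - a); lra.
Qed.

Let cutoff (A x : R) : R := Num.max 0 (Num.min 1 (A + 1 - `|x|)).
Let continuous_cutoff A : continuous (cutoff A).
Proof.
have -> : cutoff A = (fun x => Num.max 0 (- Num.max (- 1) (- (A + 1 - `|x|)))).
  by apply/funext => x; rewrite /cutoff -oppr_min opprK.
apply: continuous_maxr; first by move=> x; exact: cvg_cst.
have h : continuous (fun x : R => - (A + 1 - `|x|)).
  move=> x; apply: cvgN; apply: cvgB; first exact: cvg_cst.
  by apply: cvg_norm; exact: cvg_id.
have h2 := @continuous_maxr R (fun=> -1) _ (fun x => cvg_cst _) h.
by move=> x; apply: cvgN; exact: h2.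
Qed.
Let cutoff01 A x : 0 <= cutoff A x <= 1.
Proof. by rewrite le_max lexx /= ge_max ler01 ge_min lexx. Qed.
Let cutoff_supp A x : A + 1 < `|x| -> cutoff A x = 0.
Proof. by move=> Ax; apply/max_idPl; rewrite ge_min; apply/orP; right; lra. Qed.
Let cutoff1 A x : `|x| <= A -> cutoff A x = 1.
Proof.
move=> Ax; have -> : cutoff A x = Num.max 0 1 by congr Num.max; apply/min_idPl; lra.
exact/max_idPr.
Qed.

(** A bounded [f] is replaced by its product with a cutoff. The error is at most [C] times the mean
    of one minus the cutoff, itself a compactly supported test function, so tightness follows from
    the compact case and the mass of the limit. *)
Theorem levy_continuity_normal : cvg_dist_normal Pr Tn v.
Proof.
move=> f cf [C fC]; have mf : measurable_fun setT f by exact: continuous_measurable_fun.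
have C0 : 0 <= C := le_trans (normr_ge0 _) (fC 0).
have mc A : measurable_fun setT (cutoff A) by apply: continuous_measurable_fun; exact: continuous_cutoff.
have cn A x : `|cutoff A x| <= 1 by have /andP[? ?] := cutoff01 A x; rewrite ger0_norm.
have f1 (A x : R) : `|f x * cutoff A x| <= C.
  by rewrite normrM -[leRHS]mulr1; apply: ler_pM.
have LA : (fun A : nat => L (cutoff A%:R)) @ \oo --> (1 : R).
  rewrite -[X in _ --> X]W1.
  apply: (proj2 (@Rinteg_dct R _ _ leb (fun (A : nat) x => cutoff A%:R (X x) * W x) W W _ _ iW _)).
  - move=> A; apply: measurable_funM; first exact: (measurableT_comp (mc A%:R) mX).
    exact: rintegrable_meas iW.
  - by move=> A x; rewrite normrM [`|W x|]ger0_norm// ler_piMl.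
  move=> x; apply: cvg_near_cst; near=> A; rewrite cutoff1 ?mul1r//.
  near: A; exact: nbhs_infty_ger.
apply/cvgrPdist_le => e e0.
have eC : 0 < e / (4 * (C + 1)) by rewrite divr_gt0// mulr_gt0//; lra.
move/cvgrPdist_le : LA => /(_ _ eC) [A _ /(_ A (leqnn A))] LA.
pose fA x := f x * cutoff A%:R x.
have cfA : continuous fA by move=> x; apply: cvgM; [exact: cf|exact: continuous_cutoff].
have H1 : (fun n => E n fA) @ \oo --> L fA.
  apply: (@compact_cvg fA (A%:R + 1) C cfA (f1 A%:R)) => x Ax.
  by rewrite /fA cutoff_supp ?mulr0.
have H2 : (fun n => E n (cutoff A%:R)) @ \oo --> L (cutoff A%:R).
  by apply: (@compact_cvg (cutoff A%:R) (A%:R + 1) 1 (@continuous_cutoff _) (cn A%:R)) => x; exact: cutoff_supp.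
(* Stated for an arbitrary weighted measure because it is applied twice, to the normal density and
   to [Pr] with weight one. *)
have close d' (T : measurableType d') (mu : {measure set T -> \bar R}) (Y V : T -> R) :
    measurable_fun setT Y -> mu.-integrable setT (EFin \o V) -> (forall w, 0 <= V w) ->
    `|Rinteg mu (fun w => f (Y w) * V w) - Rinteg mu (fun w => fA (Y w) * V w)| <=
    C * (Rinteg mu V - Rinteg mu (fun w => cutoff A%:R (Y w) * V w)).
  move=> mY iV V0; have mV := rintegrable_meas iV.
  have i2 : mu.-integrable setT (EFin \o (fun w => f (Y w) * V w)).
    apply: (rintegrable_le _ _ (rintegrableZ C iV)).
      by apply: measurable_funM => //; exact: (measurableT_comp mf).
    by move=> w; rewrite normrM [`|V w|]ger0_norm// ler_wpM2r.
  have i3 : mu.-integrable setT (EFin \o (fun w => fA (Y w) * V w)).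
    apply: (rintegrable_le _ _ (rintegrableZ C iV)).
      apply: measurable_funM => //; apply: measurable_funM; first exact: (measurableT_comp mf).
      exact: (measurableT_comp (mc A%:R)).
    by move=> w; rewrite normrM [`|V w|]ger0_norm// ler_wpM2r// f1.
  have i4 : mu.-integrable setT (EFin \o (fun w => cutoff A%:R (Y w) * V w)).
    apply: (rintegrable_le _ _ iV).
      by apply: measurable_funM => //; exact: (measurableT_comp (mc A%:R)).
    by move=> w; rewrite normrM [`|V w|]ger0_norm// ler_piMl.
  have id := rintegrableB i2 i3.
  rewrite -RintegB//; apply: (le_trans (normr_Rinteg id)).
  rewrite -RintegB// -RintegZ; last exact: rintegrableB.
  apply: le_Rinteg; [exact: rintegrable_norm|by apply: rintegrableZ; exact: rintegrableB|].
  move=> w; have /andP[c0 c1] := cutoff01 A%:R (Y w).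
  have -> : f (Y w) * V w - fA (Y w) * V w = f (Y w) * ((1 - cutoff A%:R (Y w)) * V w) by rewrite /fA; ring.
  have -> : V w - cutoff A%:R (Y w) * V w = (1 - cutoff A%:R (Y w)) * V w by ring.
  have p0 : 0 <= (1 - cutoff A%:R (Y w)) * V w by rewrite mulr_ge0// subr_ge0.
  by rewrite normrM [X in _ * X]ger0_norm// ler_wpM2r.
have CL := close _ (measurableTypeR R) leb X W mX iW W0.
have CE n : `|E n f - E n fA| <= C * (1 - E n (cutoff A%:R)).
  have := close _ Omega Pr (Tn n) (fun=> 1) (mT n) i1 (fun=> ler01).
  have F1 k : (fun w => k (Tn n w) * (1 : R)) = (fun w => k (Tn n w)) by apply/funext => w; rewrite mulr1.
  by rewrite !F1 Rinteg_prob_cst.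
rewrite W1 in CL.
have e4 : 0 < e / 4 by rewrite divr_gt0.
move/cvgrPdist_le : H1 => /(_ _ e4) H1; move/cvgrPdist_le : H2 => /(_ _ eC) H2.
near=> n.
have h1 : `|L fA - E n fA| <= e / 4 by near: n.
have h2 : `|L (cutoff A%:R) - E n (cutoff A%:R)| <= e / (4 * (C + 1)) by near: n.
have h3 := CE n; move: CL LA h1 h2 h3; rewrite -/(L f) -/(L fA) -/(L (cutoff A%:R)) -/(E n f).
move: (L f) (L fA) (L (cutoff A%:R)) (E n f) (E n fA) (E n (cutoff A%:R)) => a b c a' b' c'.
set q := e / (4 * (C + 1)) => h1 h2 h3 h4 h5.
have qC : C * q <= e / 4.
  have -> : C * q = e / 4 * (C / (C + 1)) by rewrite /q; field; lra.
  have C1 : 0 < C + 1 by lra.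
  by apply: ler_piMr; [exact: ltW|rewrite ler_pdivrMr// mul1r; lra].
have c1 : 1 - c <= q by apply: le_trans h2; exact: ler_norm.
have c2 : 1 - c' <= 2 * q by have := ler_norm (c - c'); lra.
have k1 : C * (1 - c) <= C * q by rewrite ler_wpM2l.
have k2 : C * (1 - c') <= C * (2 * q) by rewrite ler_wpM2l.
have -> : a - a' = (a - b) + (b - b') - (a' - b') by ring.
have := ler_normB ((a - b) + (b - b')) (a' - b'); have := ler_normD (a - b) (b - b'); lra.
Unshelve. all: by end_near. Qed.
End LevyContinuity.

(** * Central limit theorem for uniformly bounded triangular arrays *)

Section CentralLimit.
Context {R : realType}.

Lemma cvg_inv_sqrtn : (fun n => (Num.sqrt n%:R)^-1) @ \oo --> (0 : R).
Proof.
have -> : (fun n => (Num.sqrt n%:R)^-1) = (fun n => Num.sqrt (n%:R^-1) : R).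
  by apply/funext => n; rewrite sqrtrV.
rewrite -[X in _ --> X]sqrtr0.
exact: (cvg_comp _ _ (@cvg_invn R) (@sqrt_continuous R 0)).
Qed.

Lemma pow_diff_le (z w : R[i]) n : cabs z <= 1 -> cabs w <= 1 ->
  cabs (z ^+ n - w ^+ n) <= n%:R * cabs (z - w).
Proof.
move=> z1 w1; elim: n => [|n IH]; first by rewrite !expr0 subrr cabs0 mul0r.
have -> : z ^+ n.+1 - w ^+ n.+1 = z * (z ^+ n - w ^+ n) + w ^+ n * (z - w).
  by rewrite !exprS; ring.
apply: (le_trans (cabsD _ _)); rewrite -[n.+1%:R]natr1 mulrDl mul1r; apply: lerD.
  by rewrite cabsM; apply: le_trans IH; rewrite ler_piMl ?cabs_ge0.
by rewrite cabsM ler_piMl ?cabs_ge0// cabsX exprn_ile1 ?cabs_ge0.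
Qed.

Lemma eiu_sum m (f : nat -> R) b : eiu (b * \sum_(k < m) f k) = \prod_(k < m) eiu (b * f k).
Proof.
elim: m => [|m IH]; first by rewrite !big_ord0 mulr0 eiu0.
by rewrite !big_ord_recr/= mulrDr eiuD IH.
Qed.

Lemma expRN_taylor (x : R) : 0 <= x -> `|expR (- x) - (1 - x)| <= x ^+ 2.
Proof.
move=> x0; have h1 := expR_ge1Dx (- x); have h2 := expR_ge1Dx x.
have h3 : expR (- x) * (1 + x) <= 1.
  by rewrite expRN mulrC ler_pdivrMr ?mul1r// expR_gt0.
rewrite ger0_norm; last by lra.
have x1 : 0 < 1 + x by lra.
rewrite -(ler_pM2r x1).
have : 0 <= x ^+ 3 by rewrite exprn_ge0.
have -> : (expR (- x) - (1 - x)) * (1 + x) = expR (- x) * (1 + x) - 1 + x ^+ 2 by ring.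
have -> : x ^+ 2 * (1 + x) = x ^+ 2 + x ^+ 3 by ring.
lra.
Qed.

Context d {Omega : measurableType d} (Pr : probability Omega R).
Variables (Z : nat -> Omega -> R) (P : probability (measurableTypeR R) R).
Hypothesis iid : iid_law Pr Z P.
Variables (y : nat -> R -> R) (C v : R).
Hypotheses (my : forall n, measurable_fun setT (y n)) (yC : forall n x, `|y n x| <= C).
Hypotheses (y0 : forall n, Rinteg P (y n) = 0)
  (yv : (fun n => Rinteg P (fun x => y n x ^+ 2)) @ \oo --> v).

Let C0 : 0 <= C. Proof. exact: le_trans (normr_ge0 _) (yC 0 0). Qed.
Let vn n := Rinteg P (fun x => y n x ^+ 2).
Let y2C n x : `|y n x ^+ 2| <= C ^+ 2. Proof. by rewrite normrX lerXn2r ?nnegrE. Qed.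
Let my2 n : measurable_fun setT (fun x => y n x ^+ 2). Proof. exact: measurable_funX. Qed.
Let vn0 n : 0 <= vn n. Proof. by apply: Rinteg_ge0 => x; exact: sqr_ge0. Qed.
Let vnC n : vn n <= C ^+ 2.
Proof. exact: le_trans (ler_norm _) (Rinteg_prob_le P (my2 n) (y2C n)). Qed.

Lemma charfun_step n (a : R) :
  cabs (cint P (fun x => eiu (a * y n x)) - (1 - a ^+ 2 * vn n / 2)%:C) <= `|a| ^+ 3 * C ^+ 3.
Proof.
pose q x : R[i] := (1 - (a * y n x) ^+ 2 / 2) +i* (a * y n x).
have may : measurable_fun setT (fun x => a * y n x) by exact: measurable_funM.
have ie : cintegrable P (fun x => eiu (a * y n x)).
  by apply: (@cintegrable_prob _ _ _ P _ 1) => [|x]; [exact: cmeasurable_eiu|rewrite cabs_eiu].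
have iy : P.-integrable setT (EFin \o (fun x => a * y n x)).
  apply: (@rintegrable_prob _ _ _ P _ (`|a| * C)) => // x.
  by rewrite normrM ler_wpM2l.
have iy2 : P.-integrable setT (EFin \o (fun x => y n x ^+ 2)).
  exact: (rintegrable_prob P (my2 n) (y2C n)).
have i1 : P.-integrable setT (EFin \o (fun=> 1 : R)) by exact: finite_measure_integrable_cst.
have qE : (fun x => 1 - (a * y n x) ^+ 2 / 2) = (fun x => 1 - (a ^+ 2 / 2) * y n x ^+ 2).
  by apply/funext => x; rewrite exprMn; ring.
have iq : cintegrable P q.
  split; last exact: iy.
  by rewrite /q/= qE; apply: rintegrableB => //; exact: rintegrableZ.
have Eq : cint P q = (1 - a ^+ 2 * vn n / 2)%:C.
  apply: complex_eqP; rewrite /cint/=.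
    rewrite qE RintegB//; last exact: rintegrableZ.
    by rewrite Rinteg_prob_cst RintegZ// mulrAC.
  rewrite RintegZ ?y0 ?mulr0//.
  exact: (rintegrable_prob P (my n) (yC n)).
rewrite -Eq -cintB//.
rewrite -[leRHS](Rinteg_prob_cst P); apply: cabs_cint_bound.
- by apply: cmeasurableB; [exact: cintegrable_meas ie|exact: cintegrable_meas iq].
- move=> x; apply: (le_trans (eiu_taylor3 _)); rewrite normrM exprMn.
  by apply: ler_wpM2l; [rewrite exprn_ge0|rewrite lerXn2r ?nnegrE].
- exact: finite_measure_integrable_cst.
Qed.

(** By [pow_diff_le] the error of an [n]-th power is [n] times the one-step error, and the uniform
    bound [C] on the rows makes the latter of order [n] to the power [- 3 / 2]. *)
Lemma clt_charfun t : ccvg (fun n => charfun Pr (fun w => (Num.sqrt n%:R)^-1 * \sum_(k < n) y n (Z k w)) t)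
  (expR (- (v * t ^+ 2 / 2)))%:C.
Proof.
pose a n : R := t * (Num.sqrt n%:R)^-1.
have mez n : cmeasurable (fun x : R => eiu (a n * y n x)).
  by apply: cmeasurable_eiu; exact: measurable_funM.
(* The comparison factor uses the variance of the [n]-th row, so that its [n]-th power is exactly a
   Gaussian characteristic function; the limit of the variances is taken only afterwards. *)
pose wn n : R := expR (- (a n ^+ 2 * vn n / 2)).
have cfE n : charfun Pr (fun w => (Num.sqrt n%:R)^-1 * \sum_(k < n) y n (Z k w)) t =
    cint P (fun x => eiu (a n * y n x)) ^+ n.
  rewrite -(@indep_prod_iid R _ Omega Pr Z P iid n (fun x => eiu (a n * y n x)) 1); last 2 first.
  - exact: mez.
  - by move=> x; rewrite cabs_eiu.
  apply: eq_cint => w; rewrite mulrA -/(a n).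
  exact: (eiu_sum n (fun k => y n (Z k w))).
have wE n : (0 < n)%N -> wn n ^+ n = expR (- (vn n * t ^+ 2 / 2)).
  move=> n0; rewrite /wn -expRM_natl; congr expR; rewrite /a exprMn exprVn sqr_sqrtr//.
  by field; rewrite pnatr_eq0 -lt0n.
have L : ccvg (fun n => (wn n)%:C ^+ n) (expR (- (v * t ^+ 2 / 2)))%:C.
  apply: (@near_ccvg _ (fun n => (expR (- (vn n * t ^+ 2 / 2)))%:C)).
    by exists 1%N => // n /= n0; rewrite -wE// rmorphXn.
  apply: ccvg_real.
  have h : (fun n => - (vn n * t ^+ 2 / 2)) @ \oo --> - (v * t ^+ 2 / 2).
    by apply: cvgN; apply: cvgM; [apply: cvgM => //; exact: cvg_cst|exact: cvg_cst].
  exact: (cvg_comp _ _ h (@continuous_expR R _)).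
have D : ccvg (fun n => cint P (fun x => eiu (a n * y n x)) ^+ n - (wn n)%:C ^+ n) 0.
  (* The first term is [n] times the third-order remainder of [eiu]; the second is [n] times the
     square bounding the replacement of [1 - x] by [exp (- x)], with [x] at most
     [t^2 C^2 / (2 n)]. *)
  apply: (@ccvg_le _ _ _ (fun n => `|t| ^+ 3 * C ^+ 3 * (Num.sqrt n%:R)^-1 + t ^+ 4 * C ^+ 4 / 4 * n%:R^-1)).
    exists 1%N => // n /= n0; rewrite subr0.
    have nn0 : 0 < n%:R :> R by rewrite ltr0n.
    have x0 : 0 <= a n ^+ 2 * vn n / 2 by rewrite divr_ge0// mulr_ge0// sqr_ge0.
    have z1 : cabs (cint P (fun x => eiu (a n * y n x))) <= 1.
      rewrite -[leRHS](Rinteg_prob_cst P); apply: cabs_cint_bound.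
      - exact: mez.
      - by move=> x; rewrite cabs_eiu.
      - exact: finite_measure_integrable_cst.
    have w1 : cabs (wn n)%:C <= 1.
      by rewrite cabsC ger0_norm ?expR_ge0// -[leRHS]expR0 ler_expR oppr_le0.
    apply: (le_trans (pow_diff_le n z1 w1)).
    have sn : (Num.sqrt n%:R)^-1 ^+ 2 = n%:R^-1 :> R by rewrite exprVn sqr_sqrtr.
    have s0 : 0 <= (Num.sqrt n%:R)^-1 :> R by rewrite invr_ge0.
    have h1 := charfun_step n (a n).
    have h2 : cabs ((1 - a n ^+ 2 * vn n / 2)%:C - (wn n)%:C) <= (t ^+ 2 * n%:R^-1 * C ^+ 2 / 2) ^+ 2.
      rewrite -rmorphB cabsC distrC; apply: (le_trans (expRN_taylor x0)).
      have B : a n ^+ 2 * vn n / 2 <= t ^+ 2 * n%:R^-1 * C ^+ 2 / 2.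
        rewrite ler_pM2r ?invr_gt0// /a exprMn sn; apply: ler_wpM2l => //.
        by rewrite mulr_ge0 ?sqr_ge0// invr_ge0.
      by apply: lerXn2r => //; rewrite nnegrE; exact: le_trans x0 B.
    have h3 : cabs (cint P (fun x => eiu (a n * y n x)) - (wn n)%:C) <=
       `|a n| ^+ 3 * C ^+ 3 + (t ^+ 2 * n%:R^-1 * C ^+ 2 / 2) ^+ 2.
      have -> : cint P (fun x => eiu (a n * y n x)) - (wn n)%:C =
        (cint P (fun x => eiu (a n * y n x)) - (1 - a n ^+ 2 * vn n / 2)%:C) +
        ((1 - a n ^+ 2 * vn n / 2)%:C - (wn n)%:C) by ring.
      by apply: (le_trans (cabsD _ _)); exact: lerD.
    apply: (le_trans (ler_wpM2l (ltW nn0) h3)).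
    rewrite /a normrM [`|(Num.sqrt _)^-1|]ger0_norm//.
    rewrite le_eqVlt; apply/orP; left; apply/eqP.
    have -> : (`|t| * (Num.sqrt n%:R)^-1) ^+ 3 = `|t| ^+ 3 * (n%:R^-1 * (Num.sqrt n%:R)^-1).
      by rewrite exprMn -sn; ring.
    by field; rewrite gt_eqF//= gt_eqF// sqrtr_gt0.
  rewrite -[X in _ --> X]addr0; apply: cvgD.
    by rewrite -[X in _ --> X](mulr0 (`|t| ^+ 3 * C ^+ 3)); apply: cvgM; [exact: cvg_cst|exact: cvg_inv_sqrtn].
  by rewrite -[X in _ --> X](mulr0 (t ^+ 4 * C ^+ 4 / 4)); apply: cvgM; [exact: cvg_cst|exact: cvg_invn].
have := ccvgD D L; rewrite add0r; apply: near_ccvg; apply: nearW => n.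
by rewrite cfE subrK.
Qed.
End CentralLimit.

(** * Dominated convergence for series, and bounds for the convolution with [M] *)

Section Tannery.
Context {R : realType}.

Lemma series_tail (u b : nat -> R) : (forall k, `|u k| <= b k) -> cvgn (series b) ->
  cvgn (series u) /\ forall N, `|limn (series u) - series u N| <= limn (series b) - series b N.
Proof.
move=> ub cb.
have cu : cvgn (series u).
  apply: normed_cvg; apply: (series_le_cvg _ _ _ cb) => k; rewrite /=; [exact: normr_ge0| |exact: ub].
  exact: le_trans (normr_ge0 _) (ub k).
split => // N.
have h m : (N <= m)%N -> `|series u m - series u N| <= series b m - series b N.
  move=> Nm; rewrite !sub_series_geq//; apply: (le_trans (ler_norm_sum _ _ _)).
  by apply: ler_sum => k _; exact: ub.
have c1 : (fun m => `|series u m - series u N|) @ \oo --> `|limn (series u) - series u N|.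
  by apply: cvg_norm; apply: cvgB => //; exact: cvg_cst.
have c2 : (fun m => series b m - series b N) @ \oo --> limn (series b) - series b N.
  by apply: cvgB => //; exact: cvg_cst.
by apply: (ler_cvg_to c1 c2); exists N => // m /= Nm; exact: h.
Qed.

(** The dominating series makes all tails uniformly small, and the remaining finite sum converges
    term by term. *)
Lemma tannery (u : nat -> nat -> R) (l b : nat -> R) : (forall n k, `|u n k| <= b k) ->
  cvgn (series b) -> (forall k, (fun n => u n k) @ \oo --> l k) ->
  (fun n => limn (series (u n))) @ \oo --> limn (series l).
Proof.
move=> ub cb ul.
have lb k : `|l k| <= b k.
  have c : (fun n => `|u n k|) @ \oo --> `|l k| by apply: cvg_norm; exact: ul.
  by apply: (ler_cvg_to c (cvg_cst (b k))); apply: nearW => n; exact: ub.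
have [_ tl] := series_tail lb cb.
apply/cvgrPdist_le => e e0.
have e3 : 0 < e / 3 by rewrite divr_gt0.
move/cvgrPdist_le : (cb) => /(_ _ e3) [N _ /(_ N (leqnn N))] bN.
have sN : (fun n => series (u n) N) @ \oo --> series l N.
  rewrite /series/=; elim: N {bN} => [|N IH].
    by under eq_fun do rewrite big_geq//; rewrite big_geq//; exact: cvg_cst.
  by under eq_fun do rewrite big_nat_recr//=; rewrite big_nat_recr//=; apply: cvgD.
move/cvgrPdist_le : sN => /(_ _ e3); apply: filterS => n sn.
have [_ tu] := series_tail (ub n) cb.
have h1 := tl N; have h2 := tu N; have h3 := le_trans (ler_norm _) bN.
have -> : limn (series l) - limn (series (u n)) = (limn (series l) - series l N) +
  (series l N - series (u n) N) - (limn (series (u n)) - series (u n) N) by ring.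
apply: (le_trans (ler_normB _ _)).
have := ler_normD (limn (series l) - series l N) (series l N - series (u n) N); lra.
Qed.
End Tannery.

Section ConvMBounds.
Context {R : realType}.
Variables (nu : {finite_measure set (measurableTypeR R) -> \bar R}) (lam gam Del : R).
Hypotheses (nulam : nu setT = lam%:E) (Del0 : 0 < Del).

Let term f k x : R := (- Del) ^+ k / (k`!)%:R * conv_nubar_pow nu f k (x - gam * Del).
Let bnd C k : R := C * sequences.exp_coeff (Del * lam) k.

Let cvg_bnd C : series (bnd C) @ \oo --> C * expR (Del * lam).
Proof.
have -> : series (bnd C) = (fun n => C * series (sequences.exp_coeff (Del * lam)) n).
  by apply/funext => n; rewrite /series/= mulr_sumr.
by apply: cvgM; [exact: cvg_cst|exact: is_cvg_series_exp_coeff].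
Qed.
Let cvgn_bnd C : cvgn (series (bnd C)).
Proof. by apply/cvg_ex; exists (C * expR (Del * lam)); exact: cvg_bnd. Qed.
Let term_le (f : R -> R) C k x : measurable_fun setT f -> (forall x, `|f x| <= C) -> `|term f k x| <= bnd C k.
Proof.
move=> mf fC; have [_ bk] := conv_nubar_pow_bounded nulam k mf fC.
have t : `|(- Del) ^+ k / k`!%:R| = Del ^+ k / k`!%:R :> R.
  by rewrite normrM normrX normrN (gtr0_norm Del0) ger0_norm// invr_ge0.
rewrite /term normrM t.
apply: (le_trans (ler_wpM2l _ (bk _))); first by rewrite divr_ge0// exprn_ge0// ltW.
by rewrite /bnd /sequences.exp_coeff /= exprMn le_eqVlt; apply/orP; left; apply/eqP; ring.
Qed.

Lemma convM_bounded (f : R -> R) C x : measurable_fun setT f -> (forall x, `|f x| <= C) ->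
  `|convM gam lam Del nu f x| <= expR (lam * Del) * (C * expR (Del * lam)).
Proof.
move=> mf fC; rewrite /convM normrM ger0_norm ?expR_ge0// ler_wpM2l ?expR_ge0//.
have [_ /(_ 0%N)] := @series_tail R (fun k => term f k x) (bnd C) (fun k => @term_le f C k x mf fC) (@cvgn_bnd C).
have s0 (u : nat -> R) : series u 0 = 0 by rewrite /series/= big_geq.
by rewrite !s0 !subr0 (cvg_lim _ (@cvg_bnd C)).
Qed.

Lemma measurable_convM (f : R -> R) C : measurable_fun setT f -> (forall x, `|f x| <= C) ->
  measurable_fun setT (convM gam lam Del nu f).
Proof.
move=> mf fC; apply: measurable_funM => //.
apply: (@measurable_fun_cvg _ _ _ setT (fun n x => series (fun k => term f k x) n)) => [n|x _]; last first.
  by have [] := @series_tail R (fun k => term f k x) (bnd C) (fun k => @term_le f C k x mf fC) (@cvgn_bnd C).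
rewrite /series/=; apply: measurable_sum => k; apply: measurable_funM => //.
have [mk _] := conv_nubar_pow_bounded nulam k mf fC.
by apply: (measurableT_comp mk); exact: measurable_funB.
Qed.

(** The [k]-th term is at most [C (Del lam)^k / k!], a term of a convergent exponential series, so
    [tannery] reduces the claim to each iterated convolution. *)
Lemma convM_cvg (fn : nat -> R -> R) (f : R -> R) C x :
  (forall n, measurable_fun setT (fn n)) -> (forall n x, `|fn n x| <= C) ->
  (forall x, (fun n => fn n x) @ \oo --> f x) ->
  (fun n => convM gam lam Del nu (fn n) x) @ \oo --> convM gam lam Del nu f x.
Proof.
move=> mfn fnC fnf; apply: cvgM; first exact: cvg_cst.
apply: (@tannery _ (fun n k => term (fn n) k x) (fun k => term f k x) (bnd C)).
- by move=> n k; exact: term_le.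
- exact: cvgn_bnd.
- move=> k; apply: cvgM; first exact: cvg_cst.
  exact: (@conv_nubar_pow_cvg R nu lam nulam fn f C k _ mfn fnC fnf).
Qed.
End ConvMBounds.

(** * Exact identities for one sample: linear part and logarithmic remainder *)

Section SpectralIdentities.
Context {R : realType}.
Local Notation leb := (@leb R).
Local Notation "'pi2V'" := (((pi *+ 2)^-1)%:C : R[i]).

Lemma cintegrable_mul_bounded d (T : measurableType d) (mu : {measure set T -> \bar R})
    (f m : T -> R[i]) B : cintegrable mu f -> cmeasurable m -> (forall x, cabs (m x) <= B) ->
  cintegrable mu (fun x => m x * f x).
Proof.
move=> if_ mm mB; apply: (cintegrable_le _ _ (rintegrableZ B (cintegrable_cabs if_))).
  by apply: cmeasurableM => //; exact: cintegrable_meas if_.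
by move=> x; rewrite cabsM ler_wpM2r ?cabs_ge0.
Qed.

Section Convolution.
Variables (g : R -> R) (C : R) (k : R -> R).
Hypotheses (mg : measurable_fun setT g) (gC : forall x, `|g x| <= C)
  (ik : leb.-integrable setT (EFin \o k)).

Lemma fconv_bounded x : `|fconv g k x| <= C * Rinteg leb (fun t => `|k t|).
Proof.
have mgk : measurable_fun setT (fun y : R => g (x - y) * k y).
  apply: measurable_funM; last exact: rintegrable_meas ik.
  by apply: (measurableT_comp mg); exact: measurable_funB.
have gkC y : `|g (x - y) * k y| <= C * `|k y| by rewrite normrM ler_wpM2r.
have iN := rintegrableZ C (rintegrable_norm ik).
have igk : leb.-integrable setT (EFin \o (fun y : R => g (x - y) * k y)).
  by apply: (rintegrable_le _ _ iN) => [|y]; [exact: mgk|exact: gkC].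
apply: (le_trans (normr_Rinteg igk)); rewrite -RintegZ; last exact: rintegrable_norm.
by apply: le_Rinteg => //; exact: rintegrable_norm.
Qed.
Lemma measurable_fconv : measurable_fun setT (fconv g k).
Proof.
apply: (@measurable_Rinteg_param _ _ _ _ _ leb (fun z : R * R => g (z.1 - z.2) * k z.2)).
apply: measurable_funM; last by apply: measurable_snd_comp; exact: rintegrable_meas ik.
by apply: (measurableT_comp mg); apply: measurable_funB; [exact: measurable_fst|exact: measurable_snd].
Qed.
End Convolution.

Variables (P : probability (measurableTypeR R) R) (phi : R -> R[i]) (B : R).
Hypotheses (Pphi : forall u, mfourier P u = phi u) (phi0 : forall u, phi u != 0)
  (mphiV : cmeasurable (fun u : R => (phi u)^-1)) (phiVB : forall u, cabs (phi u)^-1 <= B).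
Variables (g : R -> R) (G : R -> R[i]) (C : R).
Hypotheses (mg : measurable_fun setT g) (gC : forall x, `|g x| <= C)
  (g2 : (\int[leb]_x (g x ^+ 2)%:E < +oo)%E) (gG : is_L2_fourier g G).
Variables (k : R -> R) (A N : R).
Hypotheses (ik : leb.-integrable setT (EFin \o k)) (kA : forall u, A < `|u| -> fourier k u = 0)
  (kN : forall u, cabs (fourier k u) <= N).
Variable fM : R -> R.
Hypothesis fM_fourier : forall x,
  (fM x)%:C = pi2V * cint leb (fun u => eiu (u * x) * (spectral G k u / phi u)).

Let psi := spectral G k.
Let ipsi : cintegrable leb psi. Proof. exact: (cintegrable_spectral mg gC gG ik kA). Qed.
Let ipp : cintegrable leb (fun u => psi u / phi u).
Proof.
have := cintegrable_mul_bounded ipsi mphiV phiVB.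
by have -> : (fun u => (phi u)^-1 * psi u) = (fun u => psi u / phi u) by apply/funext => u; rewrite mulrC.
Qed.

(** Integrating the phase against [P] gives [phi u], which cancels the division by [phi u] in the
    representation of [fM]. *)
Lemma mean_convM : (Rinteg P fM)%:C = pi2V * cint leb psi.
Proof.
pose F (z : measurableTypeR R * R) : R[i] := eiu (z.2 * z.1) * (psi z.2 / phi z.2).
have mF : cmeasurable F.
  apply: cmeasurableM; last by apply: (cmeasurable_snd (f := fun u => psi u / phi u)); exact: cintegrable_meas ipp.
  by apply: cmeasurable_eiu; apply: measurable_funM; [exact: measurable_snd|exact: measurable_fst].
have FB x u : cabs (F (x, u)) <= 1 * cabs (psi u / phi u).
  by rewrite /F cabsM cabs_eiu.
have i1 : P.-integrable setT (EFin \o (fun=> 1 : R)) by exact: finite_measure_integrable_cst.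
have ia := cintegrable_cabs ipp.
have FU := @cint_fubini R _ _ _ _ P leb F (fun=> 1) (fun u => cabs (psi u / phi u)) mF FB i1 ia.
rewrite -cint_real.
transitivity (cint P (fun x => pi2V * cint leb (fun u => F (x, u)))).
  by apply: eq_cint => x; rewrite fM_fourier.
rewrite cintZ; last exact: (@cintegrable_inner R _ _ _ _ P leb F (fun=> 1) (fun u => cabs (psi u / phi u)) mF FB i1 ia).
apply: (congr1 ( *%R _)); rewrite FU; apply: eq_cint => u.
have me : cmeasurable (fun x : R => eiu (u * x)) by apply: cmeasurable_eiu; exact: measurable_funM.
have ie : cintegrable P (fun x : R => eiu (u * x)).
  by apply: (@cintegrable_prob _ _ _ P _ 1) => [|x]; [exact: me|rewrite cabs_eiu].
apply: (etrans (@cintZr _ _ _ P (psi u / phi u) (fun x : R => eiu (u * x)) ie)).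
have -> : cint P (fun x : R => eiu (u * x)) = phi u by exact: Pphi.
by rewrite mulrC divfK// phi0.
Qed.

Section OneSample.
Context d {T : measurableType d} (Z : nat -> T -> R) (n : nat) (w : T).

Let z u := phin Z n w u / phi u.

Lemma cmeasurable_phin_u : cmeasurable (fun u => phin Z n w u).
Proof.
apply: cmeasurableM; first exact: cmeasurable_cst.
by apply: cmeasurable_sum => j; apply: cmeasurable_eiu; exact: measurable_funM.
Qed.
Lemma cabs_phin_le1 u : cabs (phin Z n w u) <= 1.
Proof.
rewrite /phin cabsM cabsC ger0_norm ?invr_ge0//.
have h : cabs (\sum_(j < n) eiu (u * Z j w)) <= n%:R.
  apply: (le_trans (cabs_sum _ _ _)); rewrite (eq_bigr (fun=> 1)); last by move=> j _; rewrite cabs_eiu.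
  by rewrite sumr_const card_ord.
case: n h => [|m] h; first by rewrite invr0 mul0r.
by rewrite ler_pdivrMl ?mulr1.
Qed.
Let mz : cmeasurable z.
Proof. by apply: cmeasurableM; [exact: cmeasurable_phin_u|exact: mphiV]. Qed.
Let zB u : cabs (z u) <= B.
Proof.
rewrite /z cabsM -[leRHS]mul1r; apply: ler_pM; rewrite ?cabs_ge0//; first exact: cabs_phin_le1.
Qed.

Lemma empirical_convM :
  (n%:R^-1 * \sum_(j < n) fM (Z j w))%:C = pi2V * cint leb (fun u => z u * psi u).
Proof.
rewrite realcM rmorph_sum /=.
transitivity ((n%:R^-1)%:C * \sum_(j < n) (pi2V * cint leb (fun u => eiu (u * Z j w) * (psi u / phi u)))).
  by apply: (congr1 ( *%R _)); apply: eq_bigr => j _; exact: fM_fourier.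
have ij (j : nat) : cintegrable leb (fun u => eiu (u * Z j w) * (psi u / phi u)).
  by apply: cintegrable_eiuM => //; exact: measurable_funM.
rewrite -mulr_sumr -cint_sum; last by move=> j; exact: ij.
rewrite mulrCA -cintZ; last by apply: cintegrable_sum => j; exact: ij.
apply: (congr1 ( *%R _)); apply: eq_cint => u.
by rewrite -mulr_suml /z /phin; ring.
Qed.

Lemma centered_empirical_convM :
  (n%:R^-1 * \sum_(j < n) fM (Z j w) - Rinteg P fM)%:C = pi2V * cint leb (fun u => psi u * (z u - 1)).
Proof.
rewrite rmorphB /= empirical_convM mean_convM -mulrBr -cintB//.
  by apply: (congr1 ( *%R _)); apply: eq_cint => u; ring.
exact: cintegrable_mul_bounded ipsi mz zB.
Qed.

Hypothesis zA : forall u, `|u| <= A -> cabs (z u - 1) <= 1 / 2.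

Let re_z u : `|u| <= A -> 0 < cre (z u).
Proof. by move=> /zA/near1_re; lra. Qed.

Let FK := fourier k.
Let iFK : cintegrable leb FK. Proof. exact: cintegrable_compact_fourier ik kA. Qed.
Let N0 : 0 <= N. Proof. exact: le_trans (cabs_ge0 _) (kN 0). Qed.

Definition logrem u := Rfun (z u) * fourier k u.

Lemma cabs_logrem u : cabs (logrem u) <= N.
Proof.
rewrite /logrem; have [uA|uA] := leP `|u| A; last by rewrite kA// mulr0 cabs0.
have R1 : cabs (Rfun (z u)) <= 1.
  apply: (le_trans (cabs_Rfun (zA uA))).
  have h : cabs (z u - 1) ^+ 2 <= (1 / 2) ^+ 2 by rewrite lerXn2r ?nnegrE ?cabs_ge0 ?zA.
  by apply: (le_trans (ler_wpM2l _ h)) => //; lra.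
by rewrite cabsM; apply: (le_trans (ler_pM (cabs_ge0 _) (cabs_ge0 _) R1 (kN u))); rewrite mul1r.
Qed.
Lemma cmeasurable_logrem : cmeasurable logrem.
Proof. by apply: cmeasurableM; [exact: cmeasurable_Rfun|exact: cintegrable_meas iFK]. Qed.
Lemma cintegrable_logrem : cintegrable leb logrem.
Proof.
have iI : leb.-integrable setT (EFin \o (\1_`[- A, A] : R -> R)) by exact: integrable_indic_itv.
apply: (cintegrable_le _ _ (rintegrableZ N iI)) => [|u]; first exact: cmeasurable_logrem.
have [uA|uA] := leP `|u| A.
  by rewrite indicE mem_set ?mulr1 ?cabs_logrem//= in_itv/= -ler_norml.
by rewrite /logrem kA// mulr0 cabs0 mulr_ge0.
Qed.

(** Inside the window this is [log z = R(z) + (z - 1)]; outside it both sides vanish with the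
    transform of the kernel. *)
Lemma cLog_logrem theta u : is_cont_arg A z theta ->
  cLog A z theta u * fourier k u = logrem u + (z u - 1) * fourier k u.
Proof.
move=> ct; have [uA|uA] := leP `|u| A; last by rewrite /logrem kA// !mulr0 addr0.
rewrite /cLog uA /logrem (cont_arg_atan ct (fun u => @re_z u) uA) -hlogE; last exact: re_z.
by rewrite RfunE ?zA// -mulrDl subrK.
Qed.

Lemma log_inner_product theta : is_cont_arg A z theta ->
  cint leb (fun x => (g x)%:C * ifourier (fun u => cLog A z theta u * fourier k u) x) =
  pi2V * (cint leb (fun u => G (- u) * logrem u) + cint leb (fun u => psi u * (z u - 1))).
Proof.
move=> ct; pose H u := logrem u + (z u - 1) * fourier k u.
have mz1 : cmeasurable (fun u => z u - 1) by apply: cmeasurableB => //; exact: cmeasurable_cst.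
have z1B u : cabs (z u - 1) <= B + 1.
  by apply: (le_trans (cabsB _ _)); rewrite cabs1 lerD2r.
have iH2 := cintegrable_mul_bounded iFK mz1 z1B.
have iH : cintegrable leb H by apply: cintegrableD => //; exact: cintegrable_logrem.
have HM u : cabs (H u) <= N + (B + 1) * N.
  apply: (le_trans (cabsD _ _)); apply: lerD; first exact: cabs_logrem.
  by rewrite cabsM; apply: ler_pM; rewrite ?cabs_ge0//; exact: kN.
have -> : (fun u => cLog A z theta u * fourier k u) = H.
  by apply/funext => u; exact: cLog_logrem.
have iG1 := cintegrable_GH mg gC gG cintegrable_logrem cabs_logrem.
transitivity (pi2V * cint leb (fun x => (g x)%:C * ift H x)).
  rewrite -cintZ; last exact: (cintegrable_g_ift mg g2 iH HM).
  by apply: eq_cint => x; rewrite /ifourier -/(ift H x) mulrCA.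
apply: (congr1 ( *%R _)); rewrite (parseval mg gC g2 gG iH HM) -cintD//.
  by apply: eq_cint => u; rewrite /H /psi /spectral; ring.
have := cintegrable_mul_bounded ipsi mz1 z1B.
by have -> : (fun u => (z u - 1) * psi u) = (fun u => psi u * (z u - 1)) by apply/funext => u; rewrite mulrC.
Qed.

Lemma phi_conj u : phi (- u) = conjc (phi u).
Proof.
rewrite -(Pphi u) -(Pphi (- u)) /mfourier /charfun -cintJ.
  by apply: eq_cint => x; rewrite mulNr eiuN.
by apply: (@cintegrable_prob _ _ _ P _ 1) => [|x]; [apply: cmeasurable_eiu; exact: measurable_funM|rewrite cabs_eiu].
Qed.
Lemma phin_conj u : phin Z n w (- u) = conjc (phin Z n w u).
Proof.
rewrite /phin cmulJ; have -> : conjc ((n%:R^-1)%:C : R[i]) = (n%:R^-1)%:C.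
  by apply: complex_eqP; rewrite !cparts ?oppr0.
congr (_ * _); rewrite rmorph_sum; apply: eq_bigr => j _; by rewrite mulNr eiuN.
Qed.
Let z_conj u : z (- u) = conjc (z u).
Proof. by rewrite /z phin_conj phi_conj cmulJ; congr (_ * _); rewrite conjc_inv. Qed.

Lemma logrem_conj u : logrem (- u) = conjc (logrem u).
Proof.
rewrite /logrem; have [uA|uA] := leP `|u| A; last first.
  by rewrite (kA uA) (@kA (- u)) ?normrN// !mulr0 conjc0.
rewrite z_conj RfunJ ?zA// cmulJ; congr (_ * _).
rewrite /fourier -cintJ.
  apply: eq_cint => x; rewrite cmulJ mulNr eiuN; congr (_ * _).
  by apply: complex_eqP; rewrite !cparts ?oppr0.
by apply: cintegrable_eiuM; [exact: measurable_funM|exact: cintegrable_real].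
Qed.

(** The function [logrem] is Hermitian, so its inverse transform is real; Parseval turns the
    integral into that of the real [g] against this real function. *)
Lemma remainder_real :
  cint leb (fun u => G (- u) * logrem u) = (cre (cint leb (fun u => G (- u) * logrem u)))%:C.
Proof.
have ilr := cintegrable_logrem.
have rl x : ift logrem x = (cre (ift logrem x))%:C.
  have E : conjc (ift logrem x) = ift logrem x.
    have i1 : cintegrable leb (fun u => eiu (- (u * x)) * logrem u).
      by apply: cintegrable_eiuM => //; apply: measurable_funN; exact: measurable_funM.
    rewrite /ift -cintJ//.
    rewrite -[RHS]cint_opp//; apply: eq_cint => u.
    by rewrite cmulJ -eiuN opprK mulNr opprK logrem_conj.
  apply: complex_eqP; rewrite ?creC ?cimC//.
  have : cim (conjc (ift logrem x)) = cim (ift logrem x) by rewrite E.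
  by rewrite cimJ; lra.
rewrite -(parseval mg gC g2 gG ilr cabs_logrem).
have -> : (fun x => (g x)%:C * ift logrem x) = (fun x => (g x * cre (ift logrem x))%:C).
  by apply/funext => x; rewrite realcM -rl.
by rewrite cint_real creC.
Qed.

Lemma cont_arg_exists : 0 < A -> ccontinuous z -> z 0 = 1 -> exists theta, is_cont_arg A z theta.
Proof.
move=> A0 [c1 c2] z0; exists (fun u => atan (cim (z u) / cre (z u))); split; last split.
- apply: continuous_in_subspaceT => u; rewrite inE /= in_itv /= -ler_norml => uA.
  have q : (fun u => cim (z u) / cre (z u)) @ u --> cim (z u) / cre (z u).
    by apply: cvgM; [exact: c2|apply: cvgV; [rewrite gt_eqF// re_z|exact: c1]].
  exact: (cvg_comp _ _ q (@continuous_atan R _)).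
- by rewrite z0 cim1 mul0r atan0.
- by move=> u uA; apply: eiu_atan; exact: re_z.
Qed.

Let Wt u : R := \1_`[- A, A] u * cabs (G (- u)).

(** [|R(z)| <= 4 |z - 1|^2] and [z - 1 = (phin - phi) / phi] account for the constant [4 B^2], and
    [N] bounds the transform of the kernel. *)
Lemma cabs_remainder : leb.-integrable setT (EFin \o Wt) ->
  cabs (cint leb (fun u => G (- u) * Rfun (z u) * fourier k u)) <=
  4 * B ^+ 2 * N * Rinteg leb (fun u => Wt u * cabs (phin Z n w u - phi u) ^+ 2).
Proof.
move=> iW; have B0 : 0 <= B := le_trans (cabs_ge0 _) (phiVB 0).
have mphi : cmeasurable phi.
  have := cmeasurableV mphiV; have -> : (fun u => ((phi u)^-1)^-1) = phi by apply/funext => u; rewrite invrK.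
  by [].
have md : measurable_fun setT (fun u => cabs (phin Z n w u - phi u) ^+ 2).
  by apply: measurable_funX; apply: measurable_cabs; apply: cmeasurableB => //; exact: cmeasurable_phin_u.
have W0 u : 0 <= Wt u by rewrite mulr_ge0 ?cabs_ge0// indicE.
have phi1 u : cabs (phi u) <= 1.
  rewrite -Pphi -[leRHS](Rinteg_prob_cst P); apply: cabs_cint_bound.
  - by apply: cmeasurable_eiu; exact: measurable_funM.
  - by move=> x; rewrite cabs_eiu.
  - exact: finite_measure_integrable_cst.
have d4 u : cabs (phin Z n w u - phi u) ^+ 2 <= 4.
  have h : cabs (phin Z n w u - phi u) <= 2.
    by apply: (le_trans (cabsB _ _)); have := cabs_phin_le1 u; have := phi1 u; lra.
  by have := lerXn2r 2 (cabs_ge0 _) (ler0n R 2) h; rewrite -natrX.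
have iWd : leb.-integrable setT (EFin \o (fun u => Wt u * cabs (phin Z n w u - phi u) ^+ 2)).
  apply: (rintegrable_le _ _ (rintegrableZ 4 iW)).
    by apply: measurable_funM => //; exact: rintegrable_meas iW.
  move=> u; rewrite ger0_norm; last by rewrite mulr_ge0 ?sqr_ge0.
  by rewrite [leRHS]mulrC; apply: ler_wpM2l.
rewrite -RintegZ//; apply: cabs_cint_bound; last exact: rintegrableZ.
  apply: cmeasurableM; last exact: cintegrable_meas iFK.
  apply: cmeasurableM; last exact: cmeasurable_Rfun.
  have [m1 [m2 _]] := gG; apply: (cmeasurable_comp (f := G)); first by split.
  exact: measurable_funN.
move=> u; have [uA|uA] := leP `|u| A; last first.
  rewrite (kA uA) mulr0 cabs0; apply: mulr_ge0; last by rewrite mulr_ge0 ?sqr_ge0.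
  by apply: mulr_ge0 => //; apply: mulr_ge0 => //; exact: sqr_ge0.
rewrite /Wt indicE mem_set ?mul1r; last by rewrite /= in_itv/= -ler_norml.
rewrite !cabsM.
have zd : cabs (z u - 1) <= B * cabs (phin Z n w u - phi u).
  have -> : z u - 1 = (phi u)^-1 * (phin Z n w u - phi u).
    by rewrite mulrBr mulVf ?phi0// mulrC.
  by rewrite cabsM ler_wpM2r ?cabs_ge0.
have rz : cabs (Rfun (z u)) <= 4 * (B * cabs (phin Z n w u - phi u)) ^+ 2.
  apply: (le_trans (cabs_Rfun (zA uA))); rewrite ler_wpM2l// lerXn2r ?nnegrE ?cabs_ge0//.
  by rewrite mulr_ge0 ?cabs_ge0.
have -> : 4 * B ^+ 2 * N * (cabs (G (- u)) * cabs (phin Z n w u - phi u) ^+ 2) =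
  cabs (G (- u)) * (4 * (B * cabs (phin Z n w u - phi u)) ^+ 2) * N by ring.
apply: ler_pM; [by rewrite mulr_ge0 ?cabs_ge0|exact: cabs_ge0| |exact: kN].
by rewrite ler_wpM2l ?cabs_ge0.
Qed.
End OneSample.
End SpectralIdentities.

(** * Size of the remainder and comparison of characteristic functions *)

Section Asymptotics.
Context {R : realType}.
Local Notation leb := (@leb R).

(** On [S] the exponentials differ by at most [|t| * D] and elsewhere by at most 2. Only the mean of
    [D] enters, so a bound on the remainder in expectation is enough. *)
Lemma charfun_close d (Omega : measurableType d) (Pr : probability Omega R) (X Y D : Omega -> R)
    (S : set Omega) t :
  measurable_fun setT X -> measurable_fun setT Y -> Pr.-integrable setT (EFin \o D) ->
  (forall w, 0 <= D w) -> measurable S -> (forall w, S w -> `|X w - Y w| <= D w) ->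
  cabs (charfun Pr X t - charfun Pr Y t) <= `|t| * Rinteg Pr D + 2 * (1 - fine (Pr S)).
Proof.
move=> mX mY iD D0 mS SD.
have me (V : Omega -> R) : measurable_fun setT V -> cmeasurable (fun w => eiu (t * V w)).
  by move=> mV; apply: cmeasurable_eiu; exact: measurable_funM.
have ie (V : Omega -> R) : measurable_fun setT V -> cintegrable Pr (fun w => eiu (t * V w)).
  by move=> mV; apply: (@cintegrable_prob _ _ _ Pr _ 1) => [|w]; [exact: me|rewrite cabs_eiu].
have iS : Pr.-integrable setT (EFin \o (\1_S : Omega -> R)).
  apply: (@rintegrable_prob _ _ _ Pr _ 1); first exact: measurable_indic.
  by move=> w; rewrite indicE; case: (_ \in _); rewrite ?normr1 ?normr0.
have i1 : Pr.-integrable setT (EFin \o (fun=> 1 : R)) by exact: finite_measure_integrable_cst.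
have i2 : Pr.-integrable setT (EFin \o (fun w => 2 * (1 - \1_S w))).
  by apply: rintegrableZ; exact: rintegrableB.
rewrite /charfun -cintB; [|exact: ie|exact: ie].
have -> : `|t| * Rinteg Pr D + 2 * (1 - fine (Pr S)) = Rinteg Pr (fun w => `|t| * D w + 2 * (1 - \1_S w)).
  rewrite RintegD//; last exact: rintegrableZ.
  rewrite RintegZ// RintegZ; last exact: rintegrableB.
  by rewrite RintegB// Rinteg_prob_cst -(Rinteg_indic Pr mS).
apply: cabs_cint_bound.
- by apply: cmeasurableB; exact: me.
- move=> w; apply: (le_trans (eiu_lipschitz _ _)); rewrite -mulrBr normrM indicE.
  case: (boolP (w \in S)) => [|_].
    rewrite inE => Sw; rewrite subrr mulr0 addr0 ge_min; apply/orP; right.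
    by rewrite ler_wpM2l// SD.
  by rewrite subr0 mulr1 ge_min -{1}[2]add0r lerD// mulr_ge0.
- by apply: rintegrableD => //; exact: rintegrableZ.
Qed.

Definition window (A : R) (G : R -> R[i]) u : R := \1_`[- A, A] u * cabs (G (- u)).

Lemma window_ge0 A G u : 0 <= window A G u.
Proof. by rewrite mulr_ge0 ?cabs_ge0// indicE. Qed.

Lemma window_integral (A : R) (G : R -> R[i]) : cmeasurable G ->
  (\int[leb]_(u in `[(- A)%R, A%R]) (cabs (G u))%:E < +oo)%E ->
  leb.-integrable setT (EFin \o window A G) /\
  (Rinteg leb (window A G))%:E = (\int[leb]_(u in `[(- A)%R, A%R]) (cabs (G u))%:E)%E.
Proof.
move=> mG fin.
have E1 : (\int[leb]_(u in `[(- A)%R, A%R]) (cabs (G u))%:E = \int[leb]_u (\1_`[(- A)%R, A%R] u * cabs (G u))%:E)%E.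
  rewrite integral_mkcond; apply: eq_integral => u _; rewrite patchE indicE.
  by case: ifP => _; rewrite ?mul1r ?mul0r.
have mI : measurable_fun setT (fun u : R => \1_`[- A, A] u * cabs (G u)).
  by apply: measurable_funM; [exact: measurable_indic|exact: measurable_cabs].
have i0 : leb.-integrable setT (EFin \o (fun u : R => \1_`[- A, A] u * cabs (G u))).
  apply/integrableP; split; first exact/measurable_EFinP.
  rewrite E1 in fin; apply: le_lt_trans fin.
  rewrite le_eqVlt; apply/orP; left; apply/eqP; apply: eq_integral => u _ /=.
  by rewrite ger0_norm// mulr_ge0 ?cabs_ge0// indicE.
have wE : window A G = (fun u => \1_`[- A, A] (- u) * cabs (G (- u))).
  apply/funext => u; rewrite /window !indicE; congr ((nat_of_bool _)%:R * _).
  by apply/idP/idP; rewrite !inE /= !in_itv /= -!ler_norml normrN.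
have n1 : (-1 : R) != 0 by rewrite oppr_eq0 oner_eq0.
have := rintegrable_affine 0 n1 i0.
under eq_fun do rewrite mulN1r addr0.
rewrite -wE => iw; split => //.
by rewrite E1 -EFin_Rinteg// wE (Rinteg_opp i0).
Qed.

Lemma window_rate (h : nat -> R) (G : nat -> R -> R[i]) (delta : R) :
  (forall n, 0 < h n) -> h @ \oo --> (0:R) -> 0 < delta -> (forall n, cmeasurable (G n)) ->
  (fun n => (\int[leb]_(u in `[(- (h n)^-1)%R, ((h n)^-1)%R]) (cabs (G n u))%:E) *
     (powR (ln ((h n)^-1)) (1 + 2 * delta) / Num.sqrt n%:R)%:E)%E @ \oo --> 0%E ->
  (\forall n \near \oo, leb.-integrable setT (EFin \o window (h n)^-1 (G n))) /\
  (fun n => Rinteg leb (window (h n)^-1 (G n)) / Num.sqrt n%:R) @ \oo --> (0 : R).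
Proof.
move=> h0 hc d0 mG /fine_cvgP[fin cv].
pose I n := (\int[leb]_(u in `[(- (h n)^-1)%R, ((h n)^-1)%R]) (cabs (G n u))%:E)%E.
pose q n : R := powR (ln ((h n)^-1)) (1 + 2 * delta).
have q1 : \forall n \near \oo, 1 <= q n.
  move/cvgrPdist_le : hc => /(_ _ (expR_gt0 (-1))); apply: filterS => n.
  rewrite sub0r normrN gtr0_norm// => hn.
  have l1 : 1 <= ln ((h n)^-1).
    rewrite -[leLHS](@expRK R) ler_ln ?posrE ?expR_gt0 ?invr_gt0//.
    by rewrite -[leLHS]invrK lef_pV2 ?posrE ?invr_gt0 ?expR_gt0// -expRN.
  rewrite /q -[leLHS](@powRr0 R (ln ((h n)^-1))).
  by apply: ler_powR => //; lra.
have I0 n : (0 <= I n)%E by apply: integral_ge0 => u _; rewrite lee_fin cabs_ge0.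
have key : \forall n \near \oo, [/\ (I n < +oo)%E & fine (I n) / Num.sqrt n%:R <= fine (I n * (q n / Num.sqrt n%:R)%:E)%E].
  near=> n.
  have n0 : (0 < n)%N by near: n; exists 1%N.
  have s0 : 0 < Num.sqrt n%:R :> R by rewrite sqrtr_gt0 ltr0n.
  have qn : 1 <= q n by near: n.
  have qs : 0 < q n / Num.sqrt n%:R by rewrite divr_gt0// (lt_le_trans ltr01).
  have fn : (I n * (q n / Num.sqrt n%:R)%:E)%E \is a fin_num by near: n.
  have In : (I n < +oo)%E.
    rewrite ltey; apply: contraTneq fn => ->.
    by rewrite gt0_mulye ?lte_fin// .
  have If : I n \is a fin_num by rewrite ge0_fin_numE.
  split => //; rewrite -(fineK If) -EFinM /= ler_wpM2l ?fine_ge0//.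
  by rewrite ler_peMl// invr_ge0 ltW.
have wI : \forall n \near \oo, leb.-integrable setT (EFin \o window (h n)^-1 (G n)) /\
   Rinteg leb (window (h n)^-1 (G n)) = fine (I n).
  apply: filterS key => n [In _]; have [i1 E] := window_integral (mG n) In.
  by split => //; rewrite /I -E.
split; first by apply: filterS wI => n [].
apply: cvg0_le cv.
near=> n.
have [_ E] : leb.-integrable setT (EFin \o window (h n)^-1 (G n)) /\
   Rinteg leb (window (h n)^-1 (G n)) = fine (I n) by near: n.
have [_ B] : [/\ (I n < +oo)%E & fine (I n) / Num.sqrt n%:R <= fine (I n * (q n / Num.sqrt n%:R)%:E)%E] by near: n.
rewrite E ger0_norm; first exact: B.
by rewrite divr_ge0 ?fine_ge0 ?sqrtr_ge0.
Unshelve. all: by end_near. Qed.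

Section RemainderMean.
Context d {Omega : measurableType d} (Pr : probability Omega R).
Variables (Z : nat -> Omega -> R) (P : probability (measurableTypeR R) R).
Hypothesis iid : iid_law Pr Z P.
Variables (W : R -> R) (n : nat).
Hypotheses (iW : leb.-integrable setT (EFin \o W)) (W0 : forall u, 0 <= W u) (n0 : (0 < n)%N).

Definition sqdev w : R := Rinteg leb (fun u => W u * cabs (phin Z n w u - mfourier P u) ^+ 2).

Lemma cmeasurable_phin2 : cmeasurable (fun z : Omega * R => phin Z n z.1 z.2).
Proof.
have [mZ _] := iid.
apply: cmeasurableM; first exact: cmeasurable_cst.
apply: cmeasurable_sum => k; apply: cmeasurable_eiu; apply: measurable_funM; first exact: measurable_snd.
exact: measurable_fst_comp.
Qed.
Let F (z : Omega * R) : R := W z.2 * cabs (phin Z n z.1 z.2 - mfourier P z.2) ^+ 2.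
Let mphi : cmeasurable (fun u : R => mfourier P u).
Proof.
apply: (@cmeasurable_cint_param _ _ _ _ _ P (fun z : R * (measurableTypeR R) => eiu (z.1 * z.2))).
by apply: cmeasurable_eiu; apply: measurable_funM; [exact: measurable_fst|exact: measurable_snd].
Qed.
Let mF : measurable_fun setT F.
Proof.
apply: measurable_funM; first by apply: measurable_snd_comp; exact: rintegrable_meas iW.
apply: measurable_funX; apply: measurable_cabs; apply: cmeasurableB; first exact: cmeasurable_phin2.
exact: (cmeasurable_snd (f := fun u => mfourier P u)).
Qed.
Let dev4 w u : cabs (phin Z n w u - mfourier P u) ^+ 2 <= 4.
Proof.
have p1 : cabs (mfourier P u) <= 1.
  rewrite -[leRHS](Rinteg_prob_cst P); apply: cabs_cint_bound.
  - by apply: cmeasurable_eiu; exact: measurable_funM.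
  - by move=> x; rewrite cabs_eiu.
  - exact: finite_measure_integrable_cst.
have h : cabs (phin Z n w u - mfourier P u) <= 2.
  by apply: (le_trans (cabsB _ _)); have := cabs_phin_le1 Z n w u; lra.
by have := lerXn2r 2 (cabs_ge0 _) (ler0n R 2) h; rewrite -natrX.
Qed.
Let FB w u : `|F (w, u)| <= 4 * W u.
Proof.
rewrite ger0_norm; last by rewrite mulr_ge0 ?sqr_ge0.
by rewrite [leRHS]mulrC; apply: ler_wpM2l.
Qed.

Lemma sqdev_ge0 w : 0 <= sqdev w.
Proof. by apply: Rinteg_ge0 => u; rewrite mulr_ge0 ?sqr_ge0. Qed.
Let iFw w : leb.-integrable setT (EFin \o (fun u => F (w, u))).
Proof.
apply: (rintegrable_le _ _ (rintegrableZ 4 iW)) => [|u]; last exact: FB.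
exact: (measurableT_comp mF (pair1_measurable w)).
Qed.
Lemma rintegrable_sqdev : Pr.-integrable setT (EFin \o sqdev).
Proof.
apply: (@rintegrable_prob _ _ _ Pr _ (4 * Rinteg leb W)).
  exact: (@measurable_Rinteg_param _ _ _ _ _ leb F mF).
move=> w; rewrite ger0_norm ?sqdev_ge0// -RintegZ//; apply: le_Rinteg; [exact: iFw|exact: rintegrableZ|].
by move=> u; apply: le_trans (FB w u); exact: ler_norm.
Qed.
(** Fubini moves the expectation inside the frequency integral, where [phin_variance] bounds it
    uniformly in [u]. *)
Lemma sqdev_mean : Rinteg Pr sqdev <= 4 / n%:R * Rinteg leb W.
Proof.
have FB' w u : `|F (w, u)| <= 1 * (4 * W u) by rewrite mul1r.
have i1 : Pr.-integrable setT (EFin \o (fun=> 1 : R)) by exact: finite_measure_integrable_cst.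
have FU := @Rinteg_fubini R _ _ _ _ Pr leb F (fun=> 1) (fun u => 4 * W u) mF FB' i1 (rintegrableZ 4 iW).
rewrite /sqdev (FU : Rinteg Pr (fun w => Rinteg leb (fun u => F (w, u))) = _) -RintegZ//.
have Fu u : Rinteg Pr (fun w => F (w, u)) = W u * Rinteg Pr (fun w => cabs (phin Z n w u - mfourier P u) ^+ 2).
  rewrite -RintegZ//; apply: (@rintegrable_prob _ _ _ Pr _ 4) => [|w].
    apply: measurable_funX; apply: measurable_cabs; apply: cmeasurableB; last exact: cmeasurable_cst.
    apply: (cmeasurable_comp cmeasurable_phin2 (h := fun w => (w, u))).
    exact: pair2_measurable.
  by rewrite ger0_norm ?sqr_ge0.
have le1 u : Rinteg Pr (fun w => F (w, u)) <= 4 / n%:R * W u.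
  by rewrite Fu [leRHS]mulrC ler_wpM2l// (phin_variance iid).
apply: le_Rinteg => //; last exact: rintegrableZ.
apply: (rintegrable_le _ _ (rintegrableZ (4 / n%:R) iW)) => [|u].
  by apply: (@measurable_Rinteg_param _ _ _ _ _ Pr (fun z : R * Omega => F (z.2, z.1))); exact: (measurableT_comp mF (measurable_fun_pair measurable_snd measurable_fst)).
by rewrite ger0_norm ?le1//; apply: Rinteg_ge0 => w; rewrite mulr_ge0 ?sqr_ge0.
Qed.
End RemainderMean.
End Asymptotics.

(** * Assembly of the decomposition and of the limit law *)

Unset Implicit Arguments.

Theorem theorem3p5 (R : realType) (lam gam Del : R)
  (nu : {finite_measure set (measurableTypeR R) -> \bar R})
  (d : measure_display) (Omega : measurableType d) (Pr : probability Omega R)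
  (Z : nat -> Omega -> R) (P : probability (measurableTypeR R) R)
  (K : R -> R) (h : nat -> R) (delta : R)
  (gn : nat -> R -> R) (G : nat -> R -> R[i]) (g : R -> R) :
  0 < lam -> 0 < Del -> nu setT = lam%:E ->
  (exists beta : R, 2 < beta /\
     (\int[nu]_x (powR (ln (Num.max `|x| (expR 1))) beta)%:E < +oo)%E) ->
  (* Z_1, Z_2, ... i.i.d. Delta-increments of the compound Poisson process *)
  iid_law Pr Z P ->
  (forall u, mfourier P u = cpp_phi gam lam Del nu u) ->
  (* the kernel *)
  measurable_fun setT K -> (@leb R).-integrable setT (EFin \o K) ->
  (forall x, K (- x) = K x) ->
  (forall u, 1 < `|u| -> fourier K u = 0) ->
  (* the bandwidths *)
  (forall n, 0 < h n) -> h @ \oo --> (0:R) -> 0 < delta ->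
  (fun n => ln ((h n)^-1) / powR n%:R (1 + 2 * delta)^-1) @ \oo --> (0:R) ->
  (* the functions g_n *)
  (forall n, measurable_fun setT (gn n)) ->
  (forall n, (\int[@leb R]_x (gn n x ^+ 2)%:E < +oo)%E) ->
  (forall n, is_L2_fourier (gn n) (G n)) ->
  (fun n => (\int[@leb R]_(u in `[(- (h n)^-1)%R, ((h n)^-1)%R]) (cabs (G n u))%:E) *
     (powR (ln ((h n)^-1)) (1 + 2 * delta) / Num.sqrt n%:R)%:E)%E @ \oo --> 0%E ->
  (exists C : R, forall n x, `|gn n x| <= C) ->
  (forall x, (fun n => fconv (gn n) (Kh (h n) K) x) @ \oo --> g x) ->
  let phi := cpp_phi gam lam Del nu in
  let FKh := fun n => fourier (Kh (h n) K) in
  let fn := fun n => convM gam lam Del nu (fconv (gn n) (Kh (h n) K)) in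
  let LHS := fun n w theta =>
    (Num.sqrt n%:R / Del)%:C *
    cint (@leb R) (fun x => (gn n x)%:C *
      ifourier (fun u => cLog (h n)^-1 (fun v => phin Z n w v / phi v) theta u * FKh n u) x) in
  let RHS := fun n w =>
    (Num.sqrt n%:R / Del)%:C *
      (n%:R^-1 * \sum_(k < n) fn n (Z k w) - Rinteg P (fn n))%:C +
    (Num.sqrt n%:R / (pi *+ 2 * Del))%:C *
      cint (@leb R) (fun u => G n (- u) * Rfun (phin Z n w u / phi u) * FKh n u) in
  (exists A : nat -> set Omega,
     (forall n, measurable (A n)) /\
     (fun n => fine (Pr (A n))) @ \oo --> (1:R) /\
     forall n w, A n w ->
       (forall u, `|u| <= (h n)^-1 -> phin Z n w u / phi u != 0) /\
       (exists theta, is_cont_arg (h n)^-1 (fun v => phin Z n w v / phi v) theta) /\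
       (forall theta, is_cont_arg (h n)^-1 (fun v => phin Z n w v / phi v) theta ->
          LHS n w theta = RHS n w /\ RHS n w = (cre (RHS n w))%:C)) /\
  (exists s2 : R, 0 <= s2 /\
     (Del ^+ 2 * s2)%:E =
       (\int[P]_x ((convM gam lam Del nu g x - g 0) ^+ 2)%:E)%E /\
     (Del ^+ 2 * s2)%:E =
       (\int[P]_x ((convM gam lam Del nu g x) ^+ 2)%:E - (g 0 ^+ 2)%:E)%E /\
     cvg_dist_normal Pr (fun n w => cre (RHS n w)) s2).
Proof.
move=> lam0 Del0 nulam _ iid Pphi mK iK Ksym K0 h0 hc d0 rate mgn gn2 gnG Grate [C gC] glim.
move=> phi FKh fn LHS RHS; have {}Pphi u : mfourier P u = phi u := Pphi u.
have [mZ _] := iid.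
pose A n : R := (h n)^-1.
have A0 n : 0 < A n by rewrite invr_gt0.
pose k n := Kh (h n) K.
have ik n : (@leb R).-integrable setT (EFin \o k n) := rintegrable_Kh (h0 n) iK.
have ksym n x : k n (- x) = k n x by rewrite /k /Kh mulNr Ksym.
have kA n u : A n < `|u| -> fourier (k n) u = 0 by exact: (fourier_Kh_eq0 (h0 n) iK K0).
pose N := Rinteg (@leb R) (fun x => `|K x|).
have kN n u : cabs (fourier (k n) u) <= N.
  by rewrite /N -(Rinteg_norm_Kh (h0 n) iK); exact: cabs_fourier (ik n).
have N0 : 0 <= N := le_trans (cabs_ge0 _) (kN 0%N 0).
pose f n := fconv (gn n) (k n).
have mf n : measurable_fun setT (f n) := measurable_fconv (mgn n) (ik n).
have fC n x : `|f n x| <= C * N.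
  by rewrite /N -(Rinteg_norm_Kh (h0 n) iK); exact: (fconv_bounded (mgn n) (gC n) (ik n)).
pose CM := expR (lam * Del) * ((C * N) * expR (Del * lam)).
have fMC n x : `|fn n x| <= CM := convM_bounded gam nulam Del0 x (mf n) (fC n).
have mfM n : measurable_fun setT (fn n) := measurable_convM gam nulam Del0 (mf n) (fC n).
pose B := expR (2 * (lam * Del)).
have phi0 u : phi u != 0 := cexp_neq0 _.
have mphiV : cmeasurable (fun u : R => (phi u)^-1) := cmeasurable_phi_inv nu lam gam Del.
have phiVB u : cabs (phi u)^-1 <= B := cabs_phi_inv gam nulam Del0 u.
have fMF n x : (fn n x)%:C =
    ((pi *+ 2)^-1)%:C * cint (@leb R) (fun u => eiu (u * x) * (spectral (G n) (k n) u / phi u)).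
  apply: (convM_fourier gam nulam Del0 (cintegrable_spectral (mgn n) (gC n) (gnG n) (ik n) (kA n))) => y.
  exact: (fconv_fourier (mgn n) (gC n) (gn2 n) (gnG n) (ik n) (ksym n) (kA n)).
have B1 : 1 <= B by rewrite -[leLHS]expR0 ler_expR !mulr_ge0// ltW.
have B0 : 0 < B := lt_le_trans ltr01 B1.
(* A deviation of [B^-1 / 2], multiplied by [|1 / phi| <= B], puts [phin / phi] within [1 / 2] of 1,
   the disc where the logarithmic remainder is controlled. *)
have e0p : 0 < B^-1 / 2 by rewrite divr_gt0// invr_gt0.
have e1 : B^-1 / 2 <= 1.
  have : B^-1 <= 1 by rewrite invf_le1.
  lra.
have [S [mS PS HS]] := phin_uniform iid e0p e1 A0 (log_rate d0 h0 rate).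
have zS n w : S n w -> forall u, `|u| <= A n -> cabs (phin Z n w u / phi u - 1) <= 1 / 2.
  move=> /HS[_ H] u uA.
  have -> : phin Z n w u / phi u - 1 = (phi u)^-1 * (phin Z n w u - mfourier P u).
    by rewrite Pphi mulrBr mulVf ?phi0// mulrC.
  rewrite cabsM; apply: (le_trans (ler_pM (cabs_ge0 _) (cabs_ge0 _) (phiVB u) (H u uA))).
  by rewrite mulrA mulfV ?gt_eqF.
(* The linear part is rewritten as a normalised sum of centred bounded functions of the sample, the
   form required by [clt_charfun]. *)
pose y n x : R := (fn n x - Rinteg P (fn n)) / Del.
pose T n w : R := (Num.sqrt n%:R)^-1 * \sum_(j < n) y n (Z j w).
pose c n : R := Num.sqrt n%:R / (pi *+ 2 * Del).
pose rem n w := cint (@leb R) (fun u => G n (- u) * Rfun (phin Z n w u / phi u) * FKh n u).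
have linE n w : Num.sqrt n%:R / Del * (n%:R^-1 * \sum_(j < n) fn n (Z j w) - Rinteg P (fn n)) = T n w.
  rewrite /T /y -mulr_suml sumrB sumr_const card_ord.
  (* For [n = 0] both sides are 0 by the conventions [sqrt 0 = 0] and [0^-1 = 0]. *)
  case: n => [|n]; first by rewrite sqrtr0 invr0 !mul0r.
  have s0 : Num.sqrt n.+1%:R != 0 :> R by rewrite sqrtr_eq0 -ltNge.
  have ss : n.+1%:R = Num.sqrt n.+1%:R * Num.sqrt n.+1%:R :> R by rewrite -expr2 sqr_sqrtr.
  rewrite -[Rinteg P (fn n.+1) *+ _]mulr_natl; move: (Num.sqrt n.+1%:R) s0 ss => r s0 ->; field.
  by rewrite s0 gt_eqF.
have RHSE n w : RHS n w = (T n w)%:C + (c n)%:C * rem n w.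
  by rewrite /RHS -linE (realcM (Num.sqrt n%:R / Del)).
have creRHS n w : cre (RHS n w) = T n w + c n * cre (rem n w) by rewrite RHSE creD creZ.
have remE n w : rem n w = cint (@leb R) (fun u => G n (- u) * logrem phi (k n) Z n w u).
  by apply: eq_cint => u; rewrite /logrem mulrA.
have cphi : ccontinuous phi.
  have -> : phi = mfourier P by apply/funext => u; rewrite Pphi.
  exact: ccontinuous_mfourier.
split.
  exists S; split => //; split => // n w Sw; have zw := zS n w Sw; have [n0 _] := HS n w Sw.
  split; last split.
  - move=> u uA; apply/eqP => zu; have := zw u uA.
    by rewrite zu sub0r cabsN cabs1; lra.
  - apply: (cont_arg_exists zw (A0 n)).
      by apply: ccontinuousM; [exact: ccontinuous_phin|exact: ccontinuousV].
    have -> : phi 0 = 1.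
      rewrite -Pphi; apply: (etrans _ (cint_prob_cst P 1)); apply: eq_cint => x.
      by rewrite mul0r eiu0.
    rewrite invr1 mulr1 /phin.
    have -> : \sum_(j < n) eiu (0 * Z j w) = n%:R.
      rewrite (eq_bigr (fun=> 1)); last by move=> j _; rewrite mul0r eiu0.
      by rewrite sumr_const card_ord.
    have nC : (n%:R : R[i]) = (n%:R : R)%:C by rewrite rmorph_nat.
    (* Positivity of [n], part of the event [S n], matters here: the empty average would give
       [phin = 0] instead of 1. *)
    by rewrite nC -realcM mulVf// pnatr_eq0 -lt0n.
  - move=> theta ct.
    have remR := remainder_real Pphi mphiV (mgn n) (gC n) (gn2 n) (gnG n) (ik n) (kA n) (kN n) zw.
    split; last by rewrite RHSE remE remR -realcM -rmorphD.
    have L := log_inner_product mphiV phiVB (mgn n) (gC n) (gn2 n) (gnG n) (ik n) (kA n) (kN n) zw ct.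
    have M := centered_empirical_convM Pphi phi0 mphiV phiVB (mgn n) (gC n) (gnG n) (ik n) (kA n) (fMF n) Z n w.
    have cE : (c n)%:C = (Num.sqrt n%:R / Del)%:C * ((pi *+ 2)^-1)%:C :> R[i].
      by rewrite -realcM; congr (_%:C); rewrite /c invfM -mulrA [Del^-1 * _]mulrC.
    rewrite /LHS L RHSE remE -linE (realcM (Num.sqrt n%:R / Del)) M cE; ring.
have gMl x : (fun n => fn n x) @ \oo --> convM gam lam Del nu g x.
  exact: (@convM_cvg R nu lam gam Del nulam Del0 f g (C * N) x mf fC glim).
set gM := convM gam lam Del nu g in gMl *.
have gMC x : `|gM x| <= CM.
  have cv : (fun n => `|fn n x|) @ \oo --> `|gM x| by apply: cvg_norm; exact: gMl.
  by apply: (ler_cvg_to cv (cvg_cst CM)); apply: nearW => n; exact: fMC.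
have iCM (r : R) : P.-integrable setT (EFin \o (fun=> r)) by exact: finite_measure_integrable_cst.
have [igM EgM] := @Rinteg_dct R _ _ P fn gM (fun=> CM) mfM fMC (iCM CM) gMl.
have mgM := rintegrable_meas igM.
have En n : Rinteg P (fn n) = f n 0.
  have M := mean_convM Pphi phi0 mphiV phiVB (mgn n) (gC n) (gnG n) (ik n) (kA n) (fMF n).
  have F := fconv_fourier (mgn n) (gC n) (gn2 n) (gnG n) (ik n) (ksym n) (kA n) 0.
  have E : (Rinteg P (fn n))%:C = (f n 0)%:C :> R[i].
    rewrite M /f F; apply: (congr1 ( *%R _)); apply: eq_cint => u.
    by rewrite mulr0 eiu0 mul1r.
  by have := congr1 (@cre R) E; rewrite !creC.
have Ef0 : (fun n => Rinteg P (fn n)) @ \oo --> g 0.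
  have -> : (fun n => Rinteg P (fn n)) = (fun n => f n 0) by apply/funext => n; exact: En.
  exact: glim.
(* The means of [g_n * K_h * M] have two limits, one by dominated convergence and one by evaluating
   [g_n * K_h] at 0. Their equality makes the two variance formulas agree. *)
have gM0 : Rinteg P gM = g 0 by exact: (@cvg_unique _ _ ((fun n => Rinteg P (fn n)) @ \oo)).
pose s2 := Rinteg P (fun x => (gM x - g 0) ^+ 2) / Del ^+ 2.
have Dn0 : Del ^+ 2 != 0 by rewrite expf_neq0// gt_eqF.
have s20 : 0 <= s2.
  by rewrite divr_ge0 ?sqr_ge0//; apply: Rinteg_ge0 => x; exact: sqr_ge0.
have s2E : Del ^+ 2 * s2 = Rinteg P (fun x => (gM x - g 0) ^+ 2) by rewrite mulrC divfK.
have iq : P.-integrable setT (EFin \o (fun x => gM x ^+ 2)).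
  apply: (@rintegrable_prob _ _ _ P _ (CM ^+ 2)) => [|x]; first exact: measurable_funX.
  by rewrite normrX lerXn2r ?nnegrE// (le_trans _ (gMC 0)).
have ilin : P.-integrable setT (EFin \o (fun x => (2 * g 0) * gM x - g 0 ^+ 2)).
  by apply: rintegrableB; [exact: rintegrableZ|exact: iCM].
have qE : (fun x => (gM x - g 0) ^+ 2) = (fun x => gM x ^+ 2 - ((2 * g 0) * gM x - g 0 ^+ 2)).
  by apply/funext => x; ring.
exists s2; split => //; split; last split.
- by rewrite s2E EFin_Rinteg// qE; exact: rintegrableB.
- rewrite s2E qE RintegB// RintegB//; last exact: rintegrableZ.
  rewrite RintegZ// gM0 Rinteg_prob_cst -EFin_Rinteg// -EFinB; congr (_%:E); ring.
have c0 n : 0 <= c n.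
  apply: divr_ge0; first exact: sqrtr_ge0.
  by apply: mulr_ge0; [apply: mulrn_wge0; exact: pi_ge0|exact: ltW].
have my n : measurable_fun setT (y n) by apply: measurable_funM => //; exact: measurable_funB.
have EC n : `|Rinteg P (fn n)| <= CM := Rinteg_prob_le P (mfM n) (fMC n).
have my2 n : measurable_fun setT (fun x : R => y n x ^+ 2) by exact: measurable_funX.
have yC n x : `|y n x| <= 2 * CM / Del.
  rewrite normrM [`|Del^-1|]gtr0_norm ?invr_gt0// ler_pM2r ?invr_gt0//.
  by apply: (le_trans (ler_normB _ _)); have := fMC n x; have := EC n; lra.
have ifM n : P.-integrable setT (EFin \o fn n) := rintegrable_prob P (mfM n) (fMC n).
have y0 n : Rinteg P (y n) = 0.
  have -> : y n = (fun x => Del^-1 * (fn n x - Rinteg P (fn n))).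
    by apply/funext => x; rewrite /y mulrC.
  rewrite RintegZ; last by apply: rintegrableB; [exact: ifM|exact: iCM].
  by rewrite RintegB// Rinteg_prob_cst subrr mulr0.
have yv : (fun n => Rinteg P (fun x => y n x ^+ 2)) @ \oo --> s2.
  have -> : s2 = Rinteg P (fun x => ((gM x - g 0) / Del) ^+ 2).
    have -> : (fun x => ((gM x - g 0) / Del) ^+ 2) = (fun x => (Del ^+ 2)^-1 * (gM x - g 0) ^+ 2).
      by apply/funext => x; rewrite exprMn exprVn mulrC.
    rewrite RintegZ; last by rewrite qE; exact: rintegrableB.
    by rewrite mulrC.
  apply: (proj2 (@Rinteg_dct R _ _ P (fun n x => y n x ^+ 2) (fun x => ((gM x - g 0) / Del) ^+ 2)
     (fun=> (2 * CM / Del) ^+ 2) _ _ (iCM _) _)).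
  - exact: my2.
  - by move=> n x; rewrite normrX lerXn2r ?nnegrE// (le_trans _ (yC n x)).
  - move=> x; have yl : (fun n => y n x) @ \oo --> (gM x - g 0) / Del.
      by apply: cvgM; [apply: cvgB; [exact: gMl|exact: Ef0]|exact: cvg_cst].
    have -> : (fun n => y n x ^+ 2) = (fun n => y n x * y n x) by apply/funext => n; rewrite expr2.
    by rewrite expr2; exact: cvgM.
have mT n : measurable_fun setT (T n).
  apply: measurable_funM => //; apply: measurable_sum => j.
  exact: (measurable_compZ iid j (my n)).
have mrem n : measurable_fun setT (fun w => cre (rem n w)).
  pose F (v : Omega * R) := G n (- v.2) * Rfun (phin Z n v.1 v.2 / phi v.2) * FKh n v.2.
  suff mF : cmeasurable F by have [] := @cmeasurable_cint_param R _ _ _ _ (@leb R) F mF.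
  apply: cmeasurableM; last first.
    exact: (cmeasurable_snd (cmeasurable_fourier (rintegrable_meas (ik n)))).
  apply: cmeasurableM.
    have mGN : cmeasurable (fun u : R => G n (- u)).
      have [m1 [m2 _]] := gnG n.
      by apply: (cmeasurable_comp (f := G n)); [split|exact: measurable_funN].
    exact: (cmeasurable_snd mGN).
  apply: cmeasurable_Rfun; apply: cmeasurableM; first exact: (cmeasurable_phin2 iid n).
  exact: (cmeasurable_snd mphiV).
have mX n : measurable_fun setT (fun w => cre (RHS n w)).
  have -> : (fun w => cre (RHS n w)) = (fun w => T n w + c n * cre (rem n w)).
    by apply/funext => w; exact: creRHS.
  by apply: measurable_funD => //; exact: measurable_funM.
apply: levy_continuity_normal => // t.
have cT := clt_charfun iid my yC y0 yv t.
have mG n : cmeasurable (G n) by have [m1 [m2 _]] := gnG n; split.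
have [wI wR] := window_rate h0 hc d0 mG Grate.
pose J n := Rinteg (@leb R) (window (A n) (G n)).
pose q := 4 * B ^+ 2 * N.
have q0 : 0 <= q by apply: mulr_ge0 => //; apply: mulr_ge0 => //; exact: sqr_ge0.
(* The first term is the mean of [c n * q * sqdev]: the factor [sqrt n] in [c n] against the [4 / n]
   of the variance leaves [J n / sqrt n]. The second is the cost of the complement of [S n]. *)
pose a n := `|t| * (q * 4 / (pi *+ 2 * Del) * (J n / Num.sqrt n%:R)) + 2 * (1 - fine (Pr (S n))).
have a0 : a @ \oo --> (0 : R).
  rewrite -[X in _ --> X](_ : `|t| * (q * 4 / (pi *+ 2 * Del) * 0) + 2 * (1 - 1) = 0); last by rewrite subrr !mulr0 addr0.
  apply: cvgD; apply: cvgM; [exact: cvg_cst| |exact: cvg_cst|].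
    by apply: cvgM; [exact: cvg_cst|exact: wR].
  by apply: cvgB; [exact: cvg_cst|exact: PS].
have D : ccvg (fun n => charfun Pr (fun w => cre (RHS n w)) t - charfun Pr (T n) t) 0.
  apply: (@ccvg_le _ _ _ a) a0; near=> n; rewrite subr0.
  have n0 : (0 < n)%N by near: n; exists 1%N.
  have iW : (@leb R).-integrable setT (EFin \o window (A n) (G n)) by near: n.
  have W0 u : 0 <= window (A n) (G n) u := window_ge0 _ _ u.
  have isq := rintegrable_sqdev iid n iW W0.
  have SD w : S n w -> `|cre (RHS n w) - T n w| <= c n * q * sqdev Z P (window (A n) (G n)) n w.
    move=> Sw; rewrite creRHS addrAC subrr add0r normrM [`|c n|]ger0_norm ?c0// -mulrA.
    apply: ler_wpM2l; first exact: c0.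
    apply: (le_trans (cre_le_cabs _)).
    have := cabs_remainder Pphi phi0 mphiV phiVB (gnG n) (ik n) (kA n) (kN n) (zS n w Sw) iW.
    have -> : sqdev Z P (window (A n) (G n)) n w = Rinteg (@leb R)
        (fun u => \1_`[- A n, A n] u * cabs (G n (- u)) * cabs (phin Z n w u - phi u) ^+ 2).
      by congr Rinteg; apply/funext => u; rewrite Pphi.
    exact.
  have iD : Pr.-integrable setT (EFin \o (fun w => c n * q * sqdev Z P (window (A n) (G n)) n w)).
    exact: rintegrableZ.
  have cq0 : 0 <= c n * q by rewrite mulr_ge0.
  have D0 w : 0 <= c n * q * sqdev Z P (window (A n) (G n)) n w.
    by rewrite mulr_ge0// sqdev_ge0.
  apply: (le_trans (charfun_close t (mX n) (mT n) iD D0 (mS n) SD)).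
  rewrite /a lerD2r; apply: ler_wpM2l => //; rewrite RintegZ//.
  apply: (le_trans (ler_wpM2l cq0 (sqdev_mean iid iW W0 n0))).
  have s0 : Num.sqrt n%:R != 0 :> R by rewrite sqrtr_eq0 -ltNge ltr0n.
  have ss : n%:R = Num.sqrt n%:R * Num.sqrt n%:R :> R by rewrite -expr2 sqr_sqrtr.
  rewrite /c -/(J n); move: (Num.sqrt n%:R) s0 ss (pi *+ 2 : R) (@pi2_neq0 R) => r s0 -> p p0.
  rewrite le_eqVlt; apply/orP; left; apply/eqP; field.
  by rewrite s0 p0 gt_eqF.
have := ccvgD D cT; rewrite add0r; apply: near_ccvg; apply: nearW => n.
by rewrite subrK.
Unshelve. all: by end_near. Qed.
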